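(* There is an absolute constant $C>0$ with the following property. Let $\mathcal{M}=(\mathcal{X},\mathcal{L})$ be a metrical task system with $|\mathcal{X}|=N$ and $D=\max_{x,y\in\mathcal{X}}d(x,y)$, and let $\mathcal{A}_{\mathrm{base}}$ be an online algorithm for $\mathcal{M}$ with competitive ratio $\alpha\ge 1$. Then there is an online algorithm $\mathcal{A}$ for $\mathcal{M}$ (given the time horizon $T$) such that: 1. $\mathcal{A}$ has competitive ratio $\alpha$; 2. the regret of $\mathcal{A}$ on every time interval $I\subseteq\{1,\dots,T\}$ is at most $C\left(D\sqrt{|I|\log T}+\sqrt{(D+1)|I|\log(NT)}\right)$. Furthermore, the per-round computational overhead of $\mathcal{A}$ on top of $\mathcal{A}_{\mathrm{base}}$ is $O(N\log T)$.
   Context: Metrical task system (MTS): a pair $(\mathcal{X},\mathcal{L})$ where $\mathcal{X}$ is an $N$-point (pseudo-)metric space with distance $d$ (its points are called states) and $\mathcal{L}\subseteq[0,1]^{\mathcal{X}}$ is a collection of possible loss vectors. At each step $t=1,\dots,T$ the (possibly randomized) online algorithm is first given a loss vector $l_t\in\mathcal{L}$ and then chooses a state $i_t\in\mathcal{X}$; it pays $l_t(i_t)$ and, for $t\ge 2$, a movement cost $d(i_t,i_{t-1})$. The loss sequence is fixed in advance (oblivious adversary) and $T$ is known to the algorithm. Competitive ratio: an algorithm has competitive ratio $\alpha\ge1$ if there is a constant $\beta>0$ independent of $T$ such that for every $T$ and every loss sequence $l_1,\dots,l_T\in\mathcal{L}$ $$\mathbb{E}\Big[\sum_{t=1}^Tl_t(i_t)+\sum_{t=2}^Td(i_t,i_{t-1})\Big]\le\alpha\min_{i_1^*,\dots,i_T^*\in\mathcal{X}}\Big(\sum_{t=1}^Tl_t(i_t^*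 )+\sum_{t=2}^Td(i_t^*,i_{t-1}^* )\Big)+\beta.$$ Time interval: a set $I=\{t_0+1,\dots,t_0+k\}\subseteq\{1,\dots,T\}$ of consecutive steps, $|I|=k$. The regret on $I$ is the smallest $R(I)$ such that for every loss sequence in $\mathcal{L}$ $$\mathbb{E}\Big[\sum_{t\in I} l_t(i_t)+\sum_{t\in I\setminus\{t_0+1\}}d(i_t,i_{t-1})\Big]\le\min_{x\in\mathcal{X}}\sum_{t\in I}l_t(x)+R(I).$$ Computation model: arithmetic operations, exponentiation, evaluating the error function, and sampling uniformly from $[0,1]$ each cost $O(1)$. *)

(* Defs.v *)
From HB Require Import structures.
From mathcomp Require Import all_boot all_order all_algebra.
From mathcomp Require Import all_classical all_reals all_analysis.

Set Implicit Arguments.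
Unset Strict Implicit.
Unset Printing Implicit Defensive.

Import Order.TTheory GRing.Theory Num.Theory.
Import numFieldNormedType.Exports.

Local Open Scope classical_set_scope.
Local Open Scope ring_scope.

(** * Metrical task systems and online algorithms *)

Record mts (R : realType) (X : finType) := MTS {
  dist : X -> X -> R;
  dist_refl : forall x, dist x x = 0;
  dist_sym : forall x y, dist x y = dist y x;
  dist_triangle : forall x y z, dist x z <= dist x y + dist y z;
  losses : set (X -> R);
  losses_01 : forall l, losses l -> forall x, 0 <= l x <= 1 }.

Definition diameter (R : realType) (X : finType) (M : mts R X) : R :=
  \big[Num.max/0]_(x : X) \big[Num.max/0]_(y : X) dist M x y.

(* Steps are numbered from 1 as in the text; [l t] is meaningful only for
   [1 <= t <= T]. *)
Definition loss_sequence (R : realType) (X : finType) (M : mts R X)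
    (T : nat) (l : nat -> X -> R) : Prop :=
  forall t, (1 <= t <= T)%N -> losses M (l t).

(* A randomized algorithm (for one fixed horizon) is a random deterministic
   strategy: [respond w [:: l_1; ...; l_t]] is the state chosen at step t.
   The adversary being oblivious, losses do not depend on [w]. *)
Record online_alg (R : realType) (X : finType) (M : mts R X) := OnlineAlg {
  alg_display : measure_display;
  alg_space : measurableType alg_display;
  alg_prob : probability alg_space R;
  respond : alg_space -> seq (X -> R) -> X;
  respond_measurable : forall (l : nat -> X -> R) (t : nat) (x : X),
    loss_sequence M t l ->
    measurable [set w | respond w [seq l s | s <- iota 1 t] = x] }.

Definition state_at (R : realType) (X : finType) (M : mts R X)
    (A : online_alg M) (l : nat -> X -> R) (w : alg_space A) (t : nat) : X :=
  respond w [seq l s | s <- iota 1 t].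

(* Cost of the trajectory [i] on the steps t0+1, ..., t0+k, without the
   movement into step t0+1. *)
Definition cost (R : realType) (X : finType) (M : mts R X)
    (l : nat -> X -> R) (i : nat -> X) (t0 k : nat) : R :=
  \sum_(t0.+1 <= t < (t0 + k).+1) l t (i t)
  + \sum_(t0.+2 <= t < (t0 + k).+1) dist M (i t) (i t.-1).

Definition expected_cost (R : realType) (X : finType) (M : mts R X)
    (A : online_alg M) (l : nat -> X -> R) (t0 k : nat) : \bar R :=
  ('E_(alg_prob A)[fun w => cost M l (state_at l w) t0 k])%E.

(* Only i_1, ..., i_T matter, so for nonempty [X] the infimum ranges over
   finitely many values and is a minimum. *)
Definition offline_opt (R : realType) (X : finType) (M : mts R X)
    (T : nat) (l : nat -> X -> R) : \bar R :=
  ereal_inf (range (fun i : nat -> X => (cost M l i 0%N T)%:E)).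

Definition has_competitive_ratio (R : realType) (X : finType) (M : mts R X)
    (A : nat -> online_alg M) (alpha : R) : Prop :=
  1 <= alpha /\
  exists2 beta : R, 0 < beta &
    forall (T : nat) (l : nat -> X -> R), loss_sequence M T l ->
      (expected_cost (A T) l 0%N T
         <= alpha%:E * offline_opt M T l + beta%:E)%E.

Definition best_fixed_loss (R : realType) (X : finType)
    (l : nat -> X -> R) (t0 k : nat) : \bar R :=
  ereal_inf (range (fun x : X => (\sum_(t0.+1 <= t < (t0 + k).+1) l t x)%:E)).

(* The set of admissible [r] is closed, so the infimum is its least element
   whenever there is one; it is [-oo] if there are no loss sequences. *)
Definition regret (R : realType) (X : finType) (M : mts R X)
    (A : online_alg M) (T t0 k : nat) : \bar R :=
  ereal_inf [set r%:E | r in [set r : R |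
    forall l : nat -> X -> R, loss_sequence M T l ->
      (expected_cost A l t0 k <= best_fixed_loss l t0 k + r%:E)%E]].

(** * Computation model

   A real-number random access machine in structured form, with integer and
   real cells, indirect addressing, no real constants, and unit-cost
   operations. Outside their usual domain, division and exponentiation follow
   the library ([x / 0 = 0], [powR x y = 1] for [x < 0]). *)

Definition erf (R : realType) (x : R) : R :=
  Num.sg x * (2 / Num.sqrt pi)
  * \int[@lebesgue_measure R]_(t in `[0, `|x|]) gauss_fun t.

Inductive iexpr :=
| INat of nat
| IHorizon
| IStates
| IBase
| ICell of iexpr
| IAdd of iexpr & iexpr
| ISub of iexpr & iexpr
| IMul of iexpr & iexpr.

Inductive rexpr :=
| RNat of iexpr
| RDiameter
| RLoss of iexpr
| RDist of iexpr & iexpr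
| RCell of iexpr
| RAdd of rexpr & rexpr
| RSub of rexpr & rexpr
| RMul of rexpr & rexpr
| RDiv of rexpr & rexpr
| RExp of rexpr
| RPow of rexpr & rexpr
| RErf of rexpr.

Inductive bexpr :=
| ILe of iexpr & iexpr
| RLe of rexpr & rexpr
| BNot of bexpr
| BAnd of bexpr & bexpr.

Inductive cmd :=
| Skip
| SetI of iexpr & iexpr
| SetR of iexpr & rexpr
| Sample of iexpr
| Seq of cmd & cmd
| If of bexpr & cmd & cmd
| While of bexpr & cmd.

Fixpoint icost (e : iexpr) : nat :=
  match e with
  | INat _ | IHorizon | IStates | IBase => 1
  | ICell a => (icost a).+1
  | IAdd a b | ISub a b | IMul a b => (icost a + icost b).+1
  end.

Fixpoint rcost (e : rexpr) : nat :=
  match e with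
  | RDiameter => 1
  | RNat a | RLoss a | RCell a => (icost a).+1
  | RDist a b => (icost a + icost b).+1
  | RExp a | RErf a => (rcost a).+1
  | RAdd a b | RSub a b | RMul a b | RDiv a b | RPow a b =>
      (rcost a + rcost b).+1
  end.

Fixpoint bcost (e : bexpr) : nat :=
  match e with
  | ILe a b => (icost a + icost b).+1
  | RLe a b => (rcost a + rcost b).+1
  | BNot a => (bcost a).+1
  | BAnd a b => (bcost a + bcost b).+1
  end.

(* What a program can read during a round; states are given by their
   index. *)
Record input (R : realType) := Input {
  in_horizon : nat;
  in_states : nat;
  in_base : nat;
  in_diameter : R;
  in_loss : nat -> R;
  in_dist : nat -> nat -> R }.

(* [tape]: the uniform samples not consumed yet. *)
Record store (R : realType) := Store {
  icell : nat -> nat;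
  rcell : nat -> R;
  tape : seq R }.

Fixpoint ieval (R : realType) (inp : input R) (s : store R) (e : iexpr) : nat :=
  match e with
  | INat n => n
  | IHorizon => in_horizon inp
  | IStates => in_states inp
  | IBase => in_base inp
  | ICell a => icell s (ieval inp s a)
  | IAdd a b => (ieval inp s a + ieval inp s b)%N
  | ISub a b => (ieval inp s a - ieval inp s b)%N
  | IMul a b => (ieval inp s a * ieval inp s b)%N
  end.

Fixpoint reval (R : realType) (inp : input R) (s : store R) (e : rexpr) : R :=
  match e with
  | RNat a => (ieval inp s a)%:R
  | RDiameter => in_diameter inp
  | RLoss a => in_loss inp (ieval inp s a)
  | RDist a b => in_dist inp (ieval inp s a) (ieval inp s b)
  | RCell a => rcell s (ieval inp s a)
  | RAdd a b => reval inp s a + reval inp s b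
  | RSub a b => reval inp s a - reval inp s b
  | RMul a b => reval inp s a * reval inp s b
  | RDiv a b => reval inp s a / reval inp s b
  | RExp a => expR (reval inp s a)
  | RPow a b => powR (reval inp s a) (reval inp s b)
  | RErf a => erf (reval inp s a)
  end.

Fixpoint beval (R : realType) (inp : input R) (s : store R) (e : bexpr) : bool :=
  match e with
  | ILe a b => (ieval inp s a <= ieval inp s b)%N
  | RLe a b => reval inp s a <= reval inp s b
  | BNot a => ~~ beval inp s a
  | BAnd a b => beval inp s a && beval inp s b
  end.

Definition set_icell (R : realType) (s : store R) (a v : nat) : store R :=
  Store (fun j => if j == a then v else icell s j) (rcell s) (tape s).

Definition set_rcell (R : realType) (s : store R) (a : nat) (v : R) : store R :=
  Store (icell s) (fun j => if j == a then v else rcell s j) (tape s).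

(* [exec inp c s n s']: from [s], the command [c] terminates in [s'] after [n]
   unit-cost operations. Sampling from an exhausted tape is stuck. *)
Inductive exec (R : realType) (inp : input R) :
    cmd -> store R -> nat -> store R -> Prop :=
| exec_skip s :
    exec inp Skip s 1 s
| exec_seti a e s :
    exec inp (SetI a e) s (icost a + icost e).+1
      (set_icell s (ieval inp s a) (ieval inp s e))
| exec_setr a e s :
    exec inp (SetR a e) s (icost a + rcost e).+1
      (set_rcell s (ieval inp s a) (reval inp s e))
| exec_sample a s u us :
    tape s = u :: us ->
    exec inp (Sample a) s (icost a).+1
      (set_rcell (Store (icell s) (rcell s) us) (ieval inp s a) u)
| exec_seq c1 c2 s1 s2 s3 n1 n2 :
    exec inp c1 s1 n1 s2 -> exec inp c2 s2 n2 s3 ->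
    exec inp (Seq c1 c2) s1 (n1 + n2) s3
| exec_if b c1 c2 s s' n :
    exec inp (if beval inp s b then c1 else c2) s n s' ->
    exec inp (If b c1 c2) s (bcost b + n).+1 s'
| exec_while_false b c s :
    ~~ beval inp s b ->
    exec inp (While b c) s (bcost b).+1 s
| exec_while_true b c s1 s2 s3 n1 n2 :
    beval inp s1 b ->
    exec inp c s1 n1 s2 -> exec inp (While b c) s2 n2 s3 ->
    exec inp (While b c) s1 (bcost b + n1 + n2).+1 s3.

Definition state_index (X : finType) (x : X) : nat := index x (enum X).

(* Out-of-range indices read as 0. *)
Definition round_input (R : realType) (X : finType) (M : mts R X)
    (T : nat) (l : X -> R) (b : X) : input R :=
  Input T #|X| (state_index b) (diameter M)
    (fun i => nth 0 [seq l x | x <- enum X] i)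
    (fun i j =>
       nth 0 (nth [::] [seq [seq dist M x y | y <- enum X] | x <- enum X] i) j).

Definition initial_store (R : realType) (us : seq R) : store R :=
  Store (fun _ => 0%N) (fun _ => 0) us.

(* [A] runs one copy [base w] of [B] on the same losses and, after seeing its
   state in each round, spends at most [n] operations executing [prog], which
   leaves the index of the state to play in integer cell 0. The sample space of
   [A] carries the randomness of [B] together with [m] uniform samples on [0,1],
   all mutually independent: this is what the joint law says. Memory persists
   across rounds and is blank before the first one. *)
Definition implemented_on_top_of (R : realType) (X : finType) (M : mts R X)
    (T : nat) (B A : online_alg M) (prog : cmd) (n : R) : Prop :=
  exists (base : alg_space A -> alg_space B)
         (m : nat) (coin : nat -> alg_space A -> R),
  [/\ measurable_fun setT base,
      forall j, measurable_fun setT (coin j),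
      forall (S : set (alg_space B)) (V : nat -> set R),
        measurable S -> (forall j, measurable (V j)) ->
        (alg_prob A (base @^-1` S `&` \bigcap_(j in `I_m) (coin j @^-1` V j))
         = alg_prob B S
           * \prod_(j < m) lebesgue_measure (V j `&` `[0%R, 1%R]))%E
    & forall (l : nat -> X -> R) (w : alg_space A), loss_sequence M T l ->
        exists sigma : nat -> store R,
          sigma 0%N = initial_store [seq coin j w | j <- iota 0 m] /\
          forall t, (1 <= t <= T)%N ->
            exists k : nat,
            [/\ k%:R <= n,
                exec (round_input M T (l t) (state_at l (base w) t))
                  prog (sigma t.-1) k (sigma t)
              & icell (sigma t) 0%N = state_index (state_at l w t)]].

(* Main.v *)
Require Import Defs.
From HB Require Import structures.
From mathcomp Require Import all_boot all_order all_algebra.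
From mathcomp Require Import all_classical all_reals all_analysis.
From mathcomp Require Import measurable_realfun.
From mathcomp Require Import ring lra zify.

Set Implicit Arguments.
Unset Strict Implicit.
Unset Printing Implicit Defensive.

Import Order.TTheory GRing.Theory Num.Theory.
Import numFieldNormedType.Exports.

Local Open Scope classical_set_scope.
Local Open Scope ring_scope.

(* Everything is done conditionally on the trajectory of the base algorithm.
   The experts are the states and the base algorithm. A chain of two-expert
   combinations, one for each scale [h = 2^-j], turns the base algorithm into
   better and better mixtures: a level mixes the current mixture (its default)
   with a fixed-share distribution [q] on states, putting weight [g] on [q].
   The weight is updated by [g := clip (g (1 + eta r))], [r] being the loss of
   the default minus the loss of [q], where [q] is charged in advance for the
   movement that changing [g] causes. As [g] moves by [eta g r], the gain
   [sum g r] telescopes: the regret to the default is [floor / eta] over the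
   whole horizon and at most [1 / eta] on an interval, while the regret to [q]
   is controlled by the potential [ln g - g]. Treating the large scales first
   makes the [1 / eta] of the finer scales sum to a geometric series, whence the
   interval regret; the floor [1 / T^2] makes the loss to the base algorithm
   constant.
   The mixtures are realized by maximal couplings, driven by a single uniform
   coin: once the current expert is known, the relative position of the coin in
   the cell it fell in is again uniform. *)

(** * Combining two experts *)

(** Keeping the ratio [alpha] exactly means that the loss against the base algorithm may not grow
    with [T]. An expert algorithm treating the base and the states alike would lose order sqrt(T) to
    both; hence the asymmetric rule, which protects the default and lets the expert pay. An interval
    of length k is served by the level whose h is close to sqrt(log T / k): there log T / h and k h
    balance, which gives the term D sqrt(k log T). The fixed share of that level, run with exponent
    [tuning] times h, gives the term with log(NT). Level 0 has the smallest h and serves the longest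
    intervals; there are about log T levels, whence the overhead O(N log T). Movement couples
    consecutive rounds. Charging it in advance decouples them: a multiplicative update changes a
    weight by at most h times its new value, so an expert pays in proportion to the weight it holds.
    The machine has neither logarithm nor square root: digit counts replace logarithms, a power with
    exponent 1/2 the root. *)

Section LogBounds.
Context {R : realType}.
Implicit Types x y : R.

Lemma ln_le_subr1 x : 0 < x -> ln x <= x - 1.
Proof. by move=> x0; have := @le_ln1Dx R (x - 1); rewrite addrCA subrr addr0; apply; lra. Qed.

Lemma ln_ge_1subV x : 0 < x -> 1 - x^-1 <= ln x.
Proof.
move=> x0; have := ln_le_subr1 (_ : 0 < x^-1); rewrite invr_gt0 => /(_ x0).
by rewrite lnV ?posrE//; lra.
Qed.

Lemma ln1D_ge y : `|y| <= 2^-1 -> y - 2 * y ^+ 2 <= ln (1 + y).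
Proof.
move=> hy; have hy' : - 2^-1 <= y <= 2^-1 by rewrite -ler_norml.
have p : 0 < 1 + y by lra.
apply: le_trans (ln_ge_1subV p).
have -> : 1 - (1 + y)^-1 = y / (1 + y) by field; lra.
by rewrite ler_pdivlMr//; nra.
Qed.

End LogBounds.

Section TwoExperts.
Context {R : realType}.
Implicit Types eps eta B : R.

Definition clip eps (z : R) : R := Num.max eps (Num.min 1 z).

Lemma clip_bounds eps z : eps <= 1 -> eps <= clip eps z <= 1.
Proof.
by move=> e1; rewrite /clip le_max lexx/= ge_max e1/= ge_min lexx.
Qed.

Variant clip_spec eps z : R -> Prop :=
| ClipLow of z < eps : clip_spec eps z eps
| ClipMid of eps <= z & z <= 1 : clip_spec eps z z
| ClipHigh of 1 < z : clip_spec eps z 1.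

Lemma clipP eps z : eps <= 1 -> clip_spec eps z (clip eps z).
Proof.
move=> e1; rewrite /clip; case: (leP 1 z) => z1.
  rewrite max_r//; case: (eqVneq z 1) => [->|zn]; first by constructor.
  by constructor; rewrite lt_neqAle eq_sym zn.
by case: (leP eps z) => ze; constructor => //; exact: ltW.
Qed.

Variables (eps eta B : R) (g r : nat -> R).
Hypotheses (eps01 : 0 < eps <= 1) (eta0 : 0 < eta) (etaB : eta * B <= 2^-1).
Hypothesis rB : forall t, `|r t| <= B.
Hypothesis gE : forall t, g t.+1 = clip eps (g t * (1 + eta * r t)).

Lemma weight_bounds t : eps <= g t.+1 <= 1.
Proof. by rewrite gE; apply: clip_bounds; case/andP: eps01. Qed.

Let etar t : `|eta * r t| <= eta * B.
Proof. by rewrite normrM (gtr0_norm eta0) ler_pM2l. Qed.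

Let factor t : 2^-1 <= 1 + eta * r t.
Proof. by have := etar t; move: (etaB); rewrite ler_norml; lra. Qed.

(** Only clipping from below exceeds the linear update, and by at most [eps * (eta * B)], since the
    weight was at least [eps] before the update. *)
Lemma weight_step t :
  g t.+2 <= g t.+1 + eta * (g t.+1 * r t.+1) + eps * (eta * B).
Proof.
have := eps01; have := etaB => eB e01.
have := weight_bounds t; set a := g t.+1 => ha.
rewrite (gE t.+1) -/a.
have := etar t.+1; rewrite ler_norml; set y := eta * r t.+1 => hy.
have -> : eta * (a * r t.+1) = a * y by rewrite /y; ring.
by case: clipP; [lra|nra|nra|nra].
Qed.

(** Measured against the new weight, because [mix_move_loss] charges the movement to the expert in
    proportion to that weight. The update factor is at least 1/2, which costs the 2. *)
Lemma weight_move t : `|g t.+2 - g t.+1| <= 2 * (eta * B) * g t.+2.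
Proof.
have := eps01; have := etaB => eB e01.
have := weight_bounds t; set a := g t.+1 => ha.
rewrite (gE t.+1) -/a.
have := etar t.+1; rewrite ler_norml; set y := eta * r t.+1 => hy.
set b := eta * B in eB hy *; have b0 : 0 <= b by lra.
have a0 : 0 < a by lra.
have hb : b <= 2 * b * (1 + y) by have : 0 <= b * (1 + 2 * y); [rewrite mulr_ge0//; lra|lra].
have hab : a * b <= a * (2 * b * (1 + y)) by rewrite ler_pM2l//; lra.
have hay : - (a * b) <= a * y <= a * b by rewrite -mulrN !(ler_pM2l a0).
rewrite ler_norml; case: clipP; [lra|nra|nra|nra].
Qed.

(** The potential [ln g - g] has derivative [(1 - g) / g], so a step [eta * g * r] gains
    [eta * (1 - g) * r] to first order. It increases on (0, 1] and peaks at 1, so clipping at either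
    end can only raise it. *)
Lemma weight_log_step t :
  ln (g t.+1) - g t.+1 + eta * ((1 - g t.+1) * r t.+1) - 2 * (eta * B) ^+ 2
  <= ln (g t.+2) - g t.+2.
Proof.
have := eps01; have := etaB => eB e01.
have := weight_bounds t; set a := g t.+1 => ha.
rewrite (gE t.+1) -/a.
have := etar t.+1; set y := eta * r t.+1 => hy.
have fy : 2^-1 <= 1 + y := factor t.+1.
have hz : ln (a * (1 + y)) = ln a + ln (1 + y) by rewrite lnM// posrE; lra.
have h1 : y - 2 * y ^+ 2 <= ln (1 + y) by apply: ln1D_ge; apply: le_trans hy _.
have h2 : y ^+ 2 <= (eta * B) ^+ 2.
  rewrite -[y ^+ 2]real_normK ?num_real// ler_sqr ?nnegrE ?normr_ge0//.
  exact: le_trans hy.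
have -> : eta * ((1 - a) * r t.+1) = (1 - a) * y by rewrite /y; ring.
have main : ln a - a + (1 - a) * y - 2 * (eta * B) ^+ 2
     <= ln (a * (1 + y)) - a * (1 + y) by rewrite hz; nra.
apply: le_trans main _; set z := a * (1 + y).
have z0 : 0 < z by rewrite /z; nra.
case: clipP => //; first by case/andP: e01.
- move=> ze.
  have : ln (z / eps) <= z / eps - 1 by apply: ln_le_subr1; rewrite divr_gt0//; lra.
  have ep : 0 < eps by lra.
  rewrite lnM ?posrE ?invr_gt0// lnV ?posrE//.
  have : z / eps - 1 <= z - eps.
    rewrite lerBlDr ler_pdivrMr; last lra.
    by nra.
  lra.
- by move=> z1; rewrite ln1; have := ln_le_subr1 z0; lra.
Qed.

Lemma default_regret t0 k :
  \sum_(t0.+1 <= t < (t0 + k).+1) - (g t * r t)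
  <= (g t0.+1 - g (t0 + k).+1) / eta + k%:R * (eps * B).
Proof.
elim: k => [|k IH]; first by rewrite addn0 big_geq// subrr mul0r mul0r addr0.
rewrite addnS big_nat_recr/=; last by rewrite ltnS leq_addr.
have := weight_step (t0 + k); set a := g (t0 + k).+1; set b := g (t0 + k).+2 => h.
have h' : - (a * r (t0 + k).+1) <= (a - b) / eta + eps * B.
  rewrite -(ler_pM2l eta0) mulrDr mulrCA mulfV ?gt_eqF// mulr1.
  have -> : eta * (eps * B) = eps * (eta * B) by ring.
  lra.
rewrite -natr1 !mulrBl mulrDl mul1r.
move: h' IH; rewrite !mulrBl -/a -/b; lra.
Qed.

(** On [[eps, 1]] the potential stays between [ln eps - eps] and [-1], so the two ends of the
    telescoping sum cost at most [ln eps^-1], wherever the interval begins. *)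
Lemma expert_regret t0 k :
  \sum_(t0.+1 <= t < (t0 + k).+1) (1 - g t) * r t
  <= ln eps^-1 / eta + k%:R * (2 * eta * B ^+ 2).
Proof.
have := eps01 => e01.
rewrite -(ler_pM2l eta0) mulrDr mulrCA mulfV ?gt_eqF// mulr1.
have aux n : eta * (\sum_(t0.+1 <= t < (t0 + n).+1) (1 - g t) * r t) <=
  ln (g (t0 + n).+1) - g (t0 + n).+1 - (ln (g t0.+1) - g t0.+1)
    + n%:R * (2 * (eta * B) ^+ 2).
  elim: n => [|n IH].
    by rewrite addn0 big_geq// mulr0 mul0r subrr addr0.
  rewrite addnS big_nat_recr/=; last by rewrite ltnS leq_addr.
  have := weight_log_step (t0 + n); rewrite -natr1 mulrDl mul1r mulrDr; lra.
apply: le_trans (aux k) _.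
have -> : eta * (k%:R * (2 * eta * B ^+ 2)) = k%:R * (2 * (eta * B) ^+ 2) by ring.
have := weight_bounds (t0 + k); have := weight_bounds t0.
set a := g t0.+1; set b := g _ => ha hb.
rewrite lnV ?posrE; last lra.
have : ln eps - eps <= ln a - a.
  have : ln (eps / a) <= eps / a - 1 by apply: ln_le_subr1; rewrite divr_gt0//; lra.
  have ap : 0 < a by lra.
  have ep : 0 < eps by lra.
  rewrite lnM ?posrE ?invr_gt0// lnV ?posrE//.
  have : eps / a - 1 <= eps - a; last lra.
  rewrite lerBlDr ler_pdivrMr; last lra.
  nra.
have : ln b <= b - 1 by apply: ln_le_subr1; lra.
lra.
Qed.

End TwoExperts.

(** * Fixed share and mixtures *)

Section FixedShare.
Context {R : realType}.
Variables (N : nat) (gam eta : R).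
Hypotheses (N0 : (0 < N)%N) (gam01 : 0 < gam < 1) (eta0 : 0 < eta).
Implicit Types (q l : nat -> R).

Definition share q x : R := (1 - gam) * q x + gam / N%:R.
Definition share_weight q l x : R := share q x * expR (- (eta * l x)).
(** Sharing precedes the exponential update, and the resulting distribution is the one played
    against [l] itself: a task system reveals the loss before the move. This is why [share_mix_loss]
    has no second-order term. *)
Definition share_step q l x : R :=
  share_weight q l x / \sum_(y < N) share_weight q l y.

(** Mass below 1 is allowed because the recursion starts from the zero vector, the content of blank
    memory; [share] turns it into the constant [gam / N]. *)
Definition subdistr q := (forall x, 0 <= q x) /\ \sum_(x < N) q x <= 1.

Let NR0 : (0 : R) < N%:R. Proof. by rewrite ltr0n. Qed.
Let g0 : 0 < gam. Proof. by case/andP: gam01. Qed.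
Let g1 : 0 < 1 - gam. Proof. by rewrite subr_gt0; case/andP: gam01. Qed.

Lemma share_ge q x : subdistr q -> gam / N%:R <= share q x.
Proof. by case=> q0 _; rewrite /share lerDr mulr_ge0// ltW. Qed.

Lemma share_gt0 q x : subdistr q -> 0 < share q x.
Proof. by move=> sq; apply: lt_le_trans (share_ge x sq); rewrite divr_gt0. Qed.

Lemma share_sum q : subdistr q -> \sum_(x < N) share q x <= 1.
Proof.
case=> q0 q1; rewrite /share big_split/= -mulr_sumr sumr_const card_ord.
rewrite -[_ *+ N]mulr_natr divfK ?gt_eqF//.
by have := ler_wpM2l (ltW g1) q1; lra.
Qed.

Lemma share_le1 q (x : 'I_N) : subdistr q -> share q x <= 1.
Proof.
move=> sq; apply: le_trans (share_sum sq).
rewrite (bigD1 x)//= lerDl sumr_ge0// => y _.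
exact/ltW/share_gt0.
Qed.

Lemma share_weight_gt0 q l x : subdistr q -> 0 < share_weight q l x.
Proof. by move=> sq; rewrite mulr_gt0 ?expR_gt0 ?share_gt0. Qed.

Lemma share_total_gt0 q l : subdistr q -> 0 < \sum_(y < N) share_weight q l y.
Proof.
move=> sq; rewrite (bigD1 (Ordinal N0))//= ltr_wpDr ?share_weight_gt0//.
by apply: sumr_ge0 => y _; exact/ltW/share_weight_gt0.
Qed.

Lemma share_step_gt0 q l x : subdistr q -> 0 < share_step q l x.
Proof. by move=> sq; rewrite divr_gt0 ?share_weight_gt0 ?share_total_gt0. Qed.

Lemma share_step_sum q l : subdistr q -> \sum_(x < N) share_step q l x = 1.
Proof.
by move=> sq; rewrite -mulr_suml mulfV// gt_eqF// share_total_gt0.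
Qed.

Lemma share_step_subdistr q l : subdistr q -> subdistr (share_step q l).
Proof.
by move=> sq; split=> [x|]; [exact/ltW/share_step_gt0|rewrite share_step_sum].
Qed.

(* Gibbs: [-ln Z = eta <q', l> + KL(q' || share q)], and KL is nonnegative. *)
Lemma share_mix_loss q l : subdistr q ->
  ln (\sum_(y < N) share_weight q l y)
  <= - (eta * \sum_(x < N) share_step q l x * l x).
Proof.
move=> sq; set Z := \sum_(y < N) _.
have Z0 : 0 < Z := share_total_gt0 l sq.
have key (x : 'I_N) : share_step q l x * ln Z <=
    - (eta * (share_step q l x * l x)) + (share q x - share_step q l x).
  set s := share_step q l x; have s0 : 0 < s := share_step_gt0 l x sq.
  have p0 := share_gt0 x sq.
  have -> : ln Z = ln (share q x / s) - eta * l x.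
    rewrite -[- (eta * l x)]expRK -lnM ?posrE ?expR_gt0 ?(divr_gt0 p0 s0)//.
    congr ln; rewrite /s /share_step -/Z /share_weight.
    by field; rewrite !gt_eqF ?expR_gt0 ?share_gt0 ?share_weight_gt0.
  have : s * ln (share q x / s) <= share q x - s; last first.
    by rewrite mulrBr [s * (eta * _)]mulrCA; move: (s * ln _) (eta * _) => a b; lra.
  have : ln (share q x / s) <= share q x / s - 1 by apply: ln_le_subr1; rewrite divr_gt0.
  move/(ler_wpM2l (ltW s0))/le_trans; apply.
  by rewrite mulrBr mulr1 mulrCA mulfV ?mulr1// gt_eqF.
rewrite -[ln Z]mul1r -(share_step_sum l sq) mulr_suml.
apply: le_trans (ler_sum _ (fun x _ => key x)) _.
rewrite big_split/= sumrN -mulr_sumr sumrB share_step_sum//.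
by have := share_sum sq; lra.
Qed.

(** The normalizer is at most 1 and no loss exceeds 1, so a state keeps this fraction of its mass.
    Through [shift_contract] this bounds the movement of a share in one round. *)
Lemma share_step_stable q l x : (forall y, 0 <= l y <= 1) -> subdistr q ->
  expR (- eta) * (1 - gam) * q x <= share_step q l x.
Proof.
move=> l01 sq; rewrite /share_step ler_pdivlMr ?share_total_gt0//.
have Z1 : \sum_(y < N) share_weight q l y <= 1.
  apply: le_trans (share_sum sq); apply: ler_sum => y _.
  rewrite /share_weight -[leRHS]mulr1 ler_wpM2l ?(ltW (share_gt0 _ _))//.
  by rewrite -expR0 ler_expR oppr_le0 mulr_ge0 ?(ltW eta0)//; case/andP: (l01 y).
have [q0 _] := sq.
apply: (@le_trans _ _ (expR (- eta) * (1 - gam) * q x)).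
  rewrite -[leRHS]mulr1 ler_wpM2l//.
  by rewrite !mulr_ge0 ?expR_ge0 ?(ltW g1).
rewrite -mulrA mulrC /share_weight ler_pM ?expR_ge0//.
- by rewrite mulr_ge0// ltW.
- by rewrite /share lerDl divr_ge0 ?ler0n// ltW.
- by rewrite ler_expR lerN2 -[leRHS]mulr1 ler_wpM2l ?(ltW eta0)//; case/andP: (l01 x).
Qed.

Section Sequence.
Variables (l q : nat -> nat -> R).
Hypothesis q0 : forall x, q 0%N x = 0.
Hypothesis qE : forall t x, q t.+1 x = share_step (q t) (l t.+1) x.

Lemma share_seq_subdistr t : subdistr (q t).
Proof.
elim: t => [|t IH].
  by split=> [x|]; [rewrite q0|rewrite big1// => x _; rewrite q0].
have [a b] := share_step_subdistr (l t.+1) IH.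
by split=> [x|]; [rewrite qE|under eq_bigr do rewrite qE].
Qed.

(** The potential is [ln (share (q t) x)]. A round loses [ln (1 - gam)^-1] to the sharing, but
    sharing also keeps the potential above [ln (gam / N)], so the interval may begin at any time. *)
Lemma share_regret (x : 'I_N) t0 k :
  \sum_(t0.+1 <= t < (t0 + k).+1) \sum_(y < N) q t y * l t y
  <= \sum_(t0.+1 <= t < (t0 + k).+1) l t x
     + (ln (N%:R / gam) + k%:R * ln (1 - gam)^-1) / eta.
Proof.
pose S n := \sum_(t0.+1 <= t < (t0 + n).+1) \sum_(y < N) q t y * l t y.
pose L n := \sum_(t0.+1 <= t < (t0 + n).+1) l t x.
have aux n : eta * S n + ln (share (q t0) x) + n%:R * ln (1 - gam)
    <= eta * L n + ln (share (q (t0 + n)%N) x).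
  elim: n => [|n IH].
    by rewrite /S /L addn0 !big_geq// !mulr0 !mul0r !add0r addr0.
  have -> : S n.+1 = S n + \sum_(y < N) q (t0 + n).+1 y * l (t0 + n).+1 y.
    by rewrite /S addnS big_nat_recr// ltnS leq_addr.
  have -> : L n.+1 = L n + l (t0 + n).+1 x.
    by rewrite /L addnS big_nat_recr// ltnS leq_addr.
  rewrite addnS.
  set u := (t0 + n)%N; have su := share_seq_subdistr u.
  have mix := share_mix_loss (l u.+1) su.
  set Z := \sum_(y < N) share_weight _ _ y in mix.
  have Z0 : 0 < Z := share_total_gt0 _ su.
  have h1 : (1 - gam) * (share (q u) x * expR (- (eta * l u.+1 x)) / Z)
      <= share (q u.+1) x.
    by rewrite /share qE lerDl divr_ge0 ?ler0n ?ltW.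
  have p0 := share_gt0 x su.
  have h2 : ln (1 - gam) + (ln (share (q u) x) - eta * l u.+1 x - ln Z)
      <= ln (share (q u.+1) x).
    move: h1; rewrite -ler_ln ?posrE ?share_gt0 ?mulr_gt0 ?expR_gt0 ?invr_gt0//;
      last exact: share_seq_subdistr.
    by rewrite !lnM ?posrE ?mulr_gt0 ?expR_gt0 ?invr_gt0// lnV ?posrE// expRK.
  have e : \sum_(y < N) q u.+1 y * l u.+1 y =
      \sum_(x < N) share_step (q u) (l u.+1) x * l u.+1 x.
    by apply: eq_bigr => y _; rewrite qE.
  rewrite -e in mix.
  by move: IH h2 mix; rewrite -/u -natr1; set A := \sum_(y < N) _; lra.
rewrite -(ler_pM2l eta0) mulrDr [X in _ + X]mulrCA mulfV ?gt_eqF// mulr1.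
have := aux k; rewrite -/(S k) -/(L k).
rewrite !lnV ?lnM ?posrE ?invr_gt0// lnV ?posrE//.
have st0 := share_seq_subdistr t0.
have : ln (gam / N%:R) <= ln (share (q t0) x).
  by rewrite ler_ln ?posrE ?share_gt0 ?divr_gt0// share_ge.
have : ln (share (q (t0 + k)%N) x) <= 0.
  by apply: ln_le0; apply: share_le1; apply: share_seq_subdistr.
rewrite lnM ?posrE ?invr_gt0// lnV ?posrE//; lra.
Qed.

End Sequence.
End FixedShare.

(** * Total variation distance between mixtures *)

Section Mixtures.
Context {R : realType}.
Implicit Types (P Q p q : nat -> R).

(** For equal masses this is the total variation distance: the mass that has to leave its place to
    turn [P] into [Q]. *)
Definition shift n P Q : R := \sum_(f < n) Num.max 0 (P f - Q f).

Lemma shift_ge0 n P Q : 0 <= shift n P Q.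
Proof. by apply: sumr_ge0 => f _; rewrite le_max lexx. Qed.

Lemma shift_contract n P Q a : 0 <= a <= 1 -> (forall f, 0 <= P f) ->
  \sum_(f < n) P f <= 1 -> (forall f, a * P f <= Q f) -> shift n P Q <= 1 - a.
Proof.
move=> /andP[a0 a1] P0 P1 PQ.
apply: (@le_trans _ _ (\sum_(f < n) (1 - a) * P f)).
  apply: ler_sum => f _; rewrite ge_max mulr_ge0 ?subr_ge0//=.
  by have := PQ f; lra.
by rewrite -mulr_sumr -[leRHS]mulr1 ler_wpM2l// subr_ge0.
Qed.

(** The difference splits as [(b - a) * (P - p) + (1 - b) * (P - Q) + b * (p - q)]. The new weight
    [b] stands on the last two terms, as in [cost_at_mix]. *)
Lemma shift_mix n P Q p q (a b : R) :
  0 <= b <= 1 ->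
  (forall f, 0 <= P f) -> (forall f, 0 <= p f) ->
  \sum_(f < n) P f = 1 -> \sum_(f < n) p f = 1 ->
  shift n (fun f => (1 - a) * P f + a * p f) (fun f => (1 - b) * Q f + b * q f)
  <= `|b - a| + (1 - b) * shift n P Q + b * shift n p q.
Proof.
move=> /andP[b0 b1] P0 p0 P1 p1.
have maxD (x y : R) : Num.max 0 (x + y) <= Num.max 0 x + Num.max 0 y.
  by rewrite ge_max addr_ge0 ?le_max ?lexx//= lerD// le_max lexx orbT.
have maxM (c x : R) : 0 <= c -> Num.max 0 (c * x) = c * Num.max 0 x.
  by move=> c0; rewrite -[LHS]/(Num.max 0 (c * x)) maxr_pMr// mulr0.
pose m f : R := Num.max 0 ((b - a) * (P f - p f)).
have hm : \sum_(f < n) m f <= `|b - a|.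
  case: (ger0P (b - a)) => [ab|ba].
    rewrite -[leRHS]mulr1 -P1 mulr_sumr; apply: ler_sum => f _.
    rewrite /m ge_max; have := p0 f; have := P0 f => h1 h2.
    by apply/andP; split; nra.
  rewrite -[leRHS]mulr1 -p1 mulr_sumr; apply: ler_sum => f _.
  rewrite /m ge_max; have := p0 f; have := P0 f => h1 h2.
  by apply/andP; split; nra.
apply: (@le_trans _ _ (\sum_(f < n) (m f + (1 - b) * Num.max 0 (P f - Q f)
                                        + b * Num.max 0 (p f - q f)))).
  apply: ler_sum => f _.
  rewrite /m -!maxM ?subr_ge0//.
  apply: le_trans (lerD (maxD _ _) (lexx _)).
  apply: le_trans (maxD _ _); rewrite le_eqVlt; apply/orP; left; apply/eqP.
  by congr Num.max; ring.
by rewrite !big_split/= -!mulr_sumr !lerD.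
Qed.

End Mixtures.

(** * Maximal coupling and inverse sampling *)

Section Coupling.
Context {R : realType}.
Variable n : nat.
Implicit Types (P Q : nat -> R).

Definition distr P := (forall f, 0 <= P f) /\ \sum_(f < n) P f = 1.

(* The maximal coupling of [P] and [Q]: leave [e] with the probability that [P]
   exceeds [Q] there (relatively to [P e]; nothing if [P e = 0], as
   [x / 0 = 0]), and go where [Q] exceeds [P]. *)
Definition leave P Q e : R := Num.max 0 (P e - Q e) / P e.

Definition kernel P Q e f : R :=
  leave P Q e * (Num.max 0 (Q f - P f) / shift n Q P)
  + (if f == e then 1 - leave P Q e else 0).

Lemma shiftC P Q : \sum_(f < n) P f = \sum_(f < n) Q f -> shift n P Q = shift n Q P.
Proof.
move=> PQ; apply/eqP; rewrite -subr_eq0 /shift -sumrB.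
rewrite (eq_bigr (fun f : 'I_n => P f - Q f)) ?sumrB ?PQ ?subrr// => f _.
by case: (leP 0 (P f - Q f)); case: (leP 0 (Q f - P f)); lra.
Qed.

Variables P Q : nat -> R.
Hypotheses (dP : distr P) (dQ : distr Q).

Let P0 f : 0 <= P f. Proof. by case: dP. Qed.
Let Q0 f : 0 <= Q f. Proof. by case: dQ. Qed.
Let PQ : shift n P Q = shift n Q P.
Proof. by apply: shiftC; case: dP => _ ->; case: dQ => _ ->. Qed.
Let m0 (x : R) : 0 <= Num.max 0 x. Proof. by rewrite le_max lexx. Qed.

Lemma leave_bounds e : 0 <= leave P Q e <= 1.
Proof.
rewrite /leave divr_ge0//=; have := P0 e.
rewrite le_eqVlt => /predU1P[<-|Pe]; first by rewrite invr0 mulr0.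
rewrite ler_pdivrMr// mul1r ge_max ltW//=.
by have := Q0 e; lra.
Qed.

Lemma mul_leave e : P e * leave P Q e = Num.max 0 (P e - Q e).
Proof.
rewrite /leave mulrC; have := P0 e; rewrite le_eqVlt => /predU1P[<-|Pe].
  by rewrite mulr0 max_l// sub0r oppr_le0.
by rewrite divfK// gt_eqF.
Qed.

Lemma kernel_ge0 e f : 0 <= kernel P Q e f.
Proof.
have := leave_bounds e => /andP[l0 l1].
rewrite addr_ge0//; first by rewrite mulr_ge0// divr_ge0// shift_ge0.
by case: ifP; rewrite // subr_ge0.
Qed.

(** The factor is 1 unless the shift vanishes; then it is 0 by convention, but no mass leaves
    either. *)
Let leave_shift e : (e < n)%N ->
  leave P Q e * (shift n Q P / shift n Q P) = leave P Q e.
Proof.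
move=> en; have [z|nz] := eqVneq (shift n Q P) 0; last by rewrite divff// mulr1.
suff -> : leave P Q e = 0 by rewrite mul0r.
rewrite /leave; suff -> : Num.max 0 (P e - Q e) = 0 by rewrite mul0r.
move: z; rewrite -PQ /shift => /eqP.
rewrite psumr_eq0// => /allP/(_ (Ordinal en)).
by rewrite mem_index_enum => /(_ isT)/eqP.
Qed.

Lemma kernel_sum e : (e < n)%N -> \sum_(f < n) kernel P Q e f = 1.
Proof.
move=> en; rewrite big_split/= -mulr_sumr -mulr_suml leave_shift//.
rewrite (bigD1 (Ordinal en))//= eqxx big1 ?addr0 1?addrC ?subrK// => f.
by rewrite -val_eqE/= => /negbTE ->.
Qed.

Lemma kernel_push f : (f < n)%N -> \sum_(e < n) P e * kernel P Q e f = Q f.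
Proof.
move=> fn; under eq_bigr do rewrite mulrDr mulrA mul_leave.
rewrite big_split/= -mulr_suml -/(shift n P Q) PQ.
rewrite [X in _ + X](bigD1 (Ordinal fn))//= eqxx [X in _ + (_ + X)]big1 ?addr0; last first.
  by move=> e; rewrite -val_eqE/= eq_sym => /negbTE ->; rewrite mulr0.
rewrite mulrBr mulr1 mul_leave [X in X + _ = _]mulrC.
have -> : Num.max 0 (Q f - P f) / shift n Q P * shift n Q P = Num.max 0 (Q f - P f).
  have [z|nz] := eqVneq (shift n Q P) 0; last by rewrite divfK.
  rewrite z mulr0; move: z => /eqP; rewrite psumr_eq0// => /allP/(_ (Ordinal fn)).
  by rewrite mem_index_enum => /(_ isT)/eqP ->.
by case: (leP 0 (P f - Q f)); case: (leP 0 (Q f - P f)); lra.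
Qed.

(** Keeping an expert may have a cost, as the base algorithm moves by itself; hence the diagonal
    term. The mass kept at [e] is the minimum of [P e] and [Q e], so [Q e] bounds it. *)
Lemma kernel_cost (d : nat -> nat -> R) (D : R) :
  (forall e f, d e f <= D) -> (forall e, 0 <= d e e) ->
  \sum_(e < n) \sum_(f < n) P e * kernel P Q e f * d e f
  <= \sum_(e < n) Q e * d e e + D * shift n P Q.
Proof.
move=> dD d0; rewrite /shift mulr_sumr -big_split/=; apply: ler_sum => e _.
apply: (@le_trans _ _ (\sum_(f < n)
   (Num.max 0 (P e - Q e) * (Num.max 0 (Q f - P f) / shift n Q P) * D
    + (if f == e then (P e - Num.max 0 (P e - Q e)) * d e e else 0)))).
  apply: ler_sum => f _; rewrite /kernel mulrDr mulrA mul_leave mulrDl.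
  apply: lerD.
    by rewrite ler_wpM2l// mulr_ge0// divr_ge0// shift_ge0.
  rewrite -val_eqE; case: eqP => [->|_]; last by rewrite mulr0 mul0r.
  by rewrite mulrBr mulr1 mul_leave.
rewrite big_split/= -mulr_suml -mulr_sumr -mulr_suml.
rewrite -mul_leave -(mulrA (P e)) leave_shift// mul_leave.
rewrite (bigD1 e)//= eqxx big1 ?addr0; last by move=> f /negbTE ->.
rewrite addrC (mulrC D) lerD2r ler_wpM2r//.
by case: (leP 0 (P e - Q e)); have := P0 e; have := Q0 e; lra.
Qed.

End Coupling.

Section Pick.
Context {R : realType}.

(* Inversion of the distribution function of [w], scanning from [f]; the second
   component is the relative position of [v] in the cell it falls in. *)
Fixpoint pick n (w : nat -> R) f (v : R) : nat * R :=
  if n is m.+1 then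
    if w f < v then pick m w f.+1 (v - w f) else (f, v / w f)
  else (f, v / w f).

Lemma pick_le n w f v : ((pick n w f v).1 <= f + n)%N.
Proof.
elim: n f v => [|n IH] f v /=; first by rewrite addn0.
case: ifP => _ /=; last exact: leq_addr.
by rewrite addnS -addSn.
Qed.

Definition cum (w : nat -> R) j : R := \sum_(i < j) w i.

Lemma cumS w j : cum w j.+1 = cum w j + w j.
Proof. exact: big_ord_recr. Qed.

Let pick_aux n w f j v : (forall i, 0 <= w i) -> (j <= n)%N ->
  cum (fun i => w (f + i)%N) j < v <= cum (fun i => w (f + i)%N) j.+1 ->
  pick n w f v = ((f + j)%N, (v - cum (fun i => w (f + i)%N) j) / w (f + j)%N).
Proof.
move=> w0; elim: j f n v => [|j IH] f n v jn.
  rewrite cumS /cum big_ord0 add0r addn0 subr0 => /andP[_ vw].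
  by case: n jn => //= n _; rewrite ltNge vw.
have shiftf i : cum (fun k => w (f + k)%N) i.+1 = w f + cum (fun k => w (f.+1 + k)%N) i.
  rewrite /cum big_ord_recl/= addn0; congr (_ + _).
  by apply: eq_bigr => k _; rewrite /bump/= add1n addnS.
case: n jn => // n jn; rewrite !shiftf => /andP[h1 h2] /=.
have c0 : 0 <= cum (fun k => w (f.+1 + k)%N) j by apply: sumr_ge0.
have -> : w f < v by lra.
rewrite IH//; last by apply/andP; split; lra.
by rewrite addSn addnS opprD addrA.
Qed.

Lemma pickE n w j v : (forall i, 0 <= w i) -> (j <= n)%N ->
  cum w j < v <= cum w j.+1 -> pick n w 0%N v = (j, (v - cum w j) / w j).
Proof. by move=> w0 jn h; have := @pick_aux n w 0%N j v w0 jn h. Qed.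

Lemma cum_mono w i j : (forall i, 0 <= w i) -> (i <= j)%N -> cum w i <= cum w j.
Proof.
move=> w0; elim: j => [|j IH]; first by rewrite leqn0 => /eqP ->.
rewrite leq_eqVlt => /predU1P[->//|/IH h].
by rewrite cumS (le_trans h)// lerDl.
Qed.

Lemma cell_exists w m v : 0 < v <= cum w m ->
  exists2 j, (j < m)%N & cum w j < v <= cum w j.+1.
Proof.
elim: m => [|m IH]; first by rewrite /cum big_ord0; case: ltP => //= h /(lt_le_trans h); rewrite ltxx.
move=> /andP[v0 vm]; have [vj|jv] := lerP v (cum w m).
  by case: IH => [|j jm h]; [rewrite v0|exists j => //; exact: ltnW].
by exists m => //; rewrite jv.
Qed.

(** Cells are open on the left and closed on the right. Hence a cell of mass 0 is never hit, and the
    relative position is again in []0, 1]], ready for the next step. *)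
Lemma pick_cell n w v : (forall i, 0 <= w i) -> cum w n.+1 = 1 -> 0 < v <= 1 ->
  [/\ ((pick n w 0%N v).1 <= n)%N,
      cum w (pick n w 0%N v).1 < v,
      v = cum w (pick n w 0%N v).1 + (pick n w 0%N v).2 * w (pick n w 0%N v).1
    & 0 < (pick n w 0%N v).2 <= 1].
Proof.
move=> w0 w1 v01; have [|j jn h] := @cell_exists w n.+1 v; first by rewrite w1.
rewrite (pickE w0 _ h)//=; case/andP: h => h1 h2; rewrite cumS in h2.
have wj : 0 < w j by lra.
split => //; first by rewrite divfK ?gt_eqF// addrC subrK.
by rewrite divr_gt0 ?subr_gt0//= ler_pdivrMr// mul1r; lra.
Qed.

Lemma measurable_pick n w f e (V : set R) : measurable V ->
  measurable [set v | (pick n w f v).1 = e /\ V (pick n w f v).2].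
Proof.
move=> mV.
have base g : measurable [set v : R | g = e /\ V (v / w g)].
  have [<-|ne] := eqVneq g e; last first.
    rewrite (_ : [set _ | _] = set0)//.
    by apply/seteqP; split => // v [] /eqP; rewrite (negbTE ne).
  rewrite (_ : [set _ | _] = (fun v => v / w g) @^-1` V); last first.
    by apply/seteqP; split => [v []|v].
  have : measurable_fun setT (fun v : R => v / w g) by exact: measurable_funM.
  by move=> /(_ measurableT _ mV); rewrite setTI.
elim: n f => [|n IH] f /=; first exact: base.
rewrite (_ : [set _ | _] =
  ([set v | w f < v] `&` (fun v => v - w f) @^-1`
      [set v | (pick n w f.+1 v).1 = e /\ V (pick n w f.+1 v).2]) `|`
  ([set v | v <= w f] `&` [set v | f = e /\ V (v / w f)])); last first.
  apply/seteqP; split => v /=.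
    by case: ltP => h; [left|right].
  by case: ltP => h [] [].
apply: measurableU; apply: measurableI => //.
- rewrite (_ : [set _ | _] = `]w f, +oo[%classic); first exact: measurable_itv.
  by apply/seteqP; split => v /=; rewrite in_itv/= andbT.
- have : measurable_fun setT (fun v : R => v - w f).
    exact: measurable_funB.
  by move=> /(_ measurableT _ (IH f.+1)); rewrite setTI.
- rewrite (_ : [set _ | _] = `]-oo, w f]%classic); first exact: measurable_itv.
  by apply/seteqP; split => v /=; rewrite in_itv/=.
Qed.

End Pick.

(** * The law of the coupled chain *)

Section FiniteValued.
Context {d : measure_display} {T : measurableType d} {R : realType}.
Variables (I : finType) (X : T -> I).
Hypothesis mX : forall i, measurable (X @^-1` [set i]).

Let sum_indic (psi : I -> R) :
  (fun u => (psi (X u))%:E) =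
  (fun u => \sum_(i : I) (psi i * \1_(X @^-1` [set i]) u)%:E)%E.
Proof.
apply/funext => u; rewrite sumEFin (bigD1 (X u))//= big1 ?addr0.
  by rewrite indicE mem_set//= mulr1.
move=> i ni; rewrite indicE memNset ?mulr0//= => h.
by rewrite h eqxx in ni.
Qed.

Let msummand (psi : I -> R) i : measurable_fun setT
  (fun u => (psi i * \1_(X @^-1` [set i]) u)%:E).
Proof.
by apply/measurable_EFinP; apply: measurable_funM => //; exact: measurable_indic.
Qed.

Lemma measurable_finite_valued (psi : I -> R) :
  measurable_fun setT (fun u => (psi (X u))%:E).
Proof. by rewrite sum_indic; apply: emeasurable_sum => i; exact: msummand. Qed.

Lemma integral_finite_valued (mu : {measure set T -> \bar R}) (psi : I -> R) :
  (forall i, 0 <= psi i) ->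
  (\int[mu]_u (psi (X u))%:E = \sum_(i : I) (psi i)%:E * mu (X @^-1` [set i]))%E.
Proof.
move=> psi0; rewrite sum_indic ge0_integral_sum//; last first.
  by move=> i u _; rewrite lee_fin mulr_ge0.
apply: eq_bigr => i _; under eq_integral do rewrite EFinM.
rewrite ge0_integralZl//; first last.
- by rewrite lee_fin.
- by apply/measurable_EFinP; exact: measurable_indic.
by rewrite integral_indic// setIT.
Qed.

End FiniteValued.

Section Coin.
Context {R : realType}.

Definition coin_law : set (measurableTypeR R) -> \bar R :=
  mrestr (@lebesgue_measure R) (measurable_itv `[0, 1]).

HB.instance Definition _ := Measure.on coin_law.

Let coin_law_setT : coin_law setT = 1%E.
Proof.
rewrite /coin_law/= /mrestr setTI lebesgue_measure_itv/= lte_fin ltr01.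
by rewrite oppr0 adde0.
Qed.

HB.instance Definition _ := Measure_isProbability.Build _ _ R coin_law coin_law_setT.

(** The point 0, which lies in no cell, is a null set. *)
Lemma coin_lawE (B : set R) : measurable B ->
  coin_law B = lebesgue_measure (B `&` `]0, 1]).
Proof.
move=> mB; rewrite /coin_law/= /mrestr.
have -> : B `&` `[0, 1] = (B `&` `]0, 1]) `|` (B `&` [set 0]).
  rewrite -setIUr; congr (_ `&` _); apply/seteqP; split => x /=; rewrite !in_itv/=.
    by rewrite le_eqVlt => /andP[/predU1P[<-|->] h]; [right|left].
  by case=> [/andP[/ltW -> ->//]|->]; rewrite lexx ler01.
have m1 : measurable (B `&` `]0, 1]) by apply: measurableI.
have m0 : measurable (B `&` [set 0]) by apply: measurableI.
rewrite measureU0//; apply/eqP; rewrite eq_le measure_ge0 andbT.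
rewrite -(lebesgue_measure_set1 (0 : R)).
by apply: le_measure; rewrite ?inE//; exact: subIsetr.
Qed.

End Coin.

Section Chain.
Context {R : realType}.
Variables (N : nat) (P : nat -> nat -> R).

(* One coin [u] drives the whole chain: given the current expert, the relative
   position kept by [pick] is again uniform on [0,1]. *)
Fixpoint chain t (u : R) : nat * R :=
  if t is s.+1 then
    let c := chain s u in pick N (kernel N.+1 (P s) (P s.+1) c.1) 0 c.2
  else (N, u).

Lemma chain_le t u : ((chain t u).1 <= N)%N.
Proof. by case: t => //= t; have := pick_le N _ 0%N (chain t u).2; apply. Qed.

Lemma measurable_chain t e (V : set R) : measurable V ->
  measurable [set u | (chain t u).1 = e /\ V (chain t u).2].
Proof.
elim: t e V => [|t IH] e V mV /=.
  have [<-|ne] := eqVneq N e; last first.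
    rewrite (_ : [set _ | _] = set0)//.
    by apply/seteqP; split => // v [] /eqP; rewrite (negbTE ne).
  rewrite (_ : [set _ | _] = V)//.
  by apply/seteqP; split => [v []|v].
pose W c := [set v | (pick N (kernel N.+1 (P t) (P t.+1) c) 0 v).1 = e /\
                   V (pick N (kernel N.+1 (P t) (P t.+1) c) 0 v).2].
rewrite (_ : [set _ | _] =
    \bigcup_(c in `I_N.+1) [set u | (chain t u).1 = c /\ W c (chain t u).2]).
  by apply: bigcup_measurable => c _; apply: IH; exact: measurable_pick.
apply/seteqP; split => u /=; last by case=> c _ /= [<-].
by move=> h; exists (chain t u).1 => //=; rewrite ltnS chain_le.
Qed.

Hypothesis P_distr : forall t, distr N.+1 (P t).
Hypothesis P_init : forall e, P 0%N e = (e == N)%:R.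

Let w t e := kernel N.+1 (P t) (P t.+1) e.

Let w0 t e i : 0 <= w t e i. Proof. exact: kernel_ge0. Qed.

Let w1 t e : (e <= N)%N -> cum (w t e) N.+1 = 1.
Proof. by move=> eN; apply: kernel_sum. Qed.

Lemma chain_in t u : 0 < u <= 1 -> 0 < (chain t u).2 <= 1.
Proof.
move=> u01; elim: t => //= t IH.
by have [] := pick_cell (w0 t _) (w1 t (chain_le t u)) IH.
Qed.

Let A t e s := [set u : R | (0 < u <= 1) /\ (chain t u).1 = e /\ (chain t u).2 <= s].

Let mA t e s : measurable (A t e s).
Proof.
rewrite (_ : A t e s = `]0, 1]%classic `&`
  [set u | (chain t u).1 = e /\ `]-oo, s]%classic (chain t u).2]).
  by apply: measurableI => //; apply: measurable_chain; exact: measurable_itv.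
by apply/seteqP; split => u /=; rewrite !in_itv/=.
Qed.

Let A_sub t e a b : a <= b -> A t e a `<=` A t e b.
Proof. by move=> ab u [h [h1 h2]]; do 2!split => //; exact: le_trans ab. Qed.

Let cell_in t e f s : (f <= N)%N -> (e <= N)%N -> 0 <= s <= 1 ->
  0 <= cum (w t e) f + s * w t e f <= 1.
Proof.
move=> fN eN /andP[s0 s1].
rewrite addr_ge0 ?mulr_ge0//=; last by apply: sumr_ge0.
rewrite -(w1 t eN) (le_trans _ (cum_mono (w0 t e) (_ : (f.+1 <= N.+1)%N)))//.
by rewrite cumS lerD2l -[leRHS]mul1r ler_wpM2r.
Qed.

(** Split along the previous expert [e]: the part of the cell of [f] below relative height [s] is an
    interval of positions in the row of [e]. *)
Let A_step t f s : (f <= N)%N -> 0 <= s <= 1 ->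
  A t.+1 f s = \big[setU/set0]_(e < N.+1)
    (A t e (cum (w t e) f + s * w t e f) `\` A t e (cum (w t e) f)).
Proof.
move=> fN s01; rewrite -(bigcup_mkord N.+1 (fun e : nat =>
    A t e (cum (w t e) f + s * w t e f) `\` A t e (cum (w t e) f))).
apply/seteqP; split => u /=.
  move=> [u01 [h1 h2]]; have v01 := chain_in t u01.
  exists (chain t u).1; first by rewrite /= ltnS chain_le.
  have [] := pick_cell (w0 t _) (w1 t (chain_le t u)) v01.
  rewrite /= -/(w t (chain t u).1) in h1 h2; rewrite h1 => _ c1 c2 _.
  split; last by move=> [_ [_]]; rewrite leNgt c1.
  by split => //; split => //; rewrite c2 lerD2l ler_wpM2r.
case=> e /= eN [[u01 [h1 h2]] h3]; split => //.
have cv : cum (w t e) f < (chain t u).2.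
  by rewrite ltNge; apply/negP => h; apply: h3.
rewrite /= h1 -/(w t e) (@pickE _ N (w t e) f)//=; last first.
  rewrite cv (le_trans h2)// cumS lerD2l -[leRHS]mul1r ler_wpM2r//.
  by case/andP: s01.
split => //; have wp : 0 < w t e f by have := w0 t e f; case/andP: s01; nra.
by rewrite ler_pdivrMr// lerBlDl.
Qed.

Let A_diff t e a b : a <= b ->
  (forall s, 0 <= s <= 1 -> lebesgue_measure (A t e s) = (P t e * s)%:E) ->
  0 <= a <= 1 -> 0 <= b <= 1 ->
  lebesgue_measure (A t e b `\` A t e a) = (P t e * (b - a))%:E.
Proof.
move=> ab h a01 b01.
transitivity (lebesgue_measure (A t e b) - lebesgue_measure (A t e a))%E.
  rewrite measureD; [by rewrite (setIidr (A_sub ab))|exact: mA|exact: mA|].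
  by have := ltry (P t e * b); rewrite -(h b b01).
by rewrite !h// mulrBr EFinB.
Qed.

(** The invariant that makes one coin enough: the current expert has law [P t] and, given the
    expert, the position is uniform. The probability is linear in [s], so the intervals of [A_step]
    have mass [P t e * w t e f * s], and [kernel_push] sums them. *)
Lemma chain_cdf t e s : (e <= N)%N -> 0 <= s <= 1 ->
  lebesgue_measure (A t e s) = (P t e * s)%:E.
Proof.
elim: t e s => [|t IH] e s eN s01.
  rewrite P_init; have [->|ne] := eqVneq e N.
    rewrite (_ : A _ _ _ = `]0, s]%classic); last first.
      apply/seteqP; split => u /=; rewrite in_itv/=.
        by case=> /andP[u0 _] [_ us]; rewrite u0.
      move=> /andP[u0 us]; split => //; rewrite u0 (le_trans us)//.
      by case/andP: s01.
    rewrite lebesgue_measure_itv/= lte_fin mul1r oppr0 adde0.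
    case: ltP => //; case/andP: s01 => s0 _ s0'.
    by congr EFin; apply/eqP; rewrite eq_le s0 s0'.
  rewrite (_ : A _ _ _ = set0) ?measure0 ?mul0r//.
  by apply/seteqP; split => // u [_ [/= h _]]; rewrite h eqxx in ne.
rewrite A_step// measure_bigsetU_ord/=; first last.
- move=> i j _ _ [u [[[_ [h1 _]] _] [[_ [h2 _]] _]]].
  by apply: val_inj; rewrite /= -h1 -h2.
- by move=> i; apply: measurableD; exact: mA.
have cell0 e' : (e' <= N)%N -> 0 <= cum (w t e') e <= 1.
  by move=> e'N; have := @cell_in t e' e 0 eN e'N; rewrite mul0r addr0; apply; lra.
rewrite (eq_bigr (fun e' : 'I_N.+1 => (P t e' * w t e' e * s)%:E)); last first.
  move=> e' _; have e'N : (e' <= N)%N by rewrite -ltnS.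
  rewrite A_diff ?cell_in ?cell0 ?lerDl ?mulr_ge0//.
  - by congr EFin; ring.
  - by case/andP: s01.
  - by move=> s'; apply: IH.
by rewrite sumEFin -mulr_suml kernel_push.
Qed.

(** Pairs of consecutive experts suffice, as a movement cost involves two consecutive steps only. *)
Lemma chain_law2 t e f : (e <= N)%N -> (f <= N)%N ->
  coin_law [set u | (chain t u).1 = e /\ (chain t.+1 u).1 = f]
  = (P t e * kernel N.+1 (P t) (P t.+1) e f)%:E.
Proof.
move=> eN fN.
have mc s c : measurable [set u | (chain s u).1 = c].
  have := @measurable_chain s c setT measurableT.
  by congr measurable; apply/seteqP; split => u /=; [case|].
have m : measurable [set u | (chain t u).1 = e /\ (chain t.+1 u).1 = f].
  by apply: measurableI; exact: mc.
rewrite coin_lawE// -/(w t e f).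
have c0 : 0 <= cum (w t e) f <= 1.
  by have := @cell_in t e f 0 fN eN; rewrite mul0r addr0; apply; lra.
have c1 : 0 <= cum (w t e) f + w t e f <= 1.
  by have := @cell_in t e f 1 fN eN; rewrite mul1r; apply; lra.
have -> : w t e f = cum (w t e) f + w t e f - cum (w t e) f by rewrite addrAC subrr add0r.
rewrite -A_diff ?lerDl//; last by move=> s; exact: chain_cdf.
congr lebesgue_measure; apply/seteqP; split => u /=; rewrite in_itv/=.
  move=> [[h1 h2] u01]; have v01 := chain_in t u01.
  have [] := pick_cell (w0 t _) (w1 t (chain_le t u)) v01.
  rewrite /= -/(w t (chain t u).1) in h2; rewrite h2 h1 => _ p1 p2 /andP[_ p3].
  split; last by move=> [_ [_]]; rewrite leNgt p1.
  by split => //; split => //; rewrite p2 lerD2l -[leRHS]mul1r ler_wpM2r.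
case=> [[u01 [h1 h2]] h3]; split => //; split => //.
have cv : cum (w t e) f < (chain t u).2.
  by rewrite ltNge; apply/negP => h; apply: h3.
by rewrite /= h1 -/(w t e) (@pickE _ N (w t e) f)//= cv cumS.
Qed.

Definition chain_ord t u : 'I_N.+1 := inord (chain t u).1.

Lemma chain_ordE t u : chain_ord t u = (chain t u).1 :> nat.
Proof. by rewrite inordK// ltnS chain_le. Qed.

Let preim_ord t (e : 'I_N.+1) : chain_ord t @^-1` [set e] = [set u | (chain t u).1 = e].
Proof.
by apply/seteqP; split => u /= h; [rewrite -h chain_ordE|apply: val_inj; rewrite /= chain_ordE].
Qed.

Lemma measurable_chain_ord t e : measurable (chain_ord t @^-1` [set e]).
Proof.
rewrite preim_ord; have := @measurable_chain t e setT measurableT.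
by congr measurable; apply/seteqP; split => u /=; [case|].
Qed.

Let chain_pair t u := (chain_ord t u, chain_ord t.+1 u).

Let preim_pair t i : chain_pair t @^-1` [set i] =
  [set u | (chain t u).1 = i.1 /\ (chain t.+1 u).1 = i.2].
Proof.
case: i => i j; apply/seteqP; split => u /=.
  by case=> <- <-; rewrite !chain_ordE.
by case=> h1 h2; congr (_, _); apply: val_inj; rewrite /= chain_ordE.
Qed.

Let measurable_pair t i : measurable (chain_pair t @^-1` [set i]).
Proof.
rewrite preim_pair; have := measurableI _ _ (measurable_chain_ord t i.1)
    (measurable_chain_ord t.+1 i.2); by rewrite !preim_ord.
Qed.

Let pairE t (psi : nat -> nat -> R) :
  (fun u => (psi (chain t u).1 (chain t.+1 u).1)%:E) =
  (fun u => (psi (chain_pair t u).1 (chain_pair t u).2)%:E).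
Proof. by apply/funext => u; rewrite /= !chain_ordE. Qed.

Lemma measurable_chain2 t (psi : nat -> nat -> R) :
  measurable_fun (setT : set (measurableTypeR R))
    (fun u => (psi (chain t u).1 (chain t.+1 u).1)%:E).
Proof.
rewrite pairE; exact: (@measurable_finite_valued _ (measurableTypeR R) _ _ _
  (measurable_pair t) (fun i => psi i.1 i.2)).
Qed.

Lemma chain_mean2 t (psi : nat -> nat -> R) : (forall e f, 0 <= psi e f) ->
  (\int[coin_law]_u (psi (chain t u).1 (chain t.+1 u).1)%:E)%E =
  (\sum_(e < N.+1) \sum_(f < N.+1)
      P t e * kernel N.+1 (P t) (P t.+1) e f * psi e f)%:E.
Proof.
move=> psi0; rewrite pairE.
rewrite [LHS](@integral_finite_valued _ (measurableTypeR R) _ _ _ (measurable_pair t) _ _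
  (fun i => psi0 (nat_of_ord i.1) (nat_of_ord i.2))).
rewrite pair_big/= -sumEFin; apply: eq_bigr => -[e f] _ /=.
rewrite preim_pair mulrC EFinM.
by congr (_ * _)%E; apply: chain_law2; rewrite -ltnS.
Qed.

End Chain.

(** * The cascade of combinations *)

Section Balance.
Context {R : realType}.
Implicit Types s k J a D c : R.

Lemma le_sqrt_of_sqr (u v : R) : 0 <= u -> u ^+ 2 <= v -> u <= Num.sqrt v.
Proof. by move=> u0 uv; rewrite -(ger0_norm u0) -sqrtr_sqr ler_wsqrtr. Qed.

Lemma ln_pow2_le n : ln (2 ^+ n) <= n%:R :> R.
Proof.
elim: n => [|n IH]; first by rewrite expr0 ln1.
rewrite exprS lnM ?posrE ?exprn_gt0// -[n.+1%:R]natr1 [leRHS]addrC lerD//.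
by have := @ln_le_subr1 R 2 (ltr0n _ 2); lra.
Qed.

(** Here [s] is the inverse scale of the matching level, [k] the length of the interval, [J] the
    number of levels, [a] a bound for the logarithm of N T, and [c] is [tuning]. The four lemmas
    bound, in order, the regret of the weights, the charges proportional to the scale, the movement
    of the share and the regret of the share. *)
Variables s k J a D c : R.
Hypotheses (s1 : 1 <= s) (J1 : 1 <= J) (a1 : 1 <= a) (D0 : 0 <= D) (c0 : 0 < c).
Hypotheses (sk : s ^+ 2 * J <= k) (ks : k <= 4 * (s ^+ 2 * J)).
Hypothesis cE : c ^+ 2 = a / (J * (1 + D)).

Let s0 : 0 < s. Proof. exact: lt_le_trans s1. Qed.
Let J0 : 0 < J. Proof. exact: lt_le_trans J1. Qed.
Let a0 : 0 < a. Proof. exact: lt_le_trans a1. Qed.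
Let e0 : 0 < 1 + D. Proof. exact: ltr_wpDr. Qed.
Let s20 : 0 < s ^+ 2. Proof. exact: exprn_gt0. Qed.
Let k0 : 0 < k. Proof. by apply: lt_le_trans sk; rewrite mulr_gt0. Qed.

Lemma balance_sJ : s * J <= Num.sqrt (k * J).
Proof.
apply: le_sqrt_of_sqr; first by rewrite mulr_ge0// ltW.
by rewrite exprMn [J ^+ 2]expr2 mulrA ler_wpM2r// ltW.
Qed.

Let ks2 : (k / (2 * s)) ^+ 2 <= k * J.
Proof.
rewrite expr_div_n ler_pdivrMr ?exprn_gt0 ?mulr_gt0//.
rewrite expr2 exprMn -mulrA ler_pM2l//.
by apply: le_trans ks _; rewrite le_eqVlt; apply/orP; left; apply/eqP; ring.
Qed.

Lemma balance_ks : k / s <= 2 * Num.sqrt (k * J).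
Proof.
have h : k / (2 * s) <= Num.sqrt (k * J).
  by apply: le_sqrt_of_sqr ks2; rewrite divr_ge0 ?mulr_ge0// ltW.
have -> : k / s = 2 * (k / (2 * s)) by field; rewrite gt_eqF.
lra.
Qed.

Lemma balance_move : k * (D * (c / s)) <= 2 * Num.sqrt ((1 + D) * k * a).
Proof.
have h : D * c * (k / (2 * s)) <= Num.sqrt ((1 + D) * k * a).
  apply: le_sqrt_of_sqr; first by rewrite !mulr_ge0 ?invr_ge0 ?mulr_ge0// ltW.
  rewrite exprMn exprMn cE.
  apply: (@le_trans _ _ (D ^+ 2 * (a / (J * (1 + D))) * (k * J))).
    by rewrite ler_wpM2l// mulr_ge0 ?sqr_ge0// divr_ge0 ?mulr_ge0// ltW.
  have -> : D ^+ 2 * (a / (J * (1 + D))) * (k * J) = (D ^+ 2 / (1 + D)) * (k * a).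
    by field; rewrite !gt_eqF.
  rewrite -[leRHS]mulrA ler_wpM2r ?mulr_ge0 ?(ltW a0) ?(ltW k0)//.
  by rewrite ler_pdivrMr//; have := D0; nra.
have -> : k * (D * (c / s)) = 2 * (D * c * (k / (2 * s))) by field; rewrite gt_eqF.
lra.
Qed.

Lemma balance_share : a * (s / c) <= Num.sqrt ((1 + D) * k * a).
Proof.
apply: le_sqrt_of_sqr; first by rewrite mulr_ge0 ?divr_ge0// ltW.
rewrite exprMn expr_div_n cE.
have -> : a ^+ 2 * (s ^+ 2 / (a / (J * (1 + D)))) = (1 + D) * (s ^+ 2 * J) * a.
  by field; rewrite !gt_eqF.
by rewrite ler_wpM2r ?ler_wpM2l// ltW.
Qed.

End Balance.

(** * The cascade of levels and its regret, for a fixed trajectory of the base algorithm *)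

Section Plan.
Context {R : realType}.

(* What survives a round: the weights [g] and last relative losses [r] of the
   levels, their distributions [q] on states, the distribution [P] over experts
   (the states [0, .., N-1] and the base algorithm [N]) and the state of the
   base algorithm. *)
Record plan_state := PlanState {
  pl_g : nat -> R; pl_r : nat -> R; pl_q : nat -> nat -> R;
  pl_P : nat -> R; pl_b : nat }.

Variables (N T : nat) (D : R) (dst : nat -> nat -> R).

(** The number of binary digits of [T], an upper bound for [ln T] that doubling can compute. *)
Definition levels := (trunc_log 2 T).+1.
(** A loss is at most 1, and the movement charged in advance at most [2 * D]. *)
Definition bound : R := 1 + 2%:R * D.
Definition floor_weight : R := 1 / (T * T)%:R.
(** With [T + 1] the rate is below 1 even for [T = 1], and [(1 - share_rate)^-1] is [1 + 1 / T]:
    sharing costs at most 1 in total over [T] rounds. *)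
Definition share_rate : R := 1 / (T + 1)%:R.
(** Equates, up to constants, the movement [k * D * c / s] of the share with its regret [a * s / c]
    when [s ^ 2] is about [k / J]. Writing [1 + D] for [D] covers [D = 0]. *)
Definition tuning : R :=
  powR ((levels + (trunc_log 2 N).+1)%:R / (levels%:R * (1 + D))) (1 / 2%:R).
(** The scale doubles from level to level and reaches 1 at the last one, so the terms [1 / eta] of
    later levels decrease geometrically. *)
Definition scale i : R := (2 ^ i.+1)%:R / (2 ^ levels)%:R.
Definition share_exponent i : R := tuning * scale i.

(** Zero wherever possible, so that blank memory represents it; [clip] lifts the zero weights to the
    floor in the first round. *)
Definition plan0 : plan_state :=
  PlanState (fun _ => 0) (fun _ => 0) (fun _ _ => 0) (fun f => (f == N)%:R) 0.

Section Step.
Variables (l : nat -> R) (b : nat) (st : plan_state).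

Definition new_weight i : R :=
  clip floor_weight (pl_g st i * (1 + scale i / (2%:R * bound) * pl_r st i)).

Definition new_share i x : R :=
  share_step N share_rate (share_exponent i) (pl_q st i) l x.

(* Loss of the expert of level [i], plus an upper bound on its own movement and
   on the movement caused by changing its weight. *)
Definition expert_loss i : R :=
  \sum_(x < N) new_share i x * l x
  + D * (1 - expR (- share_exponent i) * (1 - share_rate) + scale i).

(** Bounds loss and movement of the mixture together. The base pays its true movement, except in the
    first round, where it seems to come from state 0; this spurious cost is at most [D]. *)
Fixpoint level_cost i : R :=
  if i is j.+1 then
    level_cost j - new_weight j * (level_cost j - expert_loss j)
  else l b + dst b (pl_b st).

Definition on_states (q : nat -> R) f : R := if (f < N)%N then q f else 0.

Fixpoint level_mix i f : R :=
  if i is j.+1 then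
    (1 - new_weight j) * level_mix j f + new_weight j * on_states (new_share j) f
  else (f == N)%:R.

Definition plan_step : plan_state :=
  PlanState new_weight (fun i => level_cost i - expert_loss i) new_share
    (level_mix levels) b.

End Step.

Variables (l : nat -> nat -> R) (b : nat -> nat).

Fixpoint plan t : plan_state :=
  if t is s.+1 then plan_step (l t) (b t) (plan s) else plan0.

Definition cost_at i t : R := level_cost (l t) (b t) (plan t.-1) i.
Definition loss_at i t : R := expert_loss (l t) (plan t.-1) i.
Definition mix_at i t : nat -> R := level_mix (l t) (plan t.-1) i.

Hypotheses (N0 : (0 < N)%N) (T0 : (0 < T)%N).
Hypothesis dst0D : forall x y, 0 <= dst x y <= D.
Hypothesis l01 : forall t x, 0 <= l t x <= 1.

Let D0 : 0 <= D. Proof. by case/andP: (dst0D 0 0); exact: le_trans. Qed.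

Lemma bound_ge1 : 1 <= bound.
Proof. by rewrite /bound lerDl mulr_ge0. Qed.

Let B0 : 0 < bound. Proof. exact: lt_le_trans bound_ge1. Qed.

Lemma floor_weight01 : 0 < floor_weight <= 1.
Proof.
rewrite /floor_weight div1r invr_gt0 invf_le1 ltr0n ?muln_gt0 ?T0//=.
by rewrite ler1n muln_gt0 T0.
Qed.

Lemma share_rate01 : 0 < share_rate < 1.
Proof.
rewrite /share_rate div1r invr_gt0 invf_lt1 ltr0n ?addn1//=.
by rewrite ltr1n ltnS.
Qed.

Lemma tuning_gt0 : 0 < tuning.
Proof. by rewrite powR_gt0// divr_gt0 ?ltr0n ?addnS// mulr_gt0//; have := D0; lra. Qed.

Lemma scaleE i : (i < levels)%N -> scale i = (2 ^+ (levels.-1 - i))^-1.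
Proof.
move=> iJ; have e : (2 ^ levels)%:R = 2 ^+ (levels.-1 - i) * 2 ^+ i.+1 :> R.
  by rewrite -exprD -natrX; congr (2 ^ _)%:R; move: iJ; rewrite /levels/=; lia.
by rewrite /scale e natrX invfM mulrCA divff ?mulr1// expf_neq0.
Qed.

Lemma scale_bounds i : (i < levels)%N -> 0 < scale i <= 1.
Proof.
by move=> iJ; rewrite scaleE// invr_gt0 exprn_gt0//= invf_le1 ?exprn_gt0// exprn_ege1// ler1n.
Qed.

Lemma scale_gt0 i : 0 < scale i.
Proof. by rewrite divr_gt0// ltr0n expn_gt0. Qed.

Lemma share_exponent_gt0 i : 0 < share_exponent i.
Proof. by rewrite mulr_gt0 ?tuning_gt0 ?scale_gt0. Qed.

Let q t i := pl_q (plan t) i.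

Lemma plan_subdistr t i : subdistr N (q t i).
Proof.
apply: (@share_seq_subdistr _ N share_rate (share_exponent i) N0 share_rate01
  l (fun t => q t i)) => //.
Qed.

Lemma plan_share_sum t i : \sum_(x < N) q t.+1 i x = 1.
Proof.
apply: (@share_step_sum _ N share_rate (share_exponent i) N0 share_rate01
  _ _ (plan_subdistr t i)).
Qed.

Lemma plan_share_ge0 t i x : 0 <= q t i x.
Proof. by case: (plan_subdistr t i). Qed.

Lemma move_bounds i : (i < levels)%N ->
  0 <= 1 - expR (- share_exponent i) * (1 - share_rate) + scale i <= 2.
Proof.
move=> iJ; have /andP[s0 s1] := scale_bounds iJ; have /andP[g0 g1] := share_rate01.
have e1 : expR (- share_exponent i) <= 1.
  by rewrite -expR0 ler_expR oppr_le0 ltW// share_exponent_gt0.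
have e0 := expR_ge0 (- share_exponent i).
by apply/andP; split; nra.
Qed.

Lemma loss_at_bounds i t : (i < levels)%N -> 0 <= loss_at i t.+1 <= bound.
Proof.
move=> iJ; rewrite /loss_at /expert_loss /=.
have /andP[m0 m2] := move_bounds iJ.
have s01 : 0 <= \sum_(x < N) q t.+1 i x * l t.+1 x <= 1.
  apply/andP; split.
    by apply: sumr_ge0 => x _; rewrite mulr_ge0 ?plan_share_ge0//; case/andP: (l01 t.+1 x).
  rewrite -(plan_share_sum t i); apply: ler_sum => x _.
  by rewrite -[leRHS]mulr1 ler_wpM2l ?plan_share_ge0//; case/andP: (l01 t.+1 x).
move: s01; rewrite /q /= /bound.
set S := \sum_(x < N) _ => /andP[S0 S1]; set m := (1 - _ * _ + _) in m0 m2 *.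
by have := D0; have : 0 <= m by []; move=> *; apply/andP; split; nra.
Qed.

Let g i t := pl_g (plan t) i.
Let r i t := pl_r (plan t) i.

Let gE i t : g i t.+1 = clip floor_weight (g i t * (1 + scale i / (2 * bound) * r i t)).
Proof. by []. Qed.

Lemma plan_weight_bounds i t : floor_weight <= g i t.+1 <= 1.
Proof. by rewrite gE; apply: clip_bounds; case/andP: floor_weight01. Qed.

Let g01 i t : 0 <= g i t <= 1.
Proof.
case: t => [|t]; first by rewrite /g /= lexx ler01.
have := plan_weight_bounds i t; have := floor_weight01.
by move=> /andP[/ltW h _] /andP[h1 ->]; rewrite (le_trans h).
Qed.

Lemma cost_at_mix i t : cost_at i.+1 t.+1 =
  (1 - pl_g (plan t.+1) i) * cost_at i t.+1 + pl_g (plan t.+1) i * loss_at i t.+1.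
Proof.
rewrite -/(g i t.+1).
have -> : cost_at i.+1 t.+1 =
  cost_at i t.+1 - g i t.+1 * (cost_at i t.+1 - loss_at i t.+1) by [].
by ring.
Qed.

Lemma cost_at_bounds i t : (i <= levels)%N -> 0 <= cost_at i t.+1 <= bound.
Proof.
elim: i => [|i IH] iJ.
  rewrite /cost_at /= /bound; have := l01 t.+1 (b t.+1).
  have := dst0D (b t.+1) (pl_b (plan t)).
  by move=> /andP[? ?] /andP[? ?]; apply/andP; split; lra.
have /andP[c0 c1] := IH (ltnW iJ); have /andP[e0 e1] := loss_at_bounds t iJ.
rewrite cost_at_mix -/(g i t.+1); have /andP[w0 w1] := g01 i t.+1.
by apply/andP; split; nra.
Qed.

Lemma relative_bound i t : (i < levels)%N -> `|r i t| <= bound.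
Proof.
move=> iJ; case: t => [|t]; first by rewrite /r /= normr0 ltW.
rewrite /r /= -/(cost_at i t.+1) -/(loss_at i t.+1).
have /andP[c0 c1] := cost_at_bounds t (ltnW iJ).
have /andP[e0 e1] := loss_at_bounds t iJ.
by rewrite ler_norml; apply/andP; split; lra.
Qed.

Let eta i := scale i / (2 * bound).

Let eta0 i : 0 < eta i. Proof. by rewrite divr_gt0 ?scale_gt0// mulr_gt0. Qed.

Let etaB i : eta i * bound = scale i / 2.
Proof. by rewrite /eta; field; rewrite gt_eqF. Qed.

Let etaB2 i : (i < levels)%N -> eta i * bound <= 2^-1.
Proof. by move=> /scale_bounds/andP[_ s1]; rewrite etaB; lra. Qed.

Lemma plan_weight_move i t : (i < levels)%N ->
  `|g i t.+2 - g i t.+1| <= scale i * g i t.+2.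
Proof.
move=> iJ; have rb t' := relative_bound t' iJ.
have := @weight_move _ _ (eta i) bound (g i) (r i) floor_weight01 (eta0 i) (etaB2 iJ) rb (gE i) t.
by rewrite etaB [2 * _]mulrC divfK.
Qed.

Lemma cost_atS i t : cost_at i.+1 t.+1 = cost_at i t.+1 - g i t.+1 * r i t.+1.
Proof. by []. Qed.

Let big_succ (F : nat -> R) t0 k :
  \sum_(t0.+1 <= t < (t0 + k).+1) F t = \sum_(t0 <= t < t0 + k) F t.+1.
Proof. by rewrite big_add1. Qed.

(** The initial weight stays in the bound because it makes the difference between the two
    guarantees: it is the floor at time 1, but can be as large as 1 where an interval begins. *)
Lemma cost_at_default i t0 k : (i < levels)%N ->
  \sum_(t0.+1 <= t < (t0 + k).+1) cost_at i.+1 t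
  <= \sum_(t0.+1 <= t < (t0 + k).+1) cost_at i t
     + g i t0.+1 * (bound * 2 ^+ (levels - i)) + k%:R * (floor_weight * bound).
Proof.
move=> iJ; have rb t' := relative_bound t' iJ.
have := @default_regret _ _ (eta i) bound (g i) (r i) floor_weight01 (eta0 i) (etaB2 iJ) rb (gE i) t0 k.
rewrite !big_succ sumrN; under [in X in _ -> X <= _]eq_bigr do rewrite cost_atS.
rewrite sumrB.
have e : (eta i)^-1 = bound * 2 ^+ (levels - i).
  rewrite /eta invf_div scaleE// invrK [2 * _]mulrC -mulrA -exprS.
  by congr (_ * _ ^+ _); lia.
have := g01 i (t0 + k).+1 => /andP[w0 _].
rewrite mulrBl e.
have : 0 <= g i (t0 + k).+1 * (bound * 2 ^+ (levels - i)).
  by rewrite !mulr_ge0// ?exprn_ge0// ltW.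
lra.
Qed.

(** The geometric series of the [2 ^+ (levels - j)] in closed form. It serves with [a] the floor for
    the whole horizon and with [a = 1] for an interval. *)
Lemma cost_at_outer (a : R) i m t0 k : (forall i, g i t0.+1 <= a) -> (i + m <= levels)%N ->
  \sum_(t0.+1 <= t < (t0 + k).+1) cost_at (i + m) t
  <= \sum_(t0.+1 <= t < (t0 + k).+1) cost_at i t
     + a * bound * (2 ^+ (levels - i).+1 - 2 ^+ (levels - (i + m)).+1)
     + m%:R * (k%:R * (floor_weight * bound)).
Proof.
move=> ga; elim: m => [|m IH] imJ; first by rewrite addn0 subrr mulr0 mul0r !addr0.
have im : (i + m < levels)%N by rewrite -addnS.
have := IH (ltnW im); have := cost_at_default t0 k im.
rewrite addnS -[m.+1%:R]natr1.
have -> : (levels - (i + m))%N = (levels - (i + m).+1).+1 by lia.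
set x : R := 2 ^+ (levels - (i + m).+1).+1.
have -> : 2 ^+ (levels - (i + m).+1).+2 = 2 * x :> R by rewrite exprS.
have x0 : 0 <= bound * x by rewrite mulr_ge0 ?exprn_ge0// ltW.
have := ler_wpM2r x0 (ga (i + m)%N); lra.
Qed.

(** Since [cost_at i.+1 = loss_at i + (1 - g) * r], this is [expert_regret]. *)
Lemma cost_at_expert i t0 k : (i < levels)%N ->
  \sum_(t0.+1 <= t < (t0 + k).+1) cost_at i.+1 t
  <= \sum_(t0.+1 <= t < (t0 + k).+1) loss_at i t
     + ln floor_weight^-1 * (2 * bound / scale i) + k%:R * (scale i * bound).
Proof.
move=> iJ; have rb t' := relative_bound t' iJ.
have := @expert_regret _ _ (eta i) bound (g i) (r i) floor_weight01 (eta0 i) (etaB2 iJ) rb (gE i) t0 k.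
rewrite !big_succ.
have -> : \sum_(t0 <= t < t0 + k) cost_at i.+1 t.+1 =
    \sum_(t0 <= t < t0 + k) loss_at i t.+1
    + \sum_(t0 <= t < t0 + k) (1 - g i t.+1) * r i t.+1.
  rewrite -[RHS]big_split; apply: eq_bigr => t _; rewrite cost_atS.
  have -> : r i t.+1 = cost_at i t.+1 - loss_at i t.+1 by [].
  by rewrite /=; ring.
have -> : 2 * eta i * bound ^+ 2 = scale i * bound.
  by rewrite /eta; field; rewrite gt_eqF.
rewrite [(eta i)^-1]invf_div => h.
by rewrite -[leRHS]addrA lerD2l.
Qed.

(** The last term is the movement charged in advance, simplified by
    [1 - exp (- x) * (1 - y) <= x + y]. *)
Lemma loss_at_regret i (x : 'I_N) t0 k : (i < levels)%N ->
  \sum_(t0.+1 <= t < (t0 + k).+1) loss_at i t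
  <= \sum_(t0.+1 <= t < (t0 + k).+1) l t x
     + (ln (N%:R / share_rate) + k%:R * ln (1 - share_rate)^-1) / share_exponent i
     + k%:R * (D * (share_exponent i + share_rate + scale i)).
Proof.
move=> iJ.
have := @share_regret _ N share_rate (share_exponent i) N0 share_rate01
  (share_exponent_gt0 i) l (fun t => q t i) _ _ x t0 k.
move=> /(_ (fun=> erefl) (fun _ _ => erefl)).
rewrite !big_succ => h; rewrite big_split /= sumr_const_nat addKn -[_ *+ k]mulr_natl.
apply: lerD; first exact: h.
rewrite ler_wpM2l// ler_wpM2l// lerD2r.
have := expR_ge1Dx (- share_exponent i).
have /andP[s0 s1] := share_rate01; have := share_exponent_gt0 i.
set e := expR _ => *; nra.
Qed.

Lemma mix_distr i t : distr N.+1 (mix_at i t.+1).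
Proof.
elim: i => [|i [IH0 IH1]].
  split=> [f|]; first exact: ler0n.
  by rewrite big_ord_recr/= eqxx big1 ?add0r// => f _; rewrite /mix_at /= ltn_eqF.
have /andP[w0 w1] := g01 i t.+1.
split=> [f|].
  rewrite /mix_at /= addr_ge0// mulr_ge0//; first by rewrite subr_ge0.
    exact: IH0.
  by rewrite /on_states; case: ifP => // _; exact: (plan_share_ge0 t.+1).
rewrite /mix_at /= big_split/= -!mulr_sumr IH1 mulr1.
rewrite [X in _ * X](_ : _ = 1) ?mulr1 ?subrK//.
rewrite big_ord_recr/= /on_states ltnn addr0 -(plan_share_sum t i).
by apply: eq_bigr => f _; rewrite ltn_ord.
Qed.

Lemma plan_distr t : distr N.+1 (pl_P (plan t)).
Proof.
case: t => [|t]; last exact: (mix_distr levels t).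
rewrite /plan/plan0; split=> [f|] /=; first exact: ler0n.
by rewrite big_ord_recr/= eqxx big1 ?add0r// => f _; rewrite ltn_eqF.
Qed.

Definition expert_cost t f : R :=
  if (f < N)%N then l t f else l t (b t) + dst (b t) (pl_b (plan t.-1)).

Let sum_on_states i t :
  \sum_(f < N.+1) on_states (q t.+1 i) f * expert_cost t.+1 f
  = \sum_(x < N) q t.+1 i x * l t.+1 x.
Proof.
rewrite big_ord_recr/= /on_states /expert_cost ltnn mul0r addr0.
by apply: eq_bigr => x _; rewrite ltn_ord.
Qed.

Let mix_sum i t :
  \sum_(f < N.+1) mix_at i.+1 t.+1 f * expert_cost t.+1 f
  = (1 - g i t.+1) * \sum_(f < N.+1) mix_at i t.+1 f * expert_cost t.+1 f
    + g i t.+1 * \sum_(x < N) q t.+1 i x * l t.+1 x.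
Proof.
rewrite -sum_on_states !mulr_sumr -big_split/=; apply: eq_bigr => f _.
by rewrite !mulrA -mulrDl.
Qed.

Let mix_sum0 t :
  \sum_(f < N.+1) mix_at 0 t.+1 f * expert_cost t.+1 f = cost_at 0 t.+1.
Proof.
rewrite big_ord_recr/= /mix_at/= eqxx mul1r big1 ?add0r => [|f _].
  by rewrite /expert_cost ltnn.
by rewrite ltn_eqF// mul0r.
Qed.

Let move0 i : (i < levels)%N ->
  0 <= D * (1 - expR (- share_exponent i) * (1 - share_rate) + scale i).
Proof. by move=> iJ; rewrite mulr_ge0//; case/andP: (move_bounds iJ). Qed.

Lemma mix_loss i t : (i <= levels)%N ->
  \sum_(f < N.+1) mix_at i t.+1 f * expert_cost t.+1 f <= cost_at i t.+1.
Proof.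
elim: i => [|i IH] iJ; first by rewrite mix_sum0.
have /andP[w0 w1] := g01 i t.+1; rewrite mix_sum cost_at_mix.
apply: lerD; rewrite ler_wpM2l ?subr_ge0 ?IH// 1?ltnW//.
by rewrite [leRHS]/(_ + _) lerDl move0.
Qed.

(** Induction on the levels with [shift_mix]. A level of new weight [g] adds at most [scale * g] for
    the change of weight and [g * (1 - a)] for the movement of its share; [D] times both is already
    part of [g] times the expert loss. The innermost mixture is always the base, hence does not
    shift. *)
Lemma mix_move_loss i t : (i <= levels)%N ->
  \sum_(f < N.+1) mix_at i t.+2 f * expert_cost t.+2 f
  + D * shift N.+1 (mix_at i t.+1) (mix_at i t.+2) <= cost_at i t.+2.
Proof.
elim: i => [|i IH] iJ.
  rewrite mix_sum0 /shift big1 ?mulr0 ?addr0// => f _.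
  by rewrite /mix_at /= subrr maxxx.
have /andP[w0 w1] := g01 i t.+2; rewrite mix_sum cost_at_mix.
have [m0 m1] := mix_distr i t.
have qs := plan_subdistr t.+1 i.
have dq : distr N.+1 (on_states (q t.+1 i)).
  split=> [f|]; first by rewrite /on_states; case: ifP => // _; exact: plan_share_ge0.
  rewrite big_ord_recr/= /on_states ltnn addr0 -(plan_share_sum t i).
  by apply: eq_bigr => f _; rewrite ltn_ord.
have [p0 p1] := dq.
have := @shift_mix _ N.+1 (mix_at i t.+1) (mix_at i t.+2)
  (on_states (q t.+1 i)) (on_states (q t.+2 i)) (g i t.+1) (g i t.+2).
move=> /(_ (g01 i t.+2) m0 p0 m1 p1) sh.
have := IH (ltnW iJ); have wm := plan_weight_move t iJ.
have /andP[s0 s1] := share_rate01.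
pose a := expR (- share_exponent i) * (1 - share_rate).
have a01 : 0 <= a <= 1.
  have e1 : expR (- share_exponent i) <= 1.
    by rewrite -expR0 ler_expR oppr_le0 ltW// share_exponent_gt0.
  by have e0 := expR_ge0 (- share_exponent i); rewrite /a; apply/andP; split; nra.
have sq : shift N.+1 (on_states (q t.+1 i)) (on_states (q t.+2 i)) <= 1 - a.
  apply: shift_contract => //; first by rewrite p1.
  move=> f; rewrite /on_states; case: ifP; rewrite ?mulr0// => _.
  by apply: (share_step_stable N0 share_rate01 (share_exponent_gt0 i) f (l01 t.+2) qs).
have shm := @shift_ge0 _ N.+1 (mix_at i t.+1) (mix_at i t.+2).
rewrite -/(g i t.+2).
have -> : loss_at i t.+2 = \sum_(x < N) q t.+2 i x * l t.+2 x + D * (1 - a + scale i) by [].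
set S := \sum_(f < N.+1) _; set Q := \sum_(x < N) _.
set c := cost_at _ _; set M := shift _ _ _ in shm *; move=> h.
have hD : D * shift N.+1 (mix_at i.+1 t.+1) (mix_at i.+1 t.+2) <=
  D * (scale i * g i t.+2 + (1 - g i t.+2) * M + g i t.+2 * (1 - a)).
  rewrite ler_wpM2l//; apply: le_trans sh _.
  by rewrite lerD ?lerD// ler_wpM2l.
have : (1 - g i t.+2) * (S + D * M) <= (1 - g i t.+2) * c.
  by rewrite ler_wpM2l// subr_ge0.
move: hD; set w := g i t.+2; set X := shift _ _ _; lra.
Qed.

Let weight1 i : g i 1%N = floor_weight.
Proof.
rewrite gE /g /= mul0r /clip; have /andP[e0 e1] := floor_weight01.
by rewrite min_r ?ler01// max_l// ltW.
Qed.

Let pow_levels : (2 ^ levels <= 2 * T)%N.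
Proof. by rewrite expnS leq_mul2l/= trunc_logP. Qed.

Lemma levels_le : (levels <= T)%N.
Proof. by apply: leq_trans (trunc_logP (isT : (1 < 2)%N) T0); exact: ltn_expl. Qed.

(** All weights start at the floor. The geometric series is at most [4 * T], which contributes 4
    after multiplication with the floor; clipping in at most [T] levels during [T] rounds
    contributes 1. *)
Lemma cost_at_horizon :
  \sum_(1 <= t < T.+1) cost_at levels t
  <= \sum_(1 <= t < T.+1) cost_at 0 t + 5 * bound.
Proof.
have := @cost_at_outer floor_weight 0 levels 0 T (fun i => _) (leqnn _).
rewrite !add0n subn0 subnn expr1 => /(_ (fun i => eq_ind_r (fun x => x <= _) (lexx _) (weight1 i))).
move=> h; apply: le_trans h _; rewrite -!addrA lerD2l.
have TR : 1 <= T%:R :> R by rewrite ler1n.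
have JT : levels%:R <= T%:R :> R by rewrite ler_nat levels_le.
have pT : 2 ^+ levels <= 2 * T%:R :> R by rewrite -natrX -natrM ler_nat.
have p0 : 0 <= 2 ^+ levels :> R by rewrite exprn_ge0.
have fT : floor_weight * T%:R <= 1.
  by rewrite /floor_weight div1r natrM ler_pdivrMl ?mulr_gt0 ?ltr0n// mulr1 ler_pMl ?ltr0n.
have /andP[f0 _] := floor_weight01.
have h1 : floor_weight * (2 ^+ levels.+1 - 2) <= 4 by rewrite exprS; nra.
have h2 : levels%:R * (T%:R * floor_weight) <= 1.
  have fTT : T%:R * (T%:R * floor_weight) = 1.
    by rewrite /floor_weight div1r natrM mulrA mulfV// mulf_neq0 ?pnatr_eq0 -?lt0n.
  by rewrite -[leRHS]fTT ler_wpM2r// mulr_ge0 ?ler0n// ltW.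
have := bound_ge1; nra.
Qed.

Lemma ln_le_levels : ln (T%:R : R) <= levels%:R.
Proof.
have h : T%:R <= 2 ^+ levels :> R by rewrite -natrX ler_nat ltnW// trunc_log_ltn.
apply: (@le_trans _ _ (ln (2 ^+ levels))).
  by rewrite ler_ln ?posrE ?ltr0n ?exprn_gt0.
exact: ln_pow2_le.
Qed.

Lemma cost_at_interval (x : 'I_N) t0 k : (t0 + k <= T)%N ->
  \sum_(t0.+1 <= t < (t0 + k).+1) cost_at levels t
  <= \sum_(t0.+1 <= t < (t0 + k).+1) l t x
     + 11 * (bound * Num.sqrt (k%:R * levels%:R))
     + 4 * Num.sqrt ((1 + D) * k%:R * (levels + (trunc_log 2 N).+1)%:R).
Proof.
move=> kT; set J := levels; set a := (J + _)%:R; set y := Num.sqrt _; set z := Num.sqrt _.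
have y0 : 0 <= y := sqrtr_ge0 _; have z0 : 0 <= z := sqrtr_ge0 _.
(* No level matches an interval shorter than [J], but there [k <= sqrt (k * J)] and the trivial
   bound suffices. *)
have [kJ|Jk] := ltnP k J.
  have h1 : \sum_(t0.+1 <= t < (t0 + k).+1) cost_at J t <= k%:R * bound.
    rewrite big_succ; apply: (@le_trans _ _ (\sum_(t0 <= t < t0 + k) bound)).
      by apply: ler_sum => t _; case/andP: (cost_at_bounds t (leqnn levels)).
    by rewrite sumr_const_nat addKn mulr_natl.
  have h2 : 0 <= \sum_(t0.+1 <= t < (t0 + k).+1) l t x.
    by apply: sumr_ge0 => t _; case/andP: (l01 t x).
  have h3 : k%:R * bound <= bound * y.
    rewrite mulrC ler_wpM2l ?(ltW B0)//; apply: le_sqrt_of_sqr => //.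
    by rewrite expr2 ler_wpM2l// ler_nat ltnW.
  have : 0 <= bound * y by rewrite mulr_ge0// ltW.
  lra.
(* Chosen so that the scale [2 ^- m] is at least sqrt(J / k) and at most twice that. *)
pose m := trunc_log 4 (k %/ J).
have kJ0 : (0 < k %/ J)%N by rewrite divn_gt0.
have mlo : (4 ^ m * J <= k)%N by rewrite -leq_divRL// trunc_logP.
have mhi : (k < 4 * (4 ^ m * J))%N.
  by rewrite mulnA -expnS -ltn_divLR// trunc_log_ltn.
(* From [4 ^ m <= k <= T < 2 ^ J]: even the longest interval finds its level. *)
have mJ : (m < J)%N.
  rewrite -(ltn_exp2l _ _ (isT : (1 < 2)%N)).
  apply: (@leq_ltn_trans (4 ^ m)).
    by rewrite -[4%N]/((2 ^ 2)%N) -expnM leq_exp2l// leq_pmull.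
  apply: leq_ltn_trans (trunc_log_ltn T (isT : (1 < 2)%N)).
  by rewrite (leq_trans _ kT)// (leq_trans _ (leq_addl _ _))// (leq_trans _ mlo)// leq_pmulr.
pose i := (J.-1 - m)%N; pose s : R := 2 ^+ m.
have iJ : (i < levels)%N by rewrite /i /J /levels /=; lia.
have e1 : (i.+1 + m = levels)%N by move: mJ; rewrite /i /J /levels /=; clear; lia.
have im : (levels.-1 - i)%N = m by move: mJ; rewrite /i /J /levels /=; lia.
have sE : scale i = s^-1 by rewrite scaleE// im.
have s1 : 1 <= s by apply: exprn_ege1; rewrite ler1n.
have s0 : 0 < s by apply: lt_le_trans s1.
have s2E : s ^+ 2 = (4 ^ m)%:R by rewrite natrX -exprM mulnC exprM -natrX.
have sk : s ^+ 2 * J%:R <= k%:R by rewrite s2E -natrM ler_nat.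
have ks : k%:R <= 4 * (s ^+ 2 * J%:R) by rewrite s2E -!natrM ler_nat ltnW.
have J1 : 1 <= J%:R :> R by rewrite ler1n.
have a2 : 2 <= a by rewrite /a /J /levels ler_nat !addSn ltnS addnS.
have a1 : 1 <= a by apply: le_trans a2; lra.
have cE : tuning ^+ 2 = a / (J%:R * (1 + D)).
  rewrite /tuning div1r powR12_sqrt ?sqr_sqrtr//.
    by rewrite divr_ge0 ?mulr_ge0 ?addr_ge0.
  by rewrite divr_ge0 ?mulr_ge0 ?addr_ge0.
have b1 := balance_sJ s1 J1 sk.
have b2 := balance_ks s1 J1 sk ks.
have b3 := balance_move s1 J1 a1 D0 tuning_gt0 sk ks cE.
have b4 := balance_share s1 J1 a1 D0 tuning_gt0 sk cE.
rewrite -/y in b1 b2; rewrite -/z in b3 b4.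
have TR : 1 <= T%:R :> R by rewrite ler1n.
have T0R : 0 < T%:R :> R by rewrite ltr0n.
have k1 : k%:R <= T%:R :> R by rewrite ler_nat (leq_trans _ kT)// leq_addl.
have JT : J%:R <= T%:R :> R by rewrite ler_nat levels_le.
have fTT : T%:R * (T%:R * floor_weight) = 1 :> R.
  by rewrite /floor_weight div1r natrM mulrA mulfV// mulf_neq0 ?pnatr_eq0 -?lt0n.
have /andP[f0 f1] := floor_weight01.
have sy : s <= y by apply: le_trans b1; rewrite ler_peMr// ltW.
(* For the [m] levels after [i], the mixture built so far is the default. *)
have outer := @cost_at_outer 1 i.+1 m t0 k (fun i => (andP (g01 i t0.+1)).2) _.
have e2 : (levels - i.+1 = m)%N by rewrite -e1 addKn.
move: outer; rewrite e1 e2 leqnn subnn expr1 mul1r => /(_ isT) outer.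
have h1 : m%:R * (k%:R * (floor_weight * bound)) <= bound * y.
  have mJR : m%:R <= T%:R :> R by apply: le_trans JT; rewrite ler_nat ltnW.
  have : m%:R * (k%:R * floor_weight) <= 1.
    rewrite -[leRHS]fTT ler_pM// ?mulr_ge0 ?ler0n ?(ltW f0)//.
    by rewrite ler_wpM2r// ltW.
  have := s1; have := sy; have := bound_ge1.
  set u := m%:R * (k%:R * floor_weight) => *.
  have -> : m%:R * (k%:R * (floor_weight * bound)) = u * bound by rewrite /u; ring.
  nra.
have exper := @cost_at_expert i t0 k iJ.
have reg := @loss_at_regret i x t0 k iJ.
have lnf : ln floor_weight^-1 <= 2 * J%:R.
  rewrite /floor_weight div1r invrK natrM lnM ?posrE//.
  by have := ln_le_levels; rewrite -/J; lra.
have h2 : ln floor_weight^-1 * (2 * bound / scale i) <= 4 * (bound * y).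
  rewrite sE invrK; apply: (@le_trans _ _ (2 * J%:R * (2 * bound * s))).
    by rewrite ler_wpM2r// !mulr_ge0// ltW.
  have := ler_wpM2l (ltW B0) b1; lra.
have h3 : k%:R * (scale i * bound) <= 2 * (bound * y).
  rewrite sE; have := ler_wpM2l (ltW B0) b2; lra.
have rE : share_rate^-1 = T%:R + 1 by rewrite /share_rate div1r invrK natrD.
have h4 : ln (N%:R / share_rate) + k%:R * ln (1 - share_rate)^-1 <= 2 * a.
  have n1 : ln (N%:R / share_rate) <= a.
    rewrite rE lnM ?posrE ?ltr0n ?ltr_wpDr//.
    rewrite /a natrD addrC; apply: lerD.
      apply: (@le_trans _ _ (ln (2 ^+ levels))).
        rewrite ler_ln ?posrE ?exprn_gt0 ?ltr_wpDr//.
        by rewrite -natrX natr1 ler_nat trunc_log_ltn.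
      exact: ln_pow2_le.
    apply: (@le_trans _ _ (ln (2 ^+ (trunc_log 2 N).+1))).
      rewrite ler_ln ?posrE ?exprn_gt0 ?ltr0n//.
      by rewrite -natrX ler_nat ltnW// trunc_log_ltn.
    exact: ln_pow2_le.
  have n2 : k%:R * ln (1 - share_rate)^-1 <= 1.
    have -> : (1 - share_rate)^-1 = 1 + T%:R^-1.
      rewrite /share_rate div1r natrD; field.
      by rewrite !gt_eqF ?ltr_wpDr// addrK.
    have : ln (1 + T%:R^-1) <= T%:R^-1 :> R.
      by apply: le_ln1Dx; apply: lt_le_trans (_ : 0 <= _); rewrite ?ltrN10// invr_ge0 ltW.
    move=> /(ler_wpM2l (ler0n R k))/le_trans; apply.
    by rewrite ler_pdivrMr// mul1r.
  lra.
have h5 : (ln (N%:R / share_rate) + k%:R * ln (1 - share_rate)^-1) / share_exponent i <= 2 * z.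
  have e : (tuning * s^-1)^-1 = tuning^-1 * s by rewrite invfM invrK.
  rewrite /share_exponent sE e [leLHS]mulrC.
  apply: (@le_trans _ _ (tuning^-1 * s * (2 * a))).
    by rewrite ler_wpM2l// mulr_ge0 ?invr_ge0// ltW// tuning_gt0.
  lra.
have h6 : k%:R * (D * (share_exponent i + share_rate + scale i)) <= 2 * z + 2 * (bound * y).
  rewrite /share_exponent sE.
  have n1 : k%:R * share_rate <= 1.
    rewrite /share_rate div1r natrD ler_pdivrMr ?ltr_wpDr//; lra.
  have n2 : D * (k%:R * share_rate) <= D by rewrite -[leRHS]mulr1 ler_wpM2l.
  have n3 : D * (k%:R / s) <= D * (2 * y) by rewrite ler_wpM2l.
  have n4 : 1 <= y by apply: le_trans sy.
  have -> : k%:R * (D * (tuning * s^-1 + share_rate + s^-1)) =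
     k%:R * (D * (tuning / s)) + D * (k%:R * share_rate) + D * (k%:R / s) by ring.
  have -> : bound * y = y + 2 * (D * y) by rewrite /bound; ring.
  have n5 : D <= D * y by rewrite ler_peMr.
  have : 0 <= D * y by rewrite mulr_ge0.
  lra.
have h7 : bound * (2 ^+ m.+1 - 2) <= 2 * (bound * y).
  rewrite exprS -/s; have := ler_wpM2l (ltW B0) sy; have := B0; lra.
(* The 11 collects 4 from [h2], 2 each from [h3], [h6] and [h7], and 1 from [h1]; the 4 collects 2
   each from [h5] and [h6]. *)
have : 0 <= bound * y by rewrite mulr_ge0// ltW.
rewrite -/J in outer; lra.
Qed.

End Plan.

Arguments plan_state R : clear implicits.

(** * Reasoning about programs *)

Section ProgramLogic.
Context {R : realType}.
Variable inp : input R.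
Implicit Types (s : store R) (c : cmd) (Q : store R -> Prop).

(** Total correctness with an upper bound on the time: [exec] being a relation, the existential
    includes termination. *)
Definition runs c s n Q : Prop :=
  exists k s', [/\ (k <= n)%N, exec inp c s k s' & Q s'].

Lemma runs_weaken c s n n' Q Q' : (n <= n')%N -> (forall s', Q s' -> Q' s') ->
  runs c s n Q -> runs c s n' Q'.
Proof.
by move=> nn' QQ' [k [s' [kn e q]]]; exists k, s'; split; [exact: leq_trans nn'| |exact: QQ'].
Qed.

Lemma runs_seq c1 c2 s n1 n2 Q1 Q : runs c1 s n1 Q1 ->
  (forall s1, Q1 s1 -> runs c2 s1 n2 Q) -> runs (Seq c1 c2) s (n1 + n2) Q.
Proof.
move=> [k1 [s1 [kn1 e1 q1]]] /(_ _ q1)[k2 [s2 [kn2 e2 q2]]].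
by exists (k1 + k2)%N, s2; split; [exact: leq_add|exact: exec_seq e1 e2|].
Qed.

Fixpoint straight c : bool :=
  match c with
  | Skip | SetI _ _ | SetR _ _ => true
  | Sample _ | While _ _ => false
  | Seq c1 c2 | If _ c1 c2 => straight c1 && straight c2
  end.

(** A conditional is charged for both branches, so that the bound does not depend on the store. *)
Fixpoint time c : nat :=
  match c with
  | Skip => 1
  | SetI a e => (icost a + icost e).+1
  | SetR a e => (icost a + rcost e).+1
  | Sample a => (icost a).+1
  | Seq c1 c2 => time c1 + time c2
  | If b c1 c2 => (bcost b + (time c1 + time c2)).+1
  | While _ _ => 0
  end.

Fixpoint sem c s : store R :=
  match c with
  | SetI a e => set_icell s (ieval inp s a) (ieval inp s e)
  | SetR a e => set_rcell s (ieval inp s a) (reval inp s e)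
  | Seq c1 c2 => sem c2 (sem c1 s)
  | If b c1 c2 => if beval inp s b then sem c1 s else sem c2 s
  | _ => s
  end.

Lemma runs_straight c s Q : straight c -> Q (sem c s) -> runs c s (time c) Q.
Proof.
move=> sc q; suff [k kn e] : exists2 k, (k <= time c)%N & exec inp c s k (sem c s).
  by exists k, (sem c s).
elim: c s sc {q} => [|a e|a e|//|c1 IH1 c2 IH2|b c1 IH1 c2 IH2|//] s /=.
- by move=> _; exists 1%N => //; constructor.
- by move=> _; eexists; first exact: leqnn; constructor.
- by move=> _; eexists; first exact: leqnn; constructor.
- move=> /andP[/(IH1 s)[k1 h1 e1] /(IH2 (sem c1 s))[k2 h2 e2]].
  by exists (k1 + k2)%N; [exact: leq_add|exact: exec_seq e1 e2].
- move=> /andP[/(IH1 s)[k1 h1 e1] /(IH2 s)[k2 h2 e2]].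
  have [bt|bf] := boolP (beval inp s b).
    exists (bcost b + k1).+1; last by constructor; rewrite bt.
    by rewrite ltnS leq_add2l (leq_trans h1)// leq_addr.
  exists (bcost b + k2).+1; last by constructor; rewrite (negbTE bf).
  by rewrite ltnS leq_add2l (leq_trans h2)// leq_addl.
Qed.

Lemma runs_while b c (Inv : nat -> store R -> Prop) s i n m :
  Inv i s ->
  (forall k s', (k < i + n)%N -> Inv k s' -> beval inp s' b /\ runs c s' m (Inv k.+1)) ->
  (forall s', Inv (i + n)%N s' -> ~~ beval inp s' b) ->
  runs (While b c) s (n * (bcost b + m).+1 + (bcost b).+1) (Inv (i + n)%N).
Proof.
elim: n i s => [|n IH] i s inv step stop.
  rewrite addn0 in stop *; exists (bcost b).+1, s; split => //.
  by apply: exec_while_false; exact: stop.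
have [bt [k1 [s1 [h1 e1 i1]]]] := step i s (ltac:(lia)) inv.
have [||k2 [s2 [h2 e2 q2]]] := IH i.+1 s1 i1.
- by move=> k s' kn; apply: step; rewrite addnS -addSn.
- by move=> s'; rewrite addSn -addnS; exact: stop.
exists (bcost b + k1 + k2).+1, s2; split; last by rewrite addnS -addSn.
  move: h1 h2; clear; lia.
exact: exec_while_true bt e1 e2.
Qed.

Definition For x e c : cmd :=
  Seq (SetI (INat x) (INat 0))
    (While (ILe (IAdd (ICell (INat x)) (INat 1)) e)
      (Seq c (SetI (INat x) (IAdd (ICell (INat x)) (INat 1))))).

(** The limit [e] is evaluated anew in every turn, so the invariant has to determine both the
    counter and the value of [e]. *)
Lemma runs_for x e c (Inv : nat -> store R -> Prop) s n m :
  Inv 0 (set_icell s x 0) ->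
  (forall k s', (k <= n)%N -> Inv k s' -> icell s' x = k /\ ieval inp s' e = n) ->
  (forall k s', (k < n)%N -> Inv k s' ->
     runs c s' m (fun s1 => Inv k.+1 (set_icell s1 x (icell s1 x + 1)%N))) ->
  runs (For x e c) s (n * (icost e + m + 12) + (icost e + 9)) (Inv n).
Proof.
move=> inv0 cnt step.
have h : runs (While (ILe (IAdd (ICell (INat x)) (INat 1)) e)
    (Seq c (SetI (INat x) (IAdd (ICell (INat x)) (INat 1)))))
    (set_icell s x 0) (n * ((5 + icost e) + (m + 6)).+1 + (5 + icost e).+1) (Inv n).
  apply: (@runs_while _ _ Inv _ 0 n (m + 6)) => //.
    move=> k s' kn i; have [xk en] := cnt k s' (ltnW kn) i.
    split; first by rewrite /= xk en addn1.
    apply: runs_seq (step k s' kn i) _ => s1 q1.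
    exact: (@runs_straight (SetI (INat x) (IAdd (ICell (INat x)) (INat 1)))).
  move=> s' i; have [xk en] := cnt n s' (leqnn _) i.
  by rewrite /= xk en addn1 ltnn.
apply: (@runs_weaken _ _ (3 + (n * ((5 + icost e) + (m + 6)).+1 + (5 + icost e).+1)) _ (Inv n)) => //.
  by clear; nia.
apply: (@runs_seq _ _ _ _ _ (fun s1 => s1 = set_icell s x 0)).
  exact: (@runs_straight (SetI (INat x) (INat 0))).
by move=> _ ->.
Qed.

End ProgramLogic.

(** * The program of a round *)

Section RoundProgram.

Definition ic n : iexpr := ICell (INat n).
Definition rc n : rexpr := RCell (INat n).

(* Integer cells: 0 output, 1 initialization flag, 2 current expert, 3 last base
   state, 4 level, 5 [2 ^ levels], 6 loop index, 7 [levels], 8 [2 ^ level].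
   Real cells: scalars at multiples of 8 (0 is the relative position of the
   coin), arrays in the classes 1 (old mixture), 2 (new mixture), 3 (shares),
   4 (weights), 5 (relative losses) modulo 8. *)
Definition at_class o e : iexpr := IAdd (IMul (INat 8) e) (INat o).
Definition old_mix e := at_class 1 e.
Definition new_mix e := at_class 2 e.
Definition share_cell := at_class 3 (IAdd (IMul (ic 4) IStates) (ic 6)).
Definition weight_cell := at_class 4 (ic 4).
Definition relative_cell := at_class 5 (ic 4).

(** The flag in cell 1 recognizes blank memory. The only sample of the whole run is drawn here;
    later rounds reuse the relative position left in real cell 0. *)
Definition prog_init : cmd :=
  If (ILe (ic 1) (INat 0))
    (Seq (Sample (INat 0))
      (Seq (SetI (INat 1) (INat 1))
        (Seq (SetI (INat 2) IStates) (SetR (old_mix IStates) (RNat (INat 1))))))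
    Skip.

Definition prog_levels : cmd :=
  Seq (Seq (SetI (INat 5) (INat 1)) (SetI (INat 7) (INat 0)))
    (While (ILe (ic 5) IHorizon)
      (Seq (SetI (INat 5) (IMul (ic 5) (INat 2)))
           (SetI (INat 7) (IAdd (ic 7) (INat 1))))).

(** [logN] is a literal of the program and depends on the number of states only, whereas
    [prog_levels] finds the number of levels; so one program serves all horizons. *)
Definition prog_params (logN : nat) : cmd :=
  Seq (SetR (INat 8) (RAdd (RNat (INat 1)) (RMul (RNat (INat 2)) RDiameter)))
  (Seq (SetR (INat 16) (RDiv (RNat (INat 1)) (RNat (IMul IHorizon IHorizon))))
  (Seq (SetR (INat 24) (RDiv (RNat (INat 1)) (RNat (IAdd IHorizon (INat 1)))))
  (Seq (SetR (INat 32)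
         (RPow (RDiv (RNat (IAdd (ic 7) (INat logN)))
                     (RMul (RNat (ic 7)) (RAdd (RNat (INat 1)) RDiameter)))
               (RDiv (RNat (INat 1)) (RNat (INat 2)))))
  (Seq (SetR (INat 40) (RAdd (RLoss IBase) (RDist IBase (ic 3))))
       (SetI (INat 3) IBase))))).

Definition prog_mix0 : cmd :=
  Seq (For 6 IStates (SetR (new_mix (ic 6)) (RNat (INat 0))))
      (SetR (new_mix IStates) (RNat (INat 1))).

Definition prog_weight : cmd :=
  Seq (SetI (INat 8) (IMul (ic 8) (INat 2)))
  (Seq (SetR (INat 48) (RDiv (RNat (ic 8)) (RNat (ic 5))))
  (Seq (SetR (INat 56) (RMul (rc 32) (rc 48)))
  (Seq (SetR weight_cell
         (RMul (RCell weight_cell)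
           (RAdd (RNat (INat 1))
             (RMul (RDiv (rc 48) (RMul (RNat (INat 2)) (rc 8)))
                   (RCell relative_cell)))))
  (Seq (If (RLe (RCell weight_cell) (RNat (INat 1))) Skip
           (SetR weight_cell (RNat (INat 1))))
  (Seq (If (RLe (rc 16) (RCell weight_cell)) Skip (SetR weight_cell (rc 16)))
       (SetR (INat 64) (RNat (INat 0)))))))).

(** A first pass stores the unnormalized weights in place and their total in cell 64; [prog_mix]
    divides in a second pass. *)
Definition prog_share : cmd :=
  Seq (SetR share_cell
        (RMul (RAdd (RMul (RSub (RNat (INat 1)) (rc 24)) (RCell share_cell))
                    (RDiv (rc 24) (RNat IStates)))
              (RExp (RSub (RNat (INat 0)) (RMul (rc 56) (RLoss (ic 6)))))))
      (SetR (INat 64) (RAdd (rc 64) (RCell share_cell))).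

Definition prog_expert : cmd :=
  SetR (INat 72)
    (RMul RDiameter
      (RAdd (RSub (RNat (INat 1))
              (RMul (RExp (RSub (RNat (INat 0)) (rc 56)))
                    (RSub (RNat (INat 1)) (rc 24))))
            (rc 48))).

Definition prog_mix : cmd :=
  Seq (SetR share_cell (RDiv (RCell share_cell) (rc 64)))
  (Seq (SetR (INat 72) (RAdd (rc 72) (RMul (RCell share_cell) (RLoss (ic 6)))))
       (SetR (new_mix (ic 6))
         (RAdd (RMul (RSub (RNat (INat 1)) (RCell weight_cell))
                     (RCell (new_mix (ic 6))))
               (RMul (RCell weight_cell) (RCell share_cell))))).

Definition prog_relative : cmd :=
  Seq (SetR (new_mix IStates)
        (RMul (RSub (RNat (INat 1)) (RCell weight_cell)) (RCell (new_mix IStates))))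
  (Seq (SetR relative_cell (RSub (rc 40) (rc 72)))
       (SetR (INat 40)
         (RSub (rc 40) (RMul (RCell weight_cell) (RCell relative_cell))))).

Definition prog_level : cmd :=
  Seq prog_weight
  (Seq (For 6 IStates prog_share)
  (Seq prog_expert (Seq (For 6 IStates prog_mix) prog_relative))).

Definition prog_shift : cmd :=
  Seq (SetR (INat 80) (RNat (INat 0)))
      (For 6 (IAdd IStates (INat 1))
        (If (RLe (RCell (old_mix (ic 6))) (RCell (new_mix (ic 6))))
          (SetR (INat 80)
            (RAdd (rc 80) (RSub (RCell (new_mix (ic 6))) (RCell (old_mix (ic 6))))))
          Skip)).

(** One entry of the row of the current expert, in constant time from the shift in cell 80 and the
    leaving probability in cell 88; the scan thus takes time linear in N. *)
Definition prog_kernel : cmd :=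
  Seq (If (RLe (RCell (old_mix (ic 6))) (RCell (new_mix (ic 6))))
        (SetR (INat 96)
          (RMul (rc 88)
            (RDiv (RSub (RCell (new_mix (ic 6))) (RCell (old_mix (ic 6)))) (rc 80))))
        (SetR (INat 96) (RNat (INat 0))))
      (If (BAnd (ILe (ic 6) (ic 2)) (ILe (ic 2) (ic 6)))
        (SetR (INat 96) (RAdd (rc 96) (RSub (RNat (INat 1)) (rc 88))))
        Skip).

Definition prog_leave : cmd :=
  Seq (If (RLe (RCell (old_mix (ic 2))) (RCell (new_mix (ic 2))))
        (SetR (INat 88) (RNat (INat 0)))
        (SetR (INat 88)
          (RDiv (RSub (RCell (old_mix (ic 2))) (RCell (new_mix (ic 2))))
                (RCell (old_mix (ic 2))))))
      (SetI (INat 6) (INat 0)).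

Definition prog_scan_body : cmd :=
  Seq (SetR (INat 0) (RSub (rc 0) (rc 96)))
    (Seq (SetI (INat 6) (IAdd (ic 6) (INat 1))) prog_kernel).

Definition prog_scan_guard : bexpr :=
  BAnd (ILe (IAdd (ic 6) (INat 1)) IStates) (BNot (RLe (rc 0) (rc 96))).

Definition prog_sample : cmd :=
  Seq (Seq prog_leave prog_kernel)
  (Seq (While prog_scan_guard prog_scan_body)
       (Seq (SetR (INat 0) (RDiv (rc 0) (rc 96))) (SetI (INat 2) (ic 6)))).

Definition prog_output : cmd :=
  Seq (For 6 (IAdd IStates (INat 1))
         (SetR (old_mix (ic 6)) (RCell (new_mix (ic 6)))))
      (If (ILe IStates (ic 2)) (SetI (INat 0) IBase) (SetI (INat 0) (ic 2))).

Definition prog_round (logN : nat) : cmd :=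
  Seq prog_init
  (Seq prog_levels
  (Seq (prog_params logN)
  (Seq prog_mix0
  (Seq (SetI (INat 8) (INat 1))
  (Seq (For 4 (ic 7) prog_level)
  (Seq prog_shift (Seq prog_sample prog_output))))))).

End RoundProgram.

Ltac cell_cases :=
  repeat match goal with
  | |- context [@eq_op ?T ?a ?b] =>
    first [ rewrite (_ : (a == b) = false); [|by apply/negbTE/eqP; lia]
          | rewrite (_ : (a == b) = true); [|by apply/eqP; lia] ]
  end.

(** * Correctness and running time of the program of a round *)

Section RoundCorrect.
Context {R : realType}.
Variable inp : input R.
Implicit Types (s : store R) (st : plan_state R).

Let N := in_states inp.
Let T := in_horizon inp.
Let D := in_diameter inp.
Let l := in_loss inp.
Let b := in_base inp.
Let dst := in_dist inp.

(** Depends on the input through [N] and [T] only, so it carries over from one round to the next. *)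
Definition represents st (ev : nat * R) s : Prop :=
  [/\ icell s 1 = 1%N, icell s 2 = ev.1, icell s 3 = pl_b st & rcell s 0 = ev.2] /\
  [/\ forall f, (f <= N)%N -> rcell s (8 * f + 1)%N = pl_P st f,
      forall i, (i < levels T)%N -> rcell s (8 * i + 4)%N = pl_g st i,
      forall i, (i < levels T)%N -> rcell s (8 * i + 5)%N = pl_r st i
    & forall i x, (i < levels T)%N -> (x < N)%N ->
        rcell s (8 * (i * N + x) + 3)%N = pl_q st i x].

Variables (st : plan_state R) (e : nat) (v : R).

Let gw i := new_weight T D st i.
Let qw i x := new_share N T D l st i x.
Let ex i := expert_loss N T D l st i.
Let lc i := level_cost N T D dst l b st i.
Let lm i f := level_mix N T D l st i f.

(** The update is in place: levels below [i] hold the values of this round, the others those of the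
    previous one. *)
Definition midway i s : Prop :=
  [/\ icell s 1 = 1%N, icell s 2 = e, icell s 3 = b, icell s 4 = i &
  [/\ icell s 5 = (2 ^ levels T)%N, icell s 7 = levels T & icell s 8 = (2 ^ i)%N]] /\
  [/\ rcell s 0 = v, rcell s 8 = bound D, rcell s 16 = floor_weight T,
      rcell s 24 = share_rate T &
  [/\ rcell s 32 = tuning N T D, rcell s 40 = lc i,
      forall f, (f <= N)%N -> rcell s (8 * f + 1)%N = pl_P st f &
      forall f, (f <= N)%N -> rcell s (8 * f + 2)%N = lm i f]] /\
  [/\ forall j, (j < levels T)%N ->
        rcell s (8 * j + 4)%N = if (j < i)%N then gw j else pl_g st j,
      forall j, (j < levels T)%N ->
        rcell s (8 * j + 5)%N = if (j < i)%N then lc j - ex j else pl_r st j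
    & forall j x, (j < levels T)%N -> (x < N)%N ->
        rcell s (8 * (j * N + x) + 3)%N = if (j < i)%N then qw j x else pl_q st j x].

(** Row-major addressing: uniqueness of Euclidean division by [N]. *)
Lemma share_addr_inj j i x y : (x < N)%N -> (y < N)%N ->
  (8 * (j * N + x) + 3 = 8 * (i * N + y) + 3)%N -> j = i /\ x = y.
Proof.
move=> xN yN h; have {}h : (j * N + x = i * N + y)%N by lia.
have N0 : (0 < N)%N by lia.
have : ((j * N + x) %/ N = (i * N + y) %/ N)%N by rewrite h.
rewrite !divnMDl// !divn_small// !addn0 => ji; split => //.
by move: h; rewrite ji => /addnI.
Qed.

Lemma prog_weight_sem i s : midway i s -> (i < levels T)%N ->
  let s' := sem inp prog_weight s in
  [/\ forall a, a != 8%N -> icell s' a = icell s a, icell s' 8 = (2 ^ i.+1)%N,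
      forall a, a != 48%N -> a != 56%N -> a != 64%N -> a != (8 * i + 4)%N ->
        rcell s' a = rcell s a &
  [/\ rcell s' 48 = scale T i, rcell s' 56 = share_exponent N T D i,
      rcell s' 64 = 0 & rcell s' (8 * i + 4)%N = gw i]].
Proof.
move=> [[_ _ _ i4 [i5 i7 i8]] [[_ r8 r16 _ [r32 _ _ _]] [rg rr _]]] iJ s'.
have hg := rg i iJ; have hr := rr i iJ; rewrite ltnn in hg hr.
pose z := pl_g st i * (1 + scale T i / (2 * bound D) * pl_r st i).
pose s1 := sem inp (Seq (SetI (INat 8) (IMul (ic 8) (INat 2)))
  (Seq (SetR (INat 48) (RDiv (RNat (ic 8)) (RNat (ic 5))))
  (Seq (SetR (INat 56) (RMul (rc 32) (rc 48)))
   (SetR weight_cell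
         (RMul (RCell weight_cell)
           (RAdd (RNat (INat 1))
             (RMul (RDiv (rc 48) (RMul (RNat (INat 2)) (rc 8)))
                   (RCell relative_cell)))))))) s.
have sc : (2 ^ i * 2)%:R / (2 ^ levels T)%:R = scale T i :> R.
  by rewrite /scale expnSr.
have i1 a : a != 8%N -> icell s1 a = icell s a by move=> /negbTE h; rewrite /s1 /= h.
have i18 : icell s1 8 = (2 ^ i.+1)%N by rewrite /s1 /= i8 expnSr.
have ra a : a != 48%N -> a != 56%N -> a != (8 * i + 4)%N -> rcell s1 a = rcell s a.
  by move=> /negbTE h1 /negbTE h2 /negbTE h3; rewrite /s1 /= i4 h1 h2 h3.
have r48 : rcell s1 48 = scale T i.
  by rewrite /s1 /= i4 i5 i8 sc; cell_cases.
have r56 : rcell s1 56 = share_exponent N T D i.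
  by rewrite /s1 /= i4 i5 i8 sc r32; cell_cases.
have rz : rcell s1 (8 * i + 4)%N = z.
  by rewrite /s1 /= i4 i5 i8 sc r8; cell_cases; rewrite hg hr.
have r16' : rcell s1 16 = floor_weight T.
  by rewrite ra ?r16//; apply/eqP; lia.
have w4 : icell s1 4 = i by rewrite i1.
have -> : s' = sem inp (Seq (If (RLe (RCell weight_cell) (RNat (INat 1))) Skip
           (SetR weight_cell (RNat (INat 1))))
  (Seq (If (RLe (rc 16) (RCell weight_cell)) Skip (SetR weight_cell (rc 16)))
       (SetR (INat 64) (RNat (INat 0))))) s1 by [].
have gE : gw i = Num.max (floor_weight T) (Num.min 1 z) by [].
clearbody s1; clear s'.
rewrite /= w4 rz.
have [z1|z1] := lerP z 1.
  rewrite /= w4 rz r16'.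
  have [fz|fz] := lerP (floor_weight T) z.
    split => //=; first by move=> a /negbTE h1 /negbTE h2 /negbTE -> /negbTE h4; rewrite ra ?h1 ?h2 ?h4.
    by split; cell_cases => //; rewrite gE min_r// max_r.
  split => //=.
    by move=> a h1 h2 /negbTE h3 h4; rewrite h3 (negbTE h4) ra.
  split; cell_cases => //.
  by rewrite gE min_r// max_l// ltW.
rewrite /= w4 eqxx r16'; cell_cases.
have [fz|fz] := lerP (floor_weight T) (1 : R).
  split => //=.
    by move=> a h1 h2 /negbTE h3 h4; rewrite h3 (negbTE h4) ra.
  split; cell_cases => //.
  by rewrite gE min_l ?(ltW z1)// max_r.
split => //=.
  by move=> a h1 h2 /negbTE h3 h4; rewrite h3 (negbTE h4) ra.
split; cell_cases => //.
by rewrite gE min_l ?(ltW z1)// max_l// ltW.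
Qed.

Let sw i y := share_weight N (share_rate T) (share_exponent N T D i) (pl_q st i) l y.

Definition share_inv s1 i k s : Prop :=
  [/\ icell s 6 = k, forall a, a != 6%N -> icell s a = icell s1 a,
      rcell s 64 = \sum_(y < k) sw i y,
      forall y, (y < k)%N -> rcell s (8 * (i * N + y) + 3)%N = sw i y
    & forall a, a != 64%N -> (forall y, (y < k)%N -> a != (8 * (i * N + y) + 3)%N) ->
        rcell s a = rcell s1 a].

Lemma prog_share_loop i s1 : icell s1 4 = i -> rcell s1 24 = share_rate T ->
  rcell s1 56 = share_exponent N T D i -> rcell s1 64 = 0 ->
  (forall y, (y < N)%N -> rcell s1 (8 * (i * N + y) + 3)%N = pl_q st i y) ->
  runs inp (For 6 IStates prog_share) s1
    (N * (1 + time prog_share + 12) + (1 + 9)) (share_inv s1 i N).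
Proof.
move=> i4 r24 r56 r64 rq; apply: runs_for.
- split => //=; first by move=> a /negbTE ->.
  by rewrite big_ord0.
- by move=> k s' _ [].
- move=> k s kN [k6 fi zE wE fr].
  have s4 : icell s 4 = i by rewrite fi.
  have s24 : rcell s 24 = share_rate T by rewrite fr ?r24// => y _; apply/eqP; lia.
  have s56 : rcell s 56 = share_exponent N T D i.
    by rewrite fr ?r56// => y _; apply/eqP; lia.
  have sq : rcell s (8 * (i * N + k) + 3)%N = pl_q st i k.
    by rewrite fr ?rq// => [|y yk]; apply/eqP; lia.
  apply: runs_straight => //=; rewrite -/N s4 k6 s24 s56 sq eqxx.
  split => /=.
  + by rewrite addn1.
  + by move=> a a6; rewrite (negbTE a6) fi.
  + cell_cases; rewrite big_ord_recr/= zE; congr (_ + _).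
    by rewrite /sw /share_weight /share sub0r.
  + move=> y; rewrite ltnS leq_eqVlt => /predU1P[->|yk].
      by rewrite eqxx; cell_cases; rewrite /sw /share_weight /share sub0r.
    by cell_cases; exact: wE.
  + move=> a a64 ay; rewrite (negbTE a64) (negbTE (ay k _))//.
    by apply: fr => // y yk; apply: ay; rewrite ltnW.
Qed.

Definition mix_inv s1 i k s : Prop :=
  [/\ icell s 6 = k, forall a, a != 6%N -> icell s a = icell s1 a,
      rcell s 72 = rcell s1 72 + \sum_(y < k) qw i y * l y,
      forall y, (y < k)%N -> rcell s (8 * (i * N + y) + 3)%N = qw i y /\
        rcell s (8 * y + 2)%N = lm i.+1 y
    & forall a, a != 72%N -> (forall y, (y < k)%N -> a != (8 * (i * N + y) + 3)%N) ->
        (forall y, (y < k)%N -> a != (8 * y + 2)%N) ->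
        rcell s a = rcell s1 a].

Lemma prog_mix_loop i s1 : icell s1 4 = i ->
  rcell s1 64 = \sum_(y < N) sw i y -> rcell s1 (8 * i + 4)%N = gw i ->
  (forall y, (y < N)%N -> rcell s1 (8 * (i * N + y) + 3)%N = sw i y) ->
  (forall y, (y < N)%N -> rcell s1 (8 * y + 2)%N = lm i y) ->
  runs inp (For 6 IStates prog_mix) s1
    (N * (1 + time prog_mix + 12) + (1 + 9)) (mix_inv s1 i N).
Proof.
move=> i4 r64 rg rq rm; apply: runs_for.
- split => //=; first by move=> a /negbTE ->.
  by rewrite big_ord0 addr0.
- by move=> k s' _ [].
- move=> k s kN [k6 fi zE wE fr].
  have s4 : icell s 4 = i by rewrite fi.
  have s64 : rcell s 64 = \sum_(y < N) sw i y.
    by rewrite fr ?r64// => y _; apply/eqP; lia.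
  have sg : rcell s (8 * i + 4)%N = gw i.
    by rewrite fr ?rg// => [|y _|y _]; apply/eqP; lia.
  have sq : rcell s (8 * (i * N + k) + 3)%N = sw i k.
    by rewrite fr ?rq// => [|y yk|y yk]; apply/eqP; lia.
  have sm : rcell s (8 * k + 2)%N = lm i k.
    by rewrite fr ?rm// => [|y yk|y yk]; apply/eqP; lia.
  have qE : sw i k / \sum_(y < N) sw i y = qw i k by [].
  have mE : (1 - gw i) * lm i k + gw i * qw i k = lm i.+1 k.
    by rewrite /lm /= /on_states kN.
  apply: runs_straight => //=; rewrite -/N s4 k6 !eqxx; cell_cases.
  rewrite sq s64 sg sm qE; split => /=.
  + by rewrite addn1.
  + by move=> a a6; rewrite (negbTE a6) fi.
  + by cell_cases; rewrite big_ord_recr/= zE addrA.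
  + move=> y; rewrite ltnS leq_eqVlt => /predU1P[->|yk].
      by rewrite !eqxx; cell_cases.
    by have [h1 h2] := wE y yk; cell_cases.
  + move=> a a72 ay am; rewrite (negbTE a72) (negbTE (ay k _))// (negbTE (am k _))//.
    by apply: fr => // y yk; [apply: ay|apply: am]; rewrite ltnW.
Qed.

Definition level_time : nat :=
  time prog_weight + (N * (1 + time prog_share + 12) + (1 + 9)
  + (time prog_expert + (N * (1 + time prog_mix + 12) + (1 + 9)
  + time prog_relative))).

Lemma prog_level_correct i s : midway i s -> (i < levels T)%N ->
  runs inp prog_level s level_time
    (fun s' => midway i.+1 (set_icell s' 4 (icell s' 4 + 1)%N)).
Proof.
move=> mid iJ; have [fi i8' fr [r48 r56 r64 rg']] := prog_weight_sem mid iJ.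
have [[i1 i2 i3 i4 [i5 i7 i8]] [[r0 r8 r16 r24 [r32 r40 rP rm]] [rg rr rq]]] := mid.
apply: (@runs_seq _ _ _ _ _ _ _ (fun s' => s' = sem inp prog_weight s)).
  exact: runs_straight.
move=> _ ->; move: (sem inp prog_weight s) fi i8' fr r48 r56 r64 rg' => s1 fi i8' fr r48 r56 r64 rg'.
apply: runs_seq.
  apply: (@prog_share_loop i) => //; first by rewrite fi.
    by rewrite fr//; apply/eqP; lia.
  move=> y yN; rewrite fr; try (by apply/eqP; lia).
  by rewrite rq// ltnn.
move=> s2 [k6 gi zE wE gr].
apply: (@runs_seq _ _ _ _ _ _ _ (fun s' => s' = sem inp prog_expert s2)).
  exact: runs_straight.
move=> _ ->; set s3 := sem _ _ _.
have i3E a : icell s3 a = icell s2 a by [].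
have r72 : rcell s3 72 = D * (1 - expR (- share_exponent N T D i) * (1 - share_rate T) + scale T i).
  rewrite /s3 /= !gr; try (by move=> *; apply/eqP; lia).
  rewrite r56 r48 fr; try (by apply/eqP; lia).
  by rewrite r24 sub0r.
have r3E a : a != 72%N -> rcell s3 a = rcell s2 a by rewrite /s3 /= => /negbTE ->.
clearbody s3.
apply: runs_seq.
  apply: (@prog_mix_loop i) => //.
  - by rewrite i3E gi// fi.
  - by rewrite r3E.
  - rewrite r3E; last by apply/eqP; lia.
    by rewrite gr ?rg'// => [|y _]; apply/eqP; lia.
  - by move=> y yN; rewrite r3E ?wE//; apply/eqP; lia.
  - move=> y yN; rewrite r3E; last by apply/eqP; lia.
    rewrite gr => [||y' _]; try (by apply/eqP; lia).
    rewrite fr; try (by apply/eqP; lia).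
    by apply: rm; exact: ltnW.
move=> s4 [k6' hi z4 w4 hr].
have ia a : a != 6%N -> a != 8%N -> icell s4 a = icell s a.
  by move=> h1 h2; rewrite hi// i3E gi// fi.
have j8 : icell s4 8 = (2 ^ i.+1)%N by rewrite hi// i3E gi.
have ra a : a != 48%N -> a != 56%N -> a != 64%N -> a != 72%N -> a != (8 * i + 4)%N ->
    (forall y, (y < N)%N -> a != (8 * (i * N + y) + 3)%N) ->
    (forall y, (y < N)%N -> a != (8 * y + 2)%N) -> rcell s4 a = rcell s a.
  by move=> h1 h2 h3 h4 h5 h6 h7; rewrite hr// r3E// gr// fr.
have rg4 : rcell s4 (8 * i + 4)%N = gw i.
  rewrite hr => [||y _|y _]; try (by apply/eqP; lia).
  rewrite r3E; last by apply/eqP; lia.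
  by rewrite gr => [||y _] //; apply/eqP; lia.
have e4 : rcell s4 72 = ex i by rewrite z4 r72 addrC.
have c4 : rcell s4 40 = lc i.
  by rewrite ra ?r40// => [|y _|y _]; apply/eqP; lia.
have mN : rcell s4 (8 * N + 2)%N = lm i N.
  by rewrite ra ?rm// => [|||||y _|y yN]; apply/eqP; lia.
have j4 : icell s4 4 = i by rewrite ia.
apply: runs_straight => //=; rewrite -/N j4; cell_cases; rewrite c4 e4 rg4 mN.
split.
  rewrite /= j8 (ia 1%N)// (ia 2%N)// (ia 3%N)// (ia 5%N)// (ia 7%N)//.
  by rewrite i1 i2 i3 i5 i7 addn1.
split.
  split => /=; cell_cases.
  - by rewrite ra// => [|y _|y _]; apply/eqP; lia.
  - by rewrite ra// => [|y _|y _]; apply/eqP; lia.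
  - by rewrite ra// => [|y _|y _]; apply/eqP; lia.
  - by rewrite ra// => [|y _|y _]; apply/eqP; lia.
  split => /=; cell_cases.
  - by rewrite ra// => [|y _|y _]; apply/eqP; lia.
  - by [].
  - move=> f fN; cell_cases; rewrite ra ?rP// => [|||||y _|y _]; apply/eqP; lia.
  - move=> f; rewrite leq_eqVlt => /predU1P[->|fN].
      rewrite eqxx; cell_cases.
      by rewrite /lm /= /on_states ltnn mulr0 addr0.
    by cell_cases; case: (w4 f fN).
split => /= j.
- move=> jJ; cell_cases.
  have [->|ji] := eqVneq j i; first by rewrite ltnSn.
  rewrite ra; try (by move=> *; apply/eqP; lia).
  by rewrite rg// ltnS (leq_eqVlt j) (negbTE ji).
- move=> jJ; have [->|ji] := eqVneq j i; first by cell_cases; rewrite ltnSn.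
  have ji' : j <> i by apply/eqP.
  cell_cases; rewrite ra; try (by move=> *; apply/eqP; lia).
  by rewrite rr// ltnS (leq_eqVlt j) (negbTE ji).
- move=> x jJ xN; cell_cases.
  have [->|ji] := eqVneq j i; first by rewrite ltnSn; case: (w4 x xN).
  rewrite ra; try (by move=> *; apply/eqP; lia).
    by rewrite rq// ltnS (leq_eqVlt j) (negbTE ji).
  move=> y yN; apply/eqP => /(share_addr_inj xN yN)[ij _].
  by rewrite ij eqxx in ji.
Qed.

Let J := levels T.

Lemma prog_levels_correct s : (0 < T)%N ->
  runs inp prog_levels s (time (Seq (SetI (INat 5) (INat 1)) (SetI (INat 7) (INat 0)))
    + (J * 17 + 5))
    (fun s' => [/\ icell s' 5 = (2 ^ J)%N, icell s' 7 = J,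
       forall a, a != 5%N -> a != 7%N -> icell s' a = icell s a & rcell s' = rcell s]).
Proof.
move=> T0; apply: runs_seq.
  exact: (@runs_straight _ _ _ _ (fun s' => s' = sem inp
    (Seq (SetI (INat 5) (INat 1)) (SetI (INat 7) (INat 0))) s)).
move=> _ ->; pose Inv k s' := [/\ icell s' 5 = (2 ^ k)%N, icell s' 7 = k,
       forall a, a != 5%N -> a != 7%N -> icell s' a = icell s a & rcell s' = rcell s].
apply: (@runs_while _ _ _ _ Inv _ 0 J 12) => //.
- by split => //= a /negbTE -> /negbTE ->.
- move=> k s'; rewrite add0n => kJ [h5 h7 hi hr]; split.
    rewrite /= h5 (leq_trans _ (trunc_logP (isT : (1 < 2)%N) T0))//.
    by rewrite leq_exp2l.
  apply: runs_straight => //; split => //=.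
  + by rewrite h5 expnSr.
  + by rewrite h7 addn1.
  + by move=> a /negbTE h1 /negbTE h2; rewrite h1 h2 hi ?h1 ?h2.
- by move=> s'; rewrite add0n => -[h5 _ _ _]; rewrite /= h5 -ltnNge trunc_log_ltn.
Qed.

Lemma prog_mix0_correct s :
  runs inp prog_mix0 s
    (N * (1 + time (SetR (new_mix (ic 6)) (RNat (INat 0))) + 12) + (1 + 9)
      + time (SetR (new_mix IStates) (RNat (INat 1))))
    (fun s' => [/\ forall a, a != 6%N -> icell s' a = icell s a,
       forall f, (f <= N)%N -> rcell s' (8 * f + 2)%N = (f == N)%:R
     & forall a, (forall f, (f <= N)%N -> a != (8 * f + 2)%N) -> rcell s' a = rcell s a]).
Proof.
pose Inv k s' := [/\ icell s' 6 = k, forall a, a != 6%N -> icell s' a = icell s a,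
       forall f, (f < k)%N -> rcell s' (8 * f + 2)%N = 0
     & forall a, (forall f, (f < k)%N -> a != (8 * f + 2)%N) -> rcell s' a = rcell s a].
apply: (@runs_seq _ _ _ _ _ _ _ (Inv N)).
  apply: runs_for.
  - by split => //= a /negbTE ->.
  - by move=> k s' _ [].
  - move=> k s' kN [k6 hi hz hr]; apply: runs_straight => //=; rewrite k6.
    split => /=; first by rewrite addn1.
    + by move=> a a6; rewrite (negbTE a6) hi.
    + move=> f; rewrite ltnS leq_eqVlt => /predU1P[->|fk]; first by rewrite eqxx.
      by cell_cases; exact: hz.
    + move=> a ha; rewrite (negbTE (ha k _))//.
      by apply: hr => f fk; apply: ha; rewrite ltnW.
move=> s1 [k6 hi hz hr]; apply: runs_straight => //=; split => //=.
- move=> f; rewrite leq_eqVlt => /predU1P[->|fN]; first by rewrite !eqxx.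
  by rewrite -/N; cell_cases; rewrite hz.
- move=> a ha; rewrite (negbTE (ha N _))//.
  by apply: hr => f fN; apply: ha; rewrite ltnW.
Qed.

Let tune := prog_params (trunc_log 2 N).+1.

Definition mixture_time : nat :=
  time (Seq (SetI (INat 5) (INat 1)) (SetI (INat 7) (INat 0))) + (J * 17 + 5)
  + (time tune
  + (N * (1 + time (SetR (new_mix (ic 6)) (RNat (INat 0))) + 12) + (1 + 9)
      + time (SetR (new_mix IStates) (RNat (INat 1)))
  + (time (SetI (INat 8) (INat 1)) + (J * (2 + level_time + 12) + (2 + 9))))).

(** The remainder of the round is an argument, so that [prog_round] after [prog_init] is an instance
    by conversion. *)
Definition prog_mixture (rest : cmd) : cmd :=
  Seq prog_levels (Seq tune (Seq prog_mix0 (Seq (SetI (INat 8) (INat 1))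
    (Seq (For 4 (ic 7) prog_level) rest)))).

Lemma prog_mixture_correct s rest n (Q : store R -> Prop) : (0 < T)%N -> represents st (e, v) s ->
  (forall s', midway J s' -> runs inp rest s' n Q) ->
  runs inp (prog_mixture rest) s (mixture_time + n) Q.
Proof.
move=> T0 [[i1 i2 i3 r0] [rP rg rr rq]] hrest; rewrite /mixture_time -addnA.
apply: runs_seq (prog_levels_correct s T0) _ => s1 [a5 a7 ai ar].
rewrite -addnA.
apply: (@runs_seq _ _ _ _ _ _ _ (fun s' => s' = sem inp tune s1)).
  exact: runs_straight.
move=> _ ->; set s2 := sem _ _ _.
have bi a : a != 3%N -> icell s2 a = icell s1 a by rewrite /s2 /= => /negbTE ->.
have b3 : icell s2 3 = b by [].
have br a : (a %% 8)%N != 0%N -> rcell s2 a = rcell s a.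
  move=> h; have h' : (a %% 8)%N <> 0%N by apply/eqP.
  by rewrite /s2 /=; cell_cases; rewrite ar.
have br0 : rcell s2 0 = v by rewrite /s2 /= ar.
have [b8 b16 b24] : [/\ rcell s2 8 = bound D, rcell s2 16 = floor_weight T &
    rcell s2 24 = share_rate T] by [].
have b32 : rcell s2 32 = tuning N T D by rewrite /s2 /= a7.
have b40 : rcell s2 40 = lc 0 by rewrite /s2 /= ai// i3.
clearbody s2; rewrite -addnA.
apply: runs_seq (prog_mix0_correct s2) _ => s3 [ci cm cr].
rewrite -addnA.
apply: (@runs_seq _ _ _ _ _ _ _ (fun s' => s' = sem inp (SetI (INat 8) (INat 1)) s3)).
  exact: runs_straight.
move=> _ ->; apply: runs_seq; last exact: hrest.
apply: runs_for.
- split.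
    rewrite /= (ci 1%N)// (ci 2%N)// (ci 3%N)// (ci 5%N)// (ci 7%N)// b3.
    rewrite (bi 1%N)// (bi 2%N)// (bi 5%N)// (bi 7%N)// (ai 1%N)// (ai 2%N)//.
  split.
    split; first by rewrite /= cr// => *; apply/eqP; lia.
    - by rewrite /= cr// => *; apply/eqP; lia.
    - by rewrite /= cr// => *; apply/eqP; lia.
    - by rewrite /= cr// => *; apply/eqP; lia.
    split; first by rewrite /= cr// => *; apply/eqP; lia.
    - by rewrite /= cr// => *; apply/eqP; lia.
    - move=> f fN; rewrite /= cr; last by move=> *; apply/eqP; lia.
      by rewrite br ?rP//; apply/eqP; lia.
    - by move=> f fN; rewrite /= cm.
  split => [j jJ|j jJ|j x jJ xN] /=; rewrite cr; try (by move=> *; apply/eqP; lia).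
  + by rewrite br ?rg//; apply/eqP; lia.
  + by rewrite br ?rr//; apply/eqP; lia.
  + by rewrite br ?rq//; apply/eqP; lia.
- by move=> k s' _ [[_ _ _ h4 [_ h7 _]] _]; split.
- by move=> k s' kJ mid; exact: prog_level_correct.
Qed.

Let P := pl_P st.
Let P' := lm J.
Let w f := kernel N.+1 P P' e f.

Definition shift_inv s1 k s : Prop :=
  [/\ icell s 6 = k, forall a, a != 6%N -> icell s a = icell s1 a,
      rcell s 80 = \sum_(f < k) Num.max 0 (P' f - P f)
    & forall a, a != 80%N -> rcell s a = rcell s1 a].

Definition shift_time : nat :=
  time (SetR (INat 80) (RNat (INat 0))) + (N.+1 * (3 + time
       (If (RLe (RCell (old_mix (ic 6))) (RCell (new_mix (ic 6))))
          (SetR (INat 80)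
            (RAdd (rc 80) (RSub (RCell (new_mix (ic 6))) (RCell (old_mix (ic 6))))))
          Skip) + 12) + (3 + 9)).

Lemma prog_shift_correct s :
  (forall f, (f <= N)%N -> rcell s (8 * f + 1)%N = P f) ->
  (forall f, (f <= N)%N -> rcell s (8 * f + 2)%N = P' f) ->
  runs inp prog_shift s shift_time (shift_inv s N.+1).
Proof.
move=> rP rP'; apply: (@runs_seq _ _ _ _ _ _ _
  (fun s' => s' = sem inp (SetR (INat 80) (RNat (INat 0))) s)).
  exact: runs_straight.
move=> _ ->; apply: runs_for.
- split => //=; first by move=> a /negbTE ->.
    by rewrite big_ord0.
  by move=> a /negbTE ->.
- by move=> k s' _ [k6 _ _ _]; rewrite /= addn1.
- move=> k s' kN [k6 hi hz hr]; apply: runs_straight => //=; rewrite k6.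
  have hP : rcell s' (8 * k + 1)%N = P k by rewrite hr ?rP//; apply/eqP; lia.
  have hP' : rcell s' (8 * k + 2)%N = P' k by rewrite hr ?rP'//; apply/eqP; lia.
  rewrite hP hP'; case: ifP => PP'.
    split => /=; first by rewrite k6 addn1.
    + by move=> a a6; rewrite (negbTE a6) hi.
    + by rewrite big_ord_recr/= hz max_r// subr_ge0.
    + by move=> a a80; rewrite (negbTE a80) hr.
  split => /=; first by rewrite k6 addn1.
  + by move=> a a6; rewrite (negbTE a6) hi.
  + rewrite big_ord_recr/= hz max_l ?addr0// subr_le0.
    by move/negbT: PP'; rewrite -ltNge => /ltW.
  + by move=> a a80; rewrite hr.
Qed.

Definition ready s : Prop :=
  [/\ icell s 2 = e, rcell s 80 = shift N.+1 P' P, rcell s 88 = leave P P' e,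
      forall f, (f <= N)%N -> rcell s (8 * f + 1)%N = P f
    & forall f, (f <= N)%N -> rcell s (8 * f + 2)%N = P' f].

Lemma prog_kernel_sem f s : ready s -> icell s 6 = f -> (f <= N)%N ->
  [/\ icell (sem inp prog_kernel s) = icell s,
      rcell (sem inp prog_kernel s) 96 = w f
    & forall a, a != 96%N -> rcell (sem inp prog_kernel s) a = rcell s a].
Proof.
move=> [i2 r80 r88 rP rP'] i6 fN.
have hw : w f = leave P P' e * (Num.max 0 (P' f - P f) / shift N.+1 P' P)
  + (if f == e then 1 - leave P P' e else 0) by [].
have fe : (f <= e)%N && (e <= f)%N = (f == e) by rewrite -eqn_leq.
rewrite /= i6 rP// rP'//.
have [PP'|PP'] := lerP (P f) (P' f); rewrite /= i6 i2 fe.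
  rewrite max_r ?subr_ge0// in hw.
  case: ifP hw => /= _ ->; rewrite r80 r88; split => //=.
  - by move=> a /negbTE ->.
  - by rewrite addr0.
  - by move=> a /negbTE ->.
rewrite max_l ?subr_le0 ?(ltW PP')// mul0r mulr0 in hw.
case: ifP hw => /= _ ->; rewrite ?r88; split => //=.
- by move=> a /negbTE ->.
- by rewrite addr0.
- by move=> a /negbTE ->.
Qed.

Definition frame s1 s : Prop :=
  (forall a, a != 6%N -> icell s a = icell s1 a) /\
  (forall a, a != 0%N -> a != 88%N -> a != 96%N -> rcell s a = rcell s1 a).

Lemma ready_frame s s' : ready s -> icell s' 2 = icell s 2 ->
  (forall a, a != 0%N -> a != 96%N -> rcell s' a = rcell s a) -> ready s'.
Proof.
move=> [i2 r80 r88 rP rP'] hi hr; split; rewrite ?hi ?hr//.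
- by move=> f fN; rewrite hr ?rP//; apply/eqP; lia.
- by move=> f fN; rewrite hr ?rP'//; apply/eqP; lia.
Qed.

Definition scan_time : nat := (bcost prog_scan_guard + time prog_scan_body).+1.

(** The number of turns depends on the coin, so [runs_while], which fixes it, does not fit; the
    induction follows the recursion of [pick] instead. *)
Lemma prog_scan_correct n f u s : (f + n = N)%N -> ready s -> icell s 6 = f ->
  rcell s 0 = u -> rcell s 96 = w f ->
  runs inp (While prog_scan_guard prog_scan_body) s
    (n * scan_time + (bcost prog_scan_guard).+1)
    (fun s' => [/\ icell s' 6 = (pick n w f u).1,
                  rcell s' 0 / rcell s' 96 = (pick n w f u).2 & frame s s']).
Proof.
elim: n f u s => [|n IH] f u s fn rs i6 r0 r96.
  exists (bcost prog_scan_guard).+1, s; split => //.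
    by apply: exec_while_false; rewrite /= i6 -/N -fn addn0 addn1 ltnn.
  by rewrite /= r0 r96.
have guard : beval inp s prog_scan_guard = (w f < u).
  by rewrite /= i6 r0 r96 -/N -fn addn1 addnS ltnS leq_addr/= -ltNge.
have [wu|wu] := boolP (w f < u); last first.
  exists (bcost prog_scan_guard).+1, s; split.
  - by rewrite leq_addl.
  - by apply: exec_while_false; rewrite guard.
  - by rewrite /= (negbTE wu) /= r0 r96.
pose s0 := sem inp (Seq (SetR (INat 0) (RSub (rc 0) (rc 96)))
    (SetI (INat 6) (IAdd (ic 6) (INat 1)))) s.
have rs0 : ready s0.
  by apply: ready_frame rs _ _ => // a /negbTE h _; rewrite /s0 /= h.
have [||h1 h2 h3] := @prog_kernel_sem f.+1 s0 rs0.
- by rewrite /s0 /= i6 addn1.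
- by rewrite -fn addnS ltnS leq_addr.
have bodyE : sem inp prog_scan_body s = sem inp prog_kernel s0 by [].
have [k1 [s1 [c1 e1 q1]]] := @runs_straight _ inp prog_scan_body s (fun s' => s' = sem inp prog_kernel s0) isT bodyE.
rewrite {}q1 in e1; move: (sem inp prog_kernel s0) e1 h1 h2 h3 => {}s1 e1 h1 h2 h3.
have [|||||k2 [s2 [c2 e2 [q1 q2 [q3 q4]]]]] := IH f.+1 (u - w f) s1.
- by rewrite addSn -addnS.
- apply: ready_frame rs0 _ _; first by rewrite h1.
  by move=> a _ a96; rewrite h3.
- by rewrite h1 /s0 /= i6 addn1.
- by rewrite h3// /s0 /= r0 r96.
- by [].
exists (bcost prog_scan_guard + k1 + k2).+1, s2; split.
- by move: c1 c2; rewrite /scan_time; clear; lia.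
- by apply: exec_while_true e1 e2; rewrite guard.
- rewrite /= wu; split => //; split.
  + by move=> a a6; rewrite q3// h1 /s0 /= (negbTE a6).
  + by move=> a a0 a88 a96; rewrite q4// h3// /s0 /= (negbTE a0).
Qed.

Definition sample_time : nat :=
  time (Seq prog_leave prog_kernel) + ((N * scan_time + (bcost prog_scan_guard).+1)
    + time (Seq (SetR (INat 0) (RDiv (rc 0) (rc 96))) (SetI (INat 2) (ic 6)))).

Lemma prog_sample_correct s : (e <= N)%N -> icell s 2 = e -> rcell s 0 = v ->
  rcell s 80 = shift N.+1 P' P ->
  (forall f, (f <= N)%N -> rcell s (8 * f + 1)%N = P f) ->
  (forall f, (f <= N)%N -> rcell s (8 * f + 2)%N = P' f) ->
  runs inp prog_sample s sample_time
    (fun s' => [/\ icell s' 2 = (pick N w 0 v).1, rcell s' 0 = (pick N w 0 v).2,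
      forall a, a != 2%N -> a != 6%N -> icell s' a = icell s a
    & forall a, a != 0%N -> a != 88%N -> a != 96%N -> rcell s' a = rcell s a]).
Proof.
move=> eN i2 r0 r80 rP rP'; pose s0 := sem inp prog_leave s.
have s0i a : a != 6%N -> icell s0 a = icell s a.
  by move=> /negbTE h; rewrite /s0 /= h; case: ifP.
have s06 : icell s0 6 = 0%N by [].
have s0r a : a != 88%N -> rcell s0 a = rcell s a.
  by move=> /negbTE h; rewrite /s0 /=; case: ifP => _ /=; rewrite h.
have s088 : rcell s0 88 = leave P P' e.
  rewrite /s0 /leave /= i2 rP// rP'//.
  have [PP'|PP'] := lerP (P e) (P' e) => /=.
    by rewrite max_l ?subr_le0// mul0r.
  by rewrite max_r// subr_ge0 ltW.
have rs0 : ready s0.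
  split => //; [by rewrite s0i|by rewrite s0r| |].
  - by move=> f fN; rewrite s0r ?rP//; apply/eqP; lia.
  - by move=> f fN; rewrite s0r ?rP'//; apply/eqP; lia.
have [h1 h2 h3] := prog_kernel_sem rs0 s06 (leq0n N).
apply: (@runs_seq _ _ _ _ _ _ _ (fun s' => s' = sem inp prog_kernel s0)).
  exact: runs_straight.
move=> _ ->; move: (sem inp prog_kernel s0) h1 h2 h3 => s1 h1 h2 h3.
apply: runs_seq.
  apply: (@prog_scan_correct N 0 v s1) => //.
  - by apply: ready_frame rs0 _ _; rewrite ?h1// => a _ a96; rewrite h3.
  - by rewrite h1.
  - by rewrite h3// s0r.
move=> s2 [q6 q0 [qi qr]]; apply: runs_straight => //=; split => //=.
- by move=> a a2 a6; rewrite (negbTE a2) qi// h1 s0i.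
- by move=> a a0 a88 a96; rewrite (negbTE a0) qr// h3// s0r.
Qed.

Definition output_time : nat :=
  (N.+1 * (3 + time (SetR (old_mix (ic 6)) (RCell (new_mix (ic 6)))) + 12) + (3 + 9))
  + time (If (ILe IStates (ic 2)) (SetI (INat 0) IBase) (SetI (INat 0) (ic 2))).

Lemma prog_output_correct s :
  (forall f, (f <= N)%N -> rcell s (8 * f + 2)%N = P' f) ->
  runs inp prog_output s output_time
    (fun s' => [/\ icell s' 0 = (if icell s 2 < N then icell s 2 else b)%N,
      forall a, a != 0%N -> a != 6%N -> icell s' a = icell s a,
      forall f, (f <= N)%N -> rcell s' (8 * f + 1)%N = P' f
    & forall a, (forall f, (f <= N)%N -> a != (8 * f + 1)%N) -> rcell s' a = rcell s a]).
Proof.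
move=> rP'; pose Inv k s' := [/\ icell s' 6 = k,
    forall a, a != 6%N -> icell s' a = icell s a,
    forall f, (f < k)%N -> rcell s' (8 * f + 1)%N = P' f
  & forall a, (forall f, (f < k)%N -> a != (8 * f + 1)%N) -> rcell s' a = rcell s a].
apply: (@runs_seq _ _ _ _ _ _ _ (Inv N.+1)).
  apply: runs_for.
  - by split => //= a /negbTE ->.
  - by move=> k s' _ [k6 _ _ _]; rewrite /= addn1.
  - move=> k s' kN [k6 hi hz hr]; apply: runs_straight => //=; rewrite k6.
    rewrite hr; last by move=> f fk; apply/eqP; lia.
    rewrite rP'//; split => /=; first by rewrite ?k6 addn1.
    + by move=> a a6; rewrite (negbTE a6) hi.
    + move=> f; rewrite ltnS leq_eqVlt => /predU1P[->|fk]; first by rewrite eqxx.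
      by cell_cases; exact: hz.
    + move=> a ha; rewrite (negbTE (ha k _))//.
      by apply: hr => f fk; apply: ha; rewrite ltnW.
move=> s1 [k6 hi hz hr]; apply: runs_straight => //=.
rewrite -/N hi//; have [h|h] := leqP N (icell s 2); split => //=.
- by move=> a a0 a6; rewrite (negbTE a0) hi.
- by move=> a a0 a6; rewrite (negbTE a0) hi.
Qed.

Definition round_time : nat :=
  time prog_init + (mixture_time + (shift_time + (sample_time + output_time))).

Let st' := plan_step N T D dst l b st.
Let ev' := pick N (kernel N.+1 (pl_P st) (pl_P st') e) 0 v.

Lemma prog_round_after_init s : (0 < T)%N -> (e <= N)%N -> represents st (e, v) s ->
  runs inp (prog_mixture (Seq prog_shift (Seq prog_sample prog_output))) s
    (mixture_time + (shift_time + (sample_time + output_time)))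
    (fun s' => represents st' ev' s' /\
       icell s' 0 = (if ev'.1 < N then ev'.1 else b)%N).
Proof.
move=> T0 eN rep; apply: (prog_mixture_correct T0 rep) => s1 mid1; move: mid1.
move=> [[i1 i2 i3 i4 [i5 i7 i8]] [[r0 r8 r16 r24 [r32 r40 rP rm]] [rg rr rq]]].
apply: runs_seq (prog_shift_correct rP rm) _ => s2 [_ hi h80 hr].
apply: runs_seq.
  apply: (@prog_sample_correct s2) => //.
  - by rewrite hi.
  - by rewrite hr.
  - by move=> f fN; rewrite hr ?rP//; apply/eqP; lia.
  - by move=> f fN; rewrite hr ?rm//; apply/eqP; lia.
move=> s3 [e2 e0 gi gr].
apply: runs_weaken (leqnn _) _ (@prog_output_correct s3 _); last first.
  move=> f fN; rewrite gr; try (by apply/eqP; lia).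
  by rewrite hr ?rm//; apply/eqP; lia.
move=> s4 [z0 zi zP zr]; split; last by rewrite z0 e2.
split.
  split; first by rewrite zi// gi// hi.
  - by rewrite zi.
  - by rewrite zi// gi// hi.
  - by rewrite zr// => f _; apply/eqP; lia.
split => [f fN|i iJ|i iJ|i x iJ xN]; first by rewrite zP.
- rewrite zr; last by move=> *; apply/eqP; lia.
  rewrite gr; try (by apply/eqP; lia).
  by rewrite hr ?rg ?iJ//; apply/eqP; lia.
- rewrite zr; last by move=> *; apply/eqP; lia.
  rewrite gr; try (by apply/eqP; lia).
  by rewrite hr ?rr ?iJ//; apply/eqP; lia.
- rewrite zr; last by move=> *; apply/eqP; lia.
  rewrite gr; try (by apply/eqP; lia).
  by rewrite hr ?rq ?iJ//; apply/eqP; lia.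
Qed.

Lemma prog_init_again s : represents st (e, v) s ->
  runs inp prog_init s (time prog_init) (fun s' => represents st (e, v) s').
Proof.
move=> rep; have [[i1 _ _ _] _] := rep.
exists (bcost (ILe (ic 1) (INat 0)) + 1).+1, s; split => //.
by apply: exec_if; rewrite /= i1; constructor.
Qed.

Lemma prog_init_first u :
  runs inp prog_init (initial_store [:: u]) (time prog_init)
    (fun s' => represents (plan0 N) (N, u) s').
Proof.
pose s0 := set_rcell (Store (icell (initial_store [:: u])) (rcell (initial_store [:: u])) [::]) 0 u.
pose c := Seq (SetI (INat 1) (INat 1))
        (Seq (SetI (INat 2) IStates) (SetR (old_mix IStates) (RNat (INat 1)))).
have [k [s1 [kc ec q]]] := @runs_straight _ inp c s0 (fun s' => s' = sem inp c s0) isT erefl.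
exists (bcost (ILe (ic 1) (INat 0)) + (2 + k)).+1, s1; split.
- by move: kc; rewrite /c /=; clear; lia.
- apply: exec_if => /=; apply: exec_seq ec.
  exact: exec_sample.
rewrite q /c /=; split; first by split => //=; rewrite -/N; cell_cases.
split => [f fN|i iJ|i iJ|i x iJ xN] /=; rewrite -/N; cell_cases => //.
have [->|/eqP fn] := eqVneq f N; first by rewrite !eqxx.
by cell_cases.
Qed.

Lemma prog_round_again s : (0 < T)%N -> (e <= N)%N -> represents st (e, v) s ->
  runs inp (prog_round (trunc_log 2 N).+1) s round_time
    (fun s' => represents st' ev' s' /\
       icell s' 0 = (if ev'.1 < N then ev'.1 else b)%N).
Proof.
move=> T0 eN rep; apply: runs_seq (prog_init_again rep) _ => s1 rep1.
exact: prog_round_after_init.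
Qed.

Definition round_constant : nat := 2000.

(** The time is a combination of 1, [N], [J] and [N * J], each at most [N * J]; 2000 covers the sum
    of the coefficients. *)
Lemma round_time_le : (0 < N)%N -> (round_time <= round_constant * (N * J))%N.
Proof.
have : (0 < J)%N by [].
rewrite /round_time /mixture_time /shift_time /sample_time /output_time.
rewrite /level_time /scan_time /round_constant; move: N J => n j /=.
by nia.
Qed.

End RoundCorrect.

(** * Running the cascade on a metrical task system *)

Section Extensionality.
Context {R : realType}.
Variables (N T : nat) (D : R) (dst : nat -> nat -> R).

Lemma plan_ext (l l' : nat -> nat -> R) (b b' : nat -> nat) t :
  (forall s, (0 < s <= t)%N -> l s = l' s /\ b s = b' s) ->
  plan N T D dst l b t = plan N T D dst l' b' t.
Proof.
elim: t => //= t IH h; rewrite IH => [|s /andP[s0 st]]; last first.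
  by apply: h; rewrite s0 ltnW.
by have [|-> ->] := h t.+1; rewrite ?leqnn.
Qed.

Lemma chain_ext (P P' : nat -> nat -> R) t u :
  (forall s, (s <= t)%N -> P s = P' s) -> chain N P t u = chain N P' t u.
Proof.
elim: t => //= t IH h; rewrite IH => [|s st]; last by apply: h; exact: ltnW.
by rewrite !h.
Qed.

End Extensionality.

Section Run.
Context {R : realType} {X : finType}.
Variables (M : mts R X) (T : nat).

Let N := #|X|.
Let D := diameter M.

(** The same expression as in [round_input], so that what the program reads and what the plan uses
    agree by conversion. *)
Definition index_dist (i j : nat) : R :=
  nth 0 (nth [::] [seq [seq dist M x y | y <- enum X] | x <- enum X] i) j.

Definition index_loss (l : X -> R) (i : nat) : R := nth 0 [seq l x | x <- enum X] i.

Definition run_plan (l : nat -> X -> R) (b : nat -> X) t : plan_state R :=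
  plan N T D index_dist (fun s => index_loss (l s)) (fun s => state_index (b s)) t.

Definition run_chain (l : nat -> X -> R) (b : nat -> X) t (u : R) : nat * R :=
  chain N (fun s => pl_P (run_plan l b s)) t u.

Definition place (x : X) e : X := if (e < N)%N then nth x (enum X) e else x.

Definition position (l : nat -> X -> R) (b : nat -> X) u t : X :=
  place (b t) (run_chain l b t u).1.

Lemma run_plan_ext l l' b b' t :
  (forall s, (0 < s <= t)%N -> l s = l' s /\ b s = b' s) ->
  run_plan l b t = run_plan l' b' t.
Proof. by move=> h; apply: plan_ext => s /h[-> ->]. Qed.

(** Causality: only the losses and base states up to [t] matter, which lets the construction answer
    from a list of past losses. *)
Lemma position_ext l l' b b' u t :
  (forall s, (0 < s <= t)%N -> l s = l' s) -> (forall s, (s <= t)%N -> b s = b' s) ->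
  position l b u t = position l' b' u t.
Proof.
move=> hl hb; rewrite /position hb//; congr (place _ _.1).
apply: chain_ext => s st; congr pl_P; apply: run_plan_ext => r /andP[r0 rs].
by rewrite hl ?hb ?r0//=; exact: leq_trans st.
Qed.

Lemma measurable_position l b t x :
  measurable [set u : measurableTypeR R | position l b u t = x].
Proof.
pose P s := pl_P (run_plan l b s).
rewrite (_ : [set _ | _] = \bigcup_(e in [set e : 'I_N.+1 | place (b t) e = x])
    (chain_ord N P t @^-1` [set e])).
  apply: fin_bigcup_measurable; first exact: finite_finset.
  by move=> e _; exact: measurable_chain_ord.
apply/seteqP; split => u /=.
  by move=> h; exists (chain_ord N P t u) => //=; rewrite chain_ordE.
by case=> e /= h1 h2; rewrite /position -h1 -h2 chain_ordE.
Qed.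

Hypothesis X0 : (0 < #|X|)%N.
Hypothesis T0 : (0 < T)%N.

Lemma dist_ge0 x y : 0 <= dist M x y.
Proof.
have := dist_triangle M x y x; rewrite dist_refl (dist_sym M y x); lra.
Qed.

Lemma dist_le_diameter x y : dist M x y <= D.
Proof.
apply: le_trans (le_bigmax 0 (fun x => \big[Num.max/0]_(y : X) dist M x y) x).
exact: (le_bigmax 0 (fun y => dist M x y) y).
Qed.

Lemma diameter_ge0 : 0 <= D.
Proof. by have /card_gt0P[x _] := X0; apply: le_trans (dist_ge0 x x) (dist_le_diameter x x). Qed.

Let size_enum : size (enum X) = N. Proof. by rewrite -cardE. Qed.

Lemma index_lossE l x e : (e < N)%N -> index_loss l e = l (nth x (enum X) e).
Proof. by move=> eN; rewrite /index_loss (nth_map x) ?size_enum. Qed.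

Lemma index_loss_state l x : index_loss l (state_index x) = l x.
Proof.
have xe : x \in enum X by rewrite mem_enum.
rewrite (@index_lossE l x); first by rewrite nth_index.
by rewrite -size_enum /state_index index_mem.
Qed.

Lemma index_dist_state x y : index_dist (state_index x) (state_index y) = dist M x y.
Proof.
have xe (z : X) : z \in enum X by rewrite mem_enum.
have xs (z : X) : (state_index z < size (enum X))%N by have := xe z; rewrite -index_mem.
by rewrite /index_dist (nth_map x)// (nth_map y)// !nth_index.
Qed.

Lemma index_dist_bounds i j : 0 <= index_dist i j <= D.
Proof.
have [x _] := card_gt0P X0.
rewrite /index_dist; have [iN|Ni] := ltnP i (size (enum X)); last first.
  rewrite (_ : nth [::] _ i = [::]); first by rewrite nth_nil lexx diameter_ge0.
  by apply: nth_default; rewrite size_map.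
rewrite (nth_map x)//; have [jN|Nj] := ltnP j (size (enum X)); last first.
  rewrite (_ : nth 0 _ j = 0); first by rewrite lexx diameter_ge0.
  by apply: nth_default; rewrite size_map.
by rewrite (nth_map x)// dist_ge0 dist_le_diameter.
Qed.

Section OneRun.
Variables (l : nat -> X -> R) (b : nat -> X).
Hypothesis l01 : forall t x, 0 <= l t x <= 1.

Let il t := index_loss (l t).
Let ib t := state_index (b t).

Lemma index_loss_bounds t i : 0 <= il t i <= 1.
Proof.
have [x _] := card_gt0P X0; rewrite /il /index_loss.
have [iN|Ni] := ltnP i (size (enum X)); first by rewrite (nth_map x).
rewrite (_ : nth 0 _ i = 0); first by rewrite lexx ler01.
by apply: nth_default; rewrite size_map.
Qed.

Definition run_cost t : R := cost_at N T D index_dist il ib (levels T) t.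

Let P t := pl_P (run_plan l b t).

Let P_distr t : distr N.+1 (P t).
Proof. exact: plan_distr. Qed.

Definition step_cost t0 t e f : R :=
  l t (place (b t) f)
  + (if (t0.+1 < t)%N then dist M (place (b t) f) (place (b t.-1) e) else 0).

Lemma step_cost_ge0 t0 t e f : 0 <= step_cost t0 t e f.
Proof.
rewrite addr_ge0//; first by case/andP: (l01 t (place (b t) f)).
by case: ifP => // _; exact: dist_ge0.
Qed.

(** Apply [kernel_cost] with the actual distances. On the diagonal a state expert stays put, and the
    base expert pays its own movement, which [expert_cost] contains. *)
Lemma step_cost_mean t0 t : (t0 <= t)%N ->
  \sum_(e < N.+1) \sum_(f < N.+1)
     P t e * kernel N.+1 (P t) (P t.+1) e f * step_cost t0 t.+1 e f
  <= run_cost t.+1.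
Proof.
move=> t0t.
have push (F : nat -> R) : \sum_(e < N.+1) \sum_(f < N.+1)
     P t e * kernel N.+1 (P t) (P t.+1) e f * F f = \sum_(f < N.+1) P t.+1 f * F f.
  rewrite exchange_big/=; apply: eq_bigr => f _; rewrite -mulr_suml.
  by rewrite (kernel_push (P_distr t) (P_distr t.+1)).
under eq_bigr do under eq_bigr do rewrite mulrDr.
under eq_bigr do rewrite big_split/=.
rewrite big_split/= [X in X + _](push (fun f => l t.+1 (place (b t.+1) f))).
have ec f : (f < N.+1)%N ->
    l t.+1 (place (b t.+1) f) <=
      expert_cost N T D index_dist il ib t.+1 f.
  move=> fN; rewrite /expert_cost /place; case: ltnP => h.
    by rewrite /il (index_lossE _ (b t.+1)).
  rewrite /il /ib index_loss_state lerDl.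
  by case/andP: (index_dist_bounds (state_index (b t.+1)) (pl_b (run_plan l b t))).
have [tt0|tt0] := ltnP t0.+1 t.+1; last first.
  rewrite [X in _ + X]big1 ?addr0; last first.
    by move=> e _; rewrite big1// => f _; rewrite mulr0.
  have := mix_loss il ib X0 T0 index_dist_bounds t (leqnn (levels T)).
  apply: le_trans; apply: ler_sum => f _.
  by rewrite ler_wpM2l ?ec//; case: (P_distr t.+1).
case: t t0t tt0 push ec => [|t] // t0t _ push ec.
pose d e f := dist M (place (b t.+2) f) (place (b t.+1) e).
have d1 e f : d e f <= D by exact: dist_le_diameter.
have d2 e : 0 <= d e e by exact: dist_ge0.
have kc := kernel_cost (P_distr t.+1) (P_distr t.+2) d1 d2.
have mm := mix_move_loss ib X0 T0 index_dist_bounds index_loss_bounds t (leqnn (levels T)).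
apply: le_trans (_ : \sum_(f < N.+1) P t.+2 f * l t.+2 (place (b t.+2) f) +
   (\sum_(e < N.+1) P t.+2 e * d e e + D * shift N.+1 (P t.+1) (P t.+2)) <= _).
  by rewrite lerD2l.
apply: le_trans mm; rewrite addrA lerD2r -big_split/=.
apply: ler_sum => f _; rewrite -mulrDr ler_wpM2l//; first by case: (P_distr t.+2).
rewrite /expert_cost /d /place; case: ltnP => h.
  have -> : nth (b t.+1) (enum X) f = nth (b t.+2) (enum X) f.
    by apply: set_nth_default; rewrite size_enum.
  by rewrite dist_refl addr0 /il (index_lossE _ (b t.+2)).
by rewrite /il /ib index_loss_state /= index_dist_state.
Qed.

Lemma position_cost_mean t0 k :
  (\int[coin_law]_u (cost M l (position l b u) t0 k)%:E
   <= (\sum_(t0.+1 <= t < (t0 + k).+1) run_cost t)%:E)%E.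
Proof.
have costE u : cost M l (position l b u) t0 k =
  \sum_(t0 <= t < t0 + k) step_cost t0 t.+1 (run_chain l b t u).1 (run_chain l b t.+1 u).1.
  rewrite /cost /step_cost big_split/= big_add1; congr (_ + _).
  case: k => [|k]; first by rewrite addn0 !big_geq.
  rewrite addnS [RHS]big_ltn ?ltnS ?leq_addr// ltnn add0r big_add1.
  by apply: eq_big_nat => t /andP[h _]; rewrite ltnS h.
under eq_integral do rewrite costE -sumEFin.
rewrite ge0_integral_sum//; first last.
- by move=> t u _; rewrite lee_fin step_cost_ge0.
- by move=> t; exact: (measurable_chain2 _ _ _ (fun e f => step_cost t0 t.+1 e f)).
rewrite -sumEFin big_add1/= !big_nat; apply: lee_sum => t /andP[t0t _].
rewrite (chain_mean2 P_distr _ _ (fun e f => step_cost_ge0 t0 t.+1 e f)).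
  by rewrite lee_fin step_cost_mean.
by move=> e; rewrite /P /run_plan.
Qed.

End OneRun.
End Run.

(** * The combined algorithm *)

Section WithCoin.
Context {d : measure_display} {S : measurableType d} {R : realType}.
Variable P : probability S R.

Definition with_coin : set (S * measurableTypeR R) -> \bar R := (P \x (@coin_law R))%E.

HB.instance Definition _ := Measure.on with_coin.

Lemma with_coinX A V : measurable A -> measurable V ->
  with_coin (A `*` V) = (P A * coin_law V)%E.
Proof. by move=> mA mV; rewrite /with_coin/= product_measure1E. Qed.

Let with_coin_setT : with_coin setT = 1%E.
Proof.
rewrite -setXTT with_coinX// [P _]probability_setT mul1e.
exact: (@probability_setT _ _ R (@coin_law R)).
Qed.

HB.instance Definition _ :=
  Measure_isProbability.Build _ _ R with_coin with_coin_setT.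

End WithCoin.

Section Trajectories.
Context {R : realType} {X : finType}.
Variable M : mts R X.
Implicit Types (A : online_alg M) (l : nat -> X -> R).

Lemma cost_ext l l' i i' t0 k :
  (forall t, (t0 < t <= t0 + k)%N -> l t = l' t) ->
  (forall t, (t0 < t <= t0 + k)%N -> i t = i' t) ->
  cost M l i t0 k = cost M l' i' t0 k.
Proof.
move=> hl hi; rewrite /cost; congr (_ + _); apply: eq_big_nat => t /andP[h1 h2].
  by rewrite hl ?hi// h1.
by rewrite !hi//; apply/andP; split; lia.
Qed.

Lemma cost_ge0 l i t0 k : (forall t x, (t0 < t <= t0 + k)%N -> 0 <= l t x) ->
  0 <= cost M l i t0 k.
Proof.
move=> l0; rewrite /cost !big_nat addr_ge0//; apply: sumr_ge0 => t h.
  exact: l0.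
exact: dist_ge0.
Qed.

Lemma loss_sequenceW l t T : (t <= T)%N -> loss_sequence M T l -> loss_sequence M t l.
Proof. by move=> tT h s /andP[s1 st]; apply: h; rewrite s1 (leq_trans st). Qed.

(** It takes finitely many values, which makes costs measurable and allows splitting along the
    behaviour of the base algorithm. *)
Definition trajectory A l t (w : alg_space A) : {ffun 'I_t.+1 -> X} :=
  [ffun s : 'I_t.+1 => state_at l w s].

Lemma measurable_trajectory A l t tr : loss_sequence M t l ->
  measurable (@trajectory A l t @^-1` [set tr]).
Proof.
move=> hl; rewrite (_ : _ @^-1` _ =
    \bigcap_(s in [set: 'I_t.+1]) [set w | state_at l w s = tr s]).
  apply: fin_bigcap_measurable; first exact: finite_finset.
  move=> s _; apply: respond_measurable; apply: loss_sequenceW hl.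
  by rewrite -ltnS.
apply/seteqP; split => w /=.
  by move=> <- s _; rewrite /= ffunE.
by move=> h; apply/ffunP => s; rewrite ffunE; exact: h.
Qed.

Lemma measurable_cost A l T t0 k : loss_sequence M T l -> (t0 + k <= T)%N ->
  measurable_fun setT (fun w : alg_space A => (cost M l (state_at l w) t0 k)%:E).
Proof.
move=> hl kT.
pose psi (tr : {ffun 'I_T.+1 -> X}) := cost M l (fun s => tr (inord s)) t0 k.
rewrite (_ : (fun w => _) = (fun w : alg_space A => (psi (trajectory l T w))%:E)).
  have mX := fun tr => @measurable_trajectory A l T tr hl.
  have h := measurable_finite_valued mX psi.
  exact: h.
apply/funext => w; congr EFin; apply: cost_ext => // t /andP[_ h].
by rewrite ffunE inordK// ltnS (leq_trans h).
Qed.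

Lemma loss_ge0 l T t x : loss_sequence M T l -> (0 < t <= T)%N -> 0 <= l t x <= 1.
Proof. by move=> hl /hl /losses_01. Qed.

Lemma cost_seq_ge0 l T i t0 k : loss_sequence M T l -> (t0 + k <= T)%N ->
  0 <= cost M l i t0 k.
Proof.
move=> hl kT; apply: cost_ge0 => t x /andP[h1 h2].
have tT : (0 < t <= T)%N by rewrite (leq_trans h2 kT) andbT (leq_ltn_trans _ h1).
by case/andP: (loss_ge0 x hl tT).
Qed.

Lemma expected_cost_const A l T t0 k (c : R) : loss_sequence M T l ->
  (t0 + k <= T)%N -> (forall w : alg_space A, cost M l (state_at l w) t0 k <= c) ->
  (expected_cost A l t0 k <= c%:E)%E.
Proof.
move=> hl kT hc; rewrite /expected_cost unlock.
apply: (@le_trans _ _ (\int[alg_prob A]_w (cst c%:E) w)%E); last first.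
  by rewrite integral_cst// [X in (_ * X)%E]probability_setT mule1.
apply: ge0_le_integral => //.
- by move=> w _; rewrite lee_fin (cost_seq_ge0 _ hl).
- exact: measurable_cost hl kT.
- by move=> w _; rewrite lee_fin.
Qed.

(** A loss sequence is constrained on the steps 1 to [T] only, whereas the plan wants values in
    [0, 1] at all times. *)
Definition truncate T l t : X -> R := if (0 < t <= T)%N then l t else fun _ => 0.

Lemma truncateE T l t : (0 < t <= T)%N -> truncate T l t = l t.
Proof. by rewrite /truncate => ->. Qed.

Lemma truncate_sequence T l : loss_sequence M T l -> loss_sequence M T (truncate T l).
Proof. by move=> hl t h; rewrite truncateE//; exact: hl. Qed.

Lemma truncate01 T l t x : loss_sequence M T l -> 0 <= truncate T l t x <= 1.
Proof.
move=> hl; rewrite /truncate; case: ifP => h; first exact: loss_ge0 hl h.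
by rewrite lexx ler01.
Qed.

Lemma state_at_truncate A T l (w : alg_space A) t : (t <= T)%N ->
  state_at (truncate T l) w t = state_at l w t.
Proof.
move=> tT; rewrite /state_at; congr respond; apply/eq_in_map => s.
rewrite mem_iota add1n ltnS => /andP[s1 st].
by rewrite truncateE// s1 (leq_trans st).
Qed.

Lemma cost_truncate A T l (w : alg_space A) t0 k : (t0 + k <= T)%N ->
  cost M (truncate T l) (state_at (truncate T l) w) t0 k = cost M l (state_at l w) t0 k.
Proof.
move=> kT; apply: cost_ext => t /andP[h1 h2]; have tT := leq_trans h2 kT.
  by rewrite truncateE// tT andbT (leq_ltn_trans _ h1).
by rewrite state_at_truncate.
Qed.

Section Combined.
Variables (B : online_alg M) (T : nat).

(** An algorithm is a function of the loss history, so the base and the plan are replayed from the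
    list; efficiency is the business of the program. *)
Definition combined_respond (wu : alg_space B * measurableTypeR R) (ls : seq (X -> R)) : X :=
  position M T (fun s => nth (fun _ => 0) ls s.-1) (fun s => respond wu.1 (take s ls))
    wu.2 (size ls).

Lemma combined_respondE l t wu :
  combined_respond wu [seq l s | s <- iota 1 t] =
  position M T l (state_at l wu.1) wu.2 t.
Proof.
rewrite /combined_respond size_map size_iota; apply: position_ext => s.
  case: s => // s /andP[_ st]; rewrite (nth_map 0%N) ?size_iota//= nth_iota//.
by move=> st; rewrite /state_at -map_take take_iota (minn_idPl st).
Qed.

(** A finite union of rectangles, one for each trajectory of the base algorithm. *)
Lemma combined_measurable l t x : loss_sequence M t l ->
  measurable [set wu | combined_respond wu [seq l s | s <- iota 1 t] = x].
Proof.
move=> hl; pose b (tr : {ffun 'I_t.+1 -> X}) s := tr (inord s).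
rewrite (_ : [set _ | _] = \bigcup_(tr in [set: {ffun 'I_t.+1 -> X}])
  ((@trajectory B l t @^-1` [set tr]) `*`
   [set u : measurableTypeR R | position M T l (b tr) u t = x])).
  apply: fin_bigcup_measurable; first exact: finite_finset.
  move=> tr _; apply: measurableX; first exact: measurable_trajectory.
  exact: measurable_position.
have bE (w : alg_space B) u : position M T l (b (trajectory l t w)) u t =
    position M T l (state_at l w) u t.
  by apply: position_ext => // s st; rewrite /b ffunE inordK.
apply/seteqP; split => -[w u] /=; rewrite combined_respondE/=.
  by move=> h; exists (trajectory l t w) => //; split => //=; rewrite bE.
by case=> tr _ [/= <-]; rewrite bE.
Qed.

Definition combined : online_alg M :=
  @OnlineAlg R X M _ (alg_space B * measurableTypeR R)%type
    (with_coin (alg_prob B)) combined_respond combined_measurable.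

Lemma combined_state l (wu : alg_space combined) t :
  state_at l wu t = position M T l (state_at l wu.1) wu.2 t.
Proof. exact: combined_respondE. Qed.

(** Tonelli: the coin is integrated first, for a fixed outcome of the base. [H] varies with that
    outcome because the cost of the base does. *)
Lemma combined_cost l t0 k (H : alg_space B -> R) :
  (0 < #|X|)%N -> (0 < T)%N ->
  loss_sequence M T l -> (forall t x, 0 <= l t x <= 1) -> (t0 + k <= T)%N ->
  measurable_fun setT (fun w => (H w)%:E) ->
  (forall w, \sum_(t0.+1 <= t < (t0 + k).+1) run_cost M T l (state_at l w) t <= H w) ->
  (expected_cost combined l t0 k <= \int[alg_prob B]_w (H w)%:E)%E.
Proof.
move=> X0 T0 hl l01 kT mH hH; rewrite /expected_cost unlock.
pose f (wu : alg_space B * measurableTypeR R) :=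
  (cost M l (state_at (A := combined) l wu) t0 k)%:E.
have mf : measurable_fun setT f := @measurable_cost combined l T t0 k hl kT.
have f0 wu : (0 <= f wu)%E by rewrite lee_fin (cost_seq_ge0 _ hl).
have -> : (\int[alg_prob combined]_w (cost M l (state_at l w) t0 k)%:E =
    \int[alg_prob B \x (@coin_law R)]_wu f wu)%E by [].
rewrite (fubini_tonelli1 f mf f0).
apply: ge0_le_integral => //.
- by move=> w _; apply: integral_ge0 => u _; exact: f0.
- exact: measurable_fun_fubini_tonelli_F.
move=> w _; apply: (@le_trans _ _
  (\sum_(t0.+1 <= t < (t0 + k).+1) run_cost M T l (state_at l w) t)%:E); last first.
  by rewrite lee_fin.
rewrite /fubini_F.
have -> : (fun u => f (w, u)) =
    (fun u => (cost M l (position M T l (state_at l w) u) t0 k)%:E).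
  by apply/funext => u; rewrite /f; congr EFin; apply: cost_ext => // t _; rewrite combined_state.
exact: position_cost_mean.
Qed.

End Combined.
End Trajectories.

(** * Guarantees *)

Section Constants.
Context {R : realType}.

Lemma trunc_log_le_ln n : (0 < n)%N -> (trunc_log 2 n)%:R <= 2 * ln (n%:R : R).
Proof.
move=> n0; have h : 2 ^+ trunc_log 2 n <= n%:R :> R by rewrite -natrX ler_nat trunc_logP.
have aux m : m%:R <= 2 * ln (2 ^+ m : R).
  elim: m => [|m IH]; first by rewrite expr0 ln1 mulr0.
  rewrite exprS lnM ?posrE ?exprn_gt0// -[m.+1%:R]natr1.
  by have := @ln_ge_1subV R 2 (ltr0n _ 2); lra.
apply: le_trans (aux _) _; rewrite ler_pM2l// ler_ln ?posrE ?exprn_gt0 ?ltr0n//.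
Qed.

Lemma ln2_ge : 2^-1 <= ln 2 :> R.
Proof. by have := @ln_ge_1subV R 2 (ltr0n _ 2); lra. Qed.

Lemma levels_le_ln T : (1 < T)%N -> (levels T)%:R <= 4 * ln (T%:R : R).
Proof.
move=> T1; rewrite /levels -natr1; have := trunc_log_le_ln (ltnW T1).
have : ln 2 <= ln (T%:R : R) by rewrite ler_ln ?posrE ?ltr0n ?ler_nat// ltnW.
by have := ln2_ge; lra.
Qed.

Lemma levels_le_ln_max T : (levels T)%:R <= 4 * ln ((maxn 2 T)%:R : R).
Proof.
have := @levels_le_ln (maxn 2 T); rewrite leq_max ltnSn => /(_ isT); apply: le_trans.
by rewrite ler_nat /levels ltnS leq_trunc_log// leq_maxr.
Qed.

(** With [y] and [z] the two roots on the right, the left side is at most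
    [22 * (1 + 2 * D) * y + 12 * z], and [y <= z] turns this into [44 * D * y + 34 * z]. *)
Lemma regret_constant (D : R) (N T k : nat) : 0 <= D -> (0 < N)%N -> (1 < T)%N ->
  11 * (bound D * Num.sqrt (k%:R * (levels T)%:R))
  + 4 * Num.sqrt ((1 + D) * k%:R * (levels T + (trunc_log 2 N).+1)%:R)
  <= 60 * (D * Num.sqrt (k%:R * ln T%:R)
           + Num.sqrt ((D + 1) * k%:R * ln (N * T)%:R)).
Proof.
move=> D0 N0 T1; have T0 := ltnW T1.
have hJ := levels_le_ln T1; set J := levels T in hJ *.
have lnT : 2^-1 <= ln (T%:R : R).
  by apply: le_trans ln2_ge _; rewrite ler_ln ?posrE ?ltr0n ?ler_nat.
have lnN : 0 <= ln (N%:R : R) by rewrite ln_ge0// ler1n.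
have lnNT : ln (N * T)%:R = ln N%:R + ln T%:R :> R.
  by rewrite natrM lnM ?posrE ?ltr0n.
set z := Num.sqrt ((D + 1) * k%:R * ln (N * T)%:R).
set y := Num.sqrt (k%:R * ln T%:R).
have y0 : 0 <= y := sqrtr_ge0 _; have z0 : 0 <= z := sqrtr_ge0 _.
have k0 : 0 <= k%:R :> R := ler0n _ _.
have ha : (J + (trunc_log 2 N).+1)%:R <= 9 * ln (N * T)%:R :> R.
  rewrite natrD -[(trunc_log 2 N).+1%:R]natr1 lnNT.
  by have := trunc_log_le_ln N0; lra.
have h1 : Num.sqrt (k%:R * J%:R) <= 2 * y.
  have -> : 2 * y = Num.sqrt (2 ^+ 2 * (k%:R * ln T%:R)).
    by rewrite sqrtrM ?sqr_ge0// sqrtr_sqr ger0_norm.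
  rewrite ler_wsqrtr// mulrCA ler_wpM2l//; lra.
have h2 : Num.sqrt ((1 + D) * k%:R * (J + (trunc_log 2 N).+1)%:R) <= 3 * z.
  have -> : 3 * z = Num.sqrt (3 ^+ 2 * ((D + 1) * k%:R * ln (N * T)%:R)).
    by rewrite sqrtrM ?sqr_ge0// sqrtr_sqr ger0_norm.
  rewrite ler_wsqrtr// mulrCA [1 + D]addrC ler_wpM2l ?mulr_ge0 ?addr_ge0//.
  by apply: le_trans ha _; lra.
have h3 : y <= z.
  have kN := mulr_ge0 k0 lnN; have lT : 0 <= ln (T%:R : R) by lra.
  have kT := mulr_ge0 k0 lT; have dN := mulr_ge0 D0 kN; have dT := mulr_ge0 D0 kT.
  by rewrite ler_wsqrtr// lnNT; lra.
have h4 : D * Num.sqrt (k%:R * J%:R) <= D * (2 * y) by rewrite ler_wpM2l.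
by rewrite /bound mulrDl mul1r; have := mulr_ge0 D0 y0; lra.
Qed.

End Constants.

Section Guarantees.
Context {R : realType} {X : finType}.
Variables (M : mts R X) (B : online_alg M) (T : nat).
Hypotheses (X0 : (0 < #|X|)%N).

Let D := diameter M.

Let D0 : 0 <= D. Proof. exact: diameter_ge0. Qed.

Let expected_cost_truncate (A : online_alg M) l t0 k : (t0 + k <= T)%N ->
  expected_cost A (truncate T l) t0 k = expected_cost A l t0 k.
Proof.
move=> kT; rewrite /expected_cost; congr expectation.
by apply/funext => w; rewrite cost_truncate.
Qed.

(** The single [D] pays the spurious movement from state 0 into step 1. *)
Lemma run_cost_horizon l (b : nat -> X) : (0 < T)%N -> (forall t x, 0 <= l t x <= 1) ->
  \sum_(1 <= t < T.+1) run_cost M T l b t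
  <= cost M l b 0 T + (D + 5 * bound D).
Proof.
move=> T0 l01; have lb := index_loss_bounds X0 l01.
apply: le_trans (cost_at_horizon (fun t => state_index (b t)) X0 T0 (index_dist_bounds M X0) lb) _.
rewrite addrA lerD2r /cost.
have c0 t : cost_at #|X| T D (index_dist M) (fun t => index_loss (l t))
    (fun t => state_index (b t)) 0 t.+1 =
  l t.+1 (b t.+1) + index_dist M (state_index (b t.+1))
    (pl_b (run_plan M T l b t)).
  by rewrite /cost_at /= index_loss_state.
have moves m : \sum_(0 <= t < m.+1) index_dist M (state_index (b t.+1))
      (pl_b (run_plan M T l b t)) <= \sum_(2 <= t < m.+2) dist M (b t) (b t.-1) + D.
  rewrite big_ltn//= addrC lerD//; last first.
    by case/andP: (index_dist_bounds M X0 (state_index (b 1)) 0).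
  rewrite [leRHS]big_add1/= !big_nat; apply: ler_sum => -[//|t] _.
  by rewrite index_dist_state.
apply: (@le_trans _ _ (\sum_(0 <= t < T) (l t.+1 (b t.+1)
    + index_dist M (state_index (b t.+1)) (pl_b (run_plan M T l b t))))).
  rewrite big_add1 le_eqVlt; apply/orP; left; apply/eqP/eq_bigr => t _; exact: c0.
have := moves T.-1; rewrite prednK// => h.
rewrite big_split/= add0n -addrA [X in _ <= X + _]big_add1/= lerD2l; exact: h.
Qed.

Lemma combined_competitive l : loss_sequence M T l ->
  (expected_cost (combined B T) l 0 T
   <= expected_cost B l 0 T + (D + 5 * bound D)%:E)%E.
Proof.
have C0 : 0 <= D + 5 * bound D by rewrite /bound; have := D0; lra.
have [->|T0] := posnP T.
  move=> hl; apply: (@le_trans _ _ 0%E).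
    by apply: (expected_cost_const hl) => // w; rewrite /cost !big_geq// addr0.
  rewrite adde_ge0 ?lee_fin//; rewrite /expected_cost unlock.
  by apply: integral_ge0 => w _; rewrite lee_fin (cost_seq_ge0 _ hl).
move=> hl; rewrite -(expected_cost_truncate (combined B T)) ?add0n// -(expected_cost_truncate B) ?add0n//.
have htl := truncate_sequence hl.
have mB : measurable_fun setT
    (fun w : alg_space B => (cost M (truncate T l) (state_at (truncate T l) w) 0 T)%:E).
  by apply: (measurable_cost (A := B) htl); rewrite add0n.
apply: le_trans (combined_cost (H := fun w =>
    cost M (truncate T l) (state_at (truncate T l) w) 0 T + (D + 5 * bound D)) X0 T0 htl _ _ _ _) _.
- by move=> t x; apply: truncate01 hl.
- by rewrite add0n.
- under eq_fun do rewrite EFinD.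
  by apply: emeasurable_funD.
- move=> w; rewrite add0n; apply: run_cost_horizon => // t x; exact: truncate01 hl.
under eq_integral do rewrite EFinD.
rewrite ge0_integralD//; first last.
- by move=> w _; rewrite lee_fin (cost_seq_ge0 _ htl)// add0n.
- by rewrite /expected_cost unlock integral_cst// [X in (_ * X)%E]probability_setT mule1.
Qed.

Lemma combined_interval l t0 k x : loss_sequence M T l -> (0 < T)%N -> (t0 + k <= T)%N ->
  (expected_cost (combined B T) l t0 k
   <= (\sum_(t0.+1 <= t < (t0 + k).+1) l t x +
       60 * (D * Num.sqrt (k%:R * ln T%:R)
             + Num.sqrt ((D + 1) * k%:R * ln (#|X| * T)%:R)))%:E)%E.
Proof.
move=> hl T0 kT; have l0 t : (t0.+1 <= t < (t0 + k).+1)%N -> forall y, 0 <= l t y <= 1.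
  move=> /andP[h1 h2] y; apply: loss_ge0 hl _.
  by rewrite (leq_trans _ kT)// andbT (leq_trans _ h1).
(* [T = 1] is separate: [ln T] is then 0 and cannot bound the number of levels. *)
have [T1|T1] := leqP T 1; last first.
  rewrite -expected_cost_truncate//; have htl := truncate_sequence hl.
  have t01 t y : 0 <= truncate T l t y <= 1 by apply: truncate01 hl.
  have lb := index_loss_bounds X0 t01.
  set c := \sum_(_ <= t < _) _ + _.
  apply: le_trans (combined_cost (H := fun=> c) X0 T0 htl t01 kT _ _) _ => //.
    move=> w; have xN : (state_index x < #|X|)%N by rewrite cardE index_mem mem_enum.
    apply: le_trans (cost_at_interval (fun t => state_index (state_at (truncate T l) w t))
      X0 T0 (index_dist_bounds M X0) lb (Ordinal xN) kT) _.
    rewrite -addrA /c; apply: lerD; last exact: regret_constant.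
    rewrite le_eqVlt; apply/orP; left; apply/eqP; apply: eq_big_nat => t /andP[h1 h2].
    rewrite /= index_loss_state truncateE// (leq_trans _ kT)// andbT.
    exact: leq_trans h1.
  by rewrite integral_cst// [X in (_ * X)%E]probability_setT mule1.
have TE : T = 1%N by apply/eqP; rewrite eqn_leq T1 T0.
apply: (expected_cost_const hl kT) => w; set i := state_at l w.
set r := 60 * _; have r0 : 0 <= r by rewrite mulr_ge0// addr_ge0 ?mulr_ge0 ?sqrtr_ge0.
case: k kT l0 @r r0 => [|k] kT l0 r r0; first by rewrite /cost !addn0 !big_geq// addr0 add0r.
have [t00 k00] : t0 = 0%N /\ k = 0%N by split; lia.
rewrite /cost t00 k00 big_nat1 big_geq// addr0 big_nat1.
have := l0 1%N; rewrite t00 k00 => /(_ isT) l1.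
(* With one state the allowed regret is 0, but there is no choice either; with more, it is at least
   30, while a single loss is at most 1. *)
have [X1|X1] := leqP #|X| 1.
  have -> : i 1%N = x by apply: (fintype_le1P X1).
  by rewrite lerDl.
have := l1 x; have := l1 (i 1%N); suff : 1 <= r by lra.
have s2 : 2^-1 <= Num.sqrt ((D + 1) * k.+1%:R * ln (#|X| * T)%:R).
  apply: le_sqrt_of_sqr; first by rewrite invr_ge0.
  have : 2^-1 <= ln (#|X| * T)%:R :> R.
    apply: le_trans ln2_ge _; rewrite TE muln1 ler_ln ?posrE ?ltr0n ?ler_nat//.
  by rewrite k00 mulr1; have := D0; set u := ln _ => *; nra.
rewrite /r; have : 0 <= D * Num.sqrt (k.+1%:R * ln T%:R) by rewrite mulr_ge0 ?sqrtr_ge0.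
lra.
Qed.

Lemma combined_implemented : (0 < T)%N ->
  implemented_on_top_of T B (combined B T) (prog_round (trunc_log 2 #|X|).+1)
    ((4 * round_constant)%:R * #|X|%:R * ln (maxn 2 T)%:R).
Proof.
move=> T0; exists fst, 1%N, (fun _ wu => wu.2); split.
- exact: measurable_fst.
- by move=> _; exact: measurable_snd.
- move=> S V mS mV; rewrite big_ord_recl big_ord0 mule1.
  rewrite -[RHS](with_coinX (alg_prob B) mS (mV 0%N)).
  congr (with_coin (alg_prob B) _); apply/seteqP; split => -[w u] /=.
    by case=> Sw h; split => //; apply: (h 0%N).
  by case=> Sw Vu; split => // -[].
move=> l [w u] hl /=.
pose b := state_at l w; pose inp t := round_input M T (l t) (b t).
(* The blank store does not satisfy [represents], as its flag is not set; hence the separate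
   case. *)
pose ok t s := if t is 0 then s = initial_store [:: u]
  else represents (inp t) (run_plan M T l b t) (run_chain M T l b t u) s.
pose n : R := (4 * round_constant)%:R * #|X|%:R * ln (maxn 2 T)%:R.
have timeE t : (round_time (inp t))%:R <= n.
  apply: (@le_trans _ _ (round_constant * (#|X| * levels T))%:R).
    by rewrite ler_nat; apply: round_time_le.
  rewrite /n !natrM; have := levels_le_ln_max (R := R) T => h.
  rewrite (_ : _ * _ * _ = round_constant%:R * (#|X|%:R * (4 * ln (maxn 2 T)%:R))); last by ring.
  by rewrite !ler_wpM2l.
(* Stated for all stores, with an arbitrary successor when [ok] fails, so that [choice] yields one
   function whose iterates form [sigma]. *)
have step (ts : nat * store R) : exists s' : store R, ok ts.1 ts.2 ->
    exists k : nat, [/\ k%:R <= n, exec (inp ts.1.+1) (prog_round (trunc_log 2 #|X|).+1) ts.2 k s',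
      icell s' 0 = state_index (position M T l b u ts.1.+1) & ok ts.1.+1 s'].
  case: ts => t s /=; have [h|h] := pselect (ok t s); last by exists s.
  have place_index (e : nat) : (if (e < #|X|)%N then e else state_index (b t.+1))
      = state_index (place (b t.+1) e).
    rewrite /place; case: ifP => // eN.
    by rewrite /state_index index_uniq ?enum_uniq// -cardE.
  suff [k [s' [kn ex [rep outp]]]] : runs (inp t.+1) (prog_round (trunc_log 2 #|X|).+1) s
      (round_time (inp t.+1)) (fun s' =>
        represents (inp t.+1) (run_plan M T l b t.+1) (run_chain M T l b t.+1 u) s' /\
        icell s' 0 = (if ((run_chain M T l b t.+1 u).1 < #|X|)%N
                      then (run_chain M T l b t.+1 u).1 else state_index (b t.+1))).
    exists s' => _; exists k; split => //.
      by apply: le_trans (timeE t.+1); rewrite ler_nat.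
    by rewrite outp place_index.
  case: t h {place_index} => [->|t h].
    apply: runs_seq (prog_init_first (inp 1%N) u) _ => s1 rep.
    exact: (prog_round_after_init (inp := inp 1%N) T0 (leqnn _) rep).
  have h' : represents (inp t.+2) (run_plan M T l b t.+1)
    ((run_chain M T l b t.+1 u).1, (run_chain M T l b t.+1 u).2) s by rewrite -surjective_pairing.
  apply: (prog_round_again (inp := inp t.+2) T0 _ h').
  exact: chain_le.
have [f hf] := choice step.
pose sigma := fix sigma t := if t is t'.+1 then f (t', sigma t') else initial_store [:: u].
have sok t : ok t (sigma t).
  by elim: t => [//|t IH]; have [k [_ _ _ h]] := hf (t, sigma t) IH.
exists sigma; split => // -[//|t] _; have [k [h1 h2 h3 _]] := hf (t, sigma t) (sok t).
exists k; split => //.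
by rewrite [LHS]h3 -(@combined_state R X M B T l (w, u) t.+1).
Qed.

End Guarantees.

Theorem corollary2p4 (R : realType) :
  exists C K : R, [/\ 0 < C, 0 < K &
  forall (X : finType) (M : mts R X) (Abase : nat -> online_alg M) (alpha : R),
    (0 < #|X|)%N ->
    has_competitive_ratio Abase alpha ->
    exists (A : nat -> online_alg M) (prog : cmd),
    [/\ has_competitive_ratio A alpha,
        forall T t0 k : nat, (0 < T)%N -> (t0 + k <= T)%N ->
          (regret (A T) T t0 k <=
             (C * (diameter M * Num.sqrt (k%:R * ln T%:R)
                   + Num.sqrt ((diameter M + 1) * k%:R
                               * ln (#|X| * T)%:R)))%:E)%E
      & forall T : nat, (0 < T)%N ->
          implemented_on_top_of T (Abase T) (A T) prog
            (K * #|X|%:R * ln (maxn 2 T)%:R)]].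
Proof.
exists 60, (4 * round_constant)%:R; split => //.
move=> X M Abase alpha X0 [alpha1 [beta beta0 hbase]].
exists (fun T => combined (Abase T) T), (prog_round (trunc_log 2 #|X|).+1); split.
- split => //; have D0 := diameter_ge0 M X0.
  exists (beta + (diameter M + 5 * bound (diameter M))).
    by rewrite /bound; lra.
  move=> T l hl; apply: le_trans (combined_competitive (Abase T) X0 hl) _.
  rewrite [(beta + _)%:E]EFinD addeA; apply: leeD => //; exact: hbase.
(* The regret is an infimum, so it is enough that the bound is admissible, and admissibility is
   checked against each fixed state. *)
- move=> T t0 k T0 kT; apply: ereal_inf_lbound; eexists; last reflexivity.
  move=> l hl; rewrite -leeBlDr//; apply: le_ereal_inf_tmp => _ [x _ <-].
  by rewrite leeBlDr// -EFinD; exact: combined_interval.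
- by move=> T T0; exact: combined_implemented.
Qed.
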